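(* Let $N\in\mathbb N_0$ and let $\sigma\in L^\infty(\mathbb{R}^n\times\mathbb{R}^n)\cap\mathcal C^\infty(\{(\xi,\eta)\in\mathbb{R}^n\times\mathbb{R}^n:|\xi||\eta|\ne0\})$ satisfy $|\partial_1^{\alpha_1}\partial_2^{\alpha_2}\sigma(\xi,\eta)|\le C_{\alpha_1,\alpha_2}|\xi|^{-|\alpha_1|}|\eta|^{-|\alpha_2|}$ for all multiindices and all $\xi\ne0,\eta\ne0$. Assume that for all $a_1,a_2\in\mathcal O_N(\mathbb{R}^n)$ there is a locally integrable $b$ with $b(x)\le C|x|^{-2n-N-1}$ for large $|x|$ and $|T_\sigma(a_1,a_2)(x)|\le b(x)$ for all $x$. Then the following are equivalent: (a) For all $\alpha\in\mathbb N_0^n$ with $|\alpha|\le N$ and all $\xi_1\in\mathbb{R}^n\setminus\{0\}$, $\partial_2^\alpha\sigma(\xi_1,-\xi_1)=0$. (b) For all $a_1,a_2\in\mathcal O_N(\mathbb{R}^n)$ and all $|\alpha|\le N$, $\int_{\mathbb{R}^n}x^\alpha T_\sigma(a_1,a_2)(x)\,dx=0$.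
   Context: $\widehat f(\xi)=\int f(x)e^{-2\pi ix\cdot\xi}dx$. $T_\sigma(f_1,f_2)(x)=\int_{\mathbb{R}^{2n}}e^{2\pi ix\cdot(\xi_1+\xi_2)}\sigma(\xi_1,\xi_2)\widehat{f_1}(\xi_1)\widehat{f_2}(\xi_2)\,d\xi_1d\xi_2$. $\partial_1^\alpha,\partial_2^\alpha$ denote partial derivatives of order $\alpha$ in the first and second $\mathbb{R}^n$-variable respectively. $\mathcal O_N(\mathbb{R}^n)=\{f\in\mathcal C_c^\infty(\mathbb{R}^n):\int x^\beta f(x)dx=0\ \forall|\beta|\le N\}$. *)

(* Defs.v *)
From HB Require Import structures.
From mathcomp Require Import all_boot all_order all_algebra.
From mathcomp Require Import all_classical all_reals all_analysis.
From mathcomp Require Import complex.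
Set Implicit Arguments. Unset Strict Implicit. Unset Printing Implicit Defensive.
Import Order.TTheory GRing.Theory Num.Theory.
Import numFieldNormedType.Exports.
Local Open Scope classical_set_scope.
Local Open Scope ring_scope.

Section Defs.
Variable R : realType.

Definition C := R[i].

Definition Rn (m : nat) := 'rV[R]_m.
Definition borelRn (m : nat) := g_sigma_algebraType (@open ('rV[R]_m)).

Definition dotp m (x y : 'rV[R]_m) : R := \sum_(i < m) x 0 i * y 0 i.
Definition enorm m (x : 'rV[R]_m) : R := Num.sqrt (dotp x x).

Definition cabs (z : C) : R := Num.sqrt (complex.Re z ^+ 2 + complex.Im z ^+ 2).
Definition cexpi (t : R) : C := Complex (cos t) (sin t).

Definition box m (a b : 'rV[R]_m) : set (borelRn m) :=
  [set x : 'rV[R]_m | forall i, a 0 i <= x 0 i < b 0 i].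
Definition boxvol m (a b : 'rV[R]_m) : R := \prod_(i < m) Num.max 0 (b 0 i - a 0 i).
Definition leb m (A : set (borelRn m)) : \bar R :=
  ereal_inf [set (\sum_(k <oo) ((boxvol (ab k).1 (ab k).2)%:E))%E |
    ab in [set ab : nat -> 'rV[R]_m * 'rV[R]_m |
            A `<=` \bigcup_k box (ab k).1 (ab k).2]].

Definition Rint m (f : 'rV[R]_m -> R) : R :=
  fine (\int[@leb m]_(x in [set: borelRn m]) (f x)%:E)%E.
Definition cint m (f : 'rV[R]_m -> C) : C :=
  Complex (Rint (fun x => complex.Re (f x))) (Rint (fun x => complex.Im (f x))).

Definition mlen m (al : 'I_m -> nat) : nat := (\sum_(i < m) al i)%N.
Definition mono m (al : 'I_m -> nat) (x : 'rV[R]_m) : R := \prod_(i < m) x 0 i ^+ al i.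

Definition ev m (j : 'I_m) : 'rV[R]_m := delta_mx 0 j.
Definition pdseq m (ds : seq 'I_m) (g : 'rV[R]_m -> R) : 'rV[R]_m -> R :=
  foldr (fun j h => fun x => derive h x (ev j)) g ds.
Definition pdiff m (al : 'I_m -> nat) (g : 'rV[R]_m -> R) :=
  pdseq (flatten [seq nseq (al j) j | j <- enum 'I_m]) g.
Definition cpdiff m (al : 'I_m -> nat) (g : 'rV[R]_m -> C) : 'rV[R]_m -> C :=
  fun x => Complex (pdiff al (fun y => complex.Re (g y)) x)
                   (pdiff al (fun y => complex.Im (g y)) x).

Definition smooth_on m (U : set 'rV[R]_m) (g : 'rV[R]_m -> R) :=
  forall ds : seq 'I_m, forall x, U x ->
    (forall j, derivable (pdseq ds g) x (ev j)) /\ {for x, continuous (pdseq ds g)}.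
Definition csmooth_on m (U : set 'rV[R]_m) (g : 'rV[R]_m -> C) :=
  smooth_on U (fun x => complex.Re (g x)) /\ smooth_on U (fun x => complex.Im (g x)).

Definition uncurry2 n (s : 'rV[R]_n -> 'rV[R]_n -> C) : 'rV[R]_(n + n) -> C :=
  fun z => s (lsubmx z) (rsubmx z).
Definition mcat n (a1 a2 : 'I_n -> nat) : 'I_(n + n) -> nat :=
  fun k => match fintype.split k with inl i => a1 i | inr i => a2 i end.
Definition pd12 n (a1 a2 : 'I_n -> nat) (s : 'rV[R]_n -> 'rV[R]_n -> C) xi eta : C :=
  cpdiff (mcat a1 a2) (uncurry2 s) (row_mx xi eta).

Definition lmeasurable m (f : 'rV[R]_m -> R) :=
  exists Z : set (borelRn m), [/\ measurable Z, leb Z = 0%E &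
     measurable_fun (~` Z) (f : borelRn m -> R)].
Definition Linfty m (f : 'rV[R]_m -> C) :=
  lmeasurable (fun x => complex.Re (f x)) /\ lmeasurable (fun x => complex.Im (f x)) /\
  exists M : R, exists Z : set (borelRn m), [/\ measurable Z, leb Z = 0%E &
     forall x, ~ Z x -> cabs (f x) <= M].
Definition loc_integrable m (f : 'rV[R]_m -> R) :=
  exists Z : set (borelRn m), [/\ measurable Z, leb Z = 0%E,
     measurable_fun (~` Z) (f : borelRn m -> R) &
     forall K : set 'rV[R]_m, compact K ->
       (\int[@leb m]_(x in (K `\` Z : set (borelRn m))) `|f x|%:E < +oo)%E].

Definition fourier n (f : 'rV[R]_n -> C) (xi : 'rV[R]_n) : C :=
  cint (fun x => f x * cexpi (- (2 * pi * dotp x xi))).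

Definition Tsig n (s : 'rV[R]_n -> 'rV[R]_n -> C) (f1 f2 : 'rV[R]_n -> C) (x : 'rV[R]_n) : C :=
  cint (fun z : 'rV[R]_(n + n) =>
    cexpi (2 * pi * dotp x (lsubmx z + rsubmx z)) * s (lsubmx z) (rsubmx z)
    * fourier f1 (lsubmx z) * fourier f2 (rsubmx z)).

Definition ON n (N : nat) (f : 'rV[R]_n -> C) :=
  [/\ csmooth_on setT f, compact (closure [set x | f x != 0]) &
      forall be : 'I_n -> nat, (mlen be <= N)%N ->
        cint (fun x => Complex (mono be x) 0 * f x) = 0].
End Defs.

(* Main.v *)
(* With [A = ft a1], put [D xi eta = sigma xi eta * ft a2 eta] and extend it by 0 to
   the axes.  The Fourier transform of [T = Tsig sigma a1 a2] is then
   [H z = int A xi * D xi (z - xi) dxi], by Fourier inversion.  The vanishing moments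
   of [a2] give [ft a2] a zero of order [N + 1] at 0, which compensates the blow-up of
   the derivatives of [sigma]: so [D xi] has bounded eta-derivatives up to order [N],
   also across [eta = 0].  The decay of [T] makes [x^al T] integrable for [|al| <= N],
   hence both expressions of the Fourier transform can be differentiated under the
   integral sign, and up to a constant the [al]-th moment of [T] is
   [int A xi * (d_eta^al D xi) (- xi) dxi].  By the Leibniz rule (a) implies (b).

   Conversely, by induction on [|al|] the Leibniz expansion at [- xi] reduces to its
   term [d_2^al sigma xi (- xi) * ft a2 (- xi)].  Testing with all translates of the
   [N + 1]-st derivative of a bump function in place of [a1] shows that
   [A xi * d_2^al sigma xi (- xi) * ft a2 (- xi)] has zero Fourier transform, so it
   vanishes; and the two transforms can be chosen nonzero at a given point.

   In dimension 0, [leb] is identically [+oo], so the hypothesis on null sets in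
   [Linfty] is contradictory. *)

Require Import Defs.
From HB Require Import structures.
From mathcomp Require Import all_boot all_order all_algebra.
From mathcomp Require Import all_classical all_reals all_analysis.
From mathcomp Require Import complex.
From mathcomp Require Import measurable_realfun ring lra.
Set Implicit Arguments. Unset Strict Implicit. Unset Printing Implicit Defensive.
Import Order.TTheory GRing.Theory Num.Theory.
Import numFieldNormedType.Exports.
Local Open Scope classical_set_scope.
Local Open Scope ring_scope.

(** * Lebesgue measure on R^n *)

(** [leb] is only given as an infimum over covers by boxes, so its additivity on Borel sets, its
    values on boxes, products and scaling have to be derived from that. No measurability of
    [Tsig sigma a1 a2] is assumed: it is extracted from its form as an inverse Fourier transform.
    The decay exponent 2n + N + 1 exceeds |al| by at least 2n + 1, so x^al T is dominated by a
    multiple of the weight prod_i 1/(1 + x_i^2), the integrable majorant used throughout. Up to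
    scaling this weight is also the transform of exp(-|x_1| - ... - |x_n|), which replaces the
    Gaussian in Fourier inversion because an explicit primitive computes its transform. A derivative
    of order N + 1 has vanishing moments up to order N by integration by parts, and its transform is
    (2 pi i xi_i)^(N+1) times that of the bump. At a given xi <> 0 this is nonzero once xi_i <> 0
    and the bump is concentrated enough. Translating [a1] by - x multiplies its transform by exp(2
    pi i x . xi); so one vanishing integral, known for all test functions, becomes the vanishing of
    an entire inverse transform. *)

Section Boxes.
Variables (R : realType) (m : nat).
Implicit Types a b x : 'rV[R]_m.

Lemma boxvol_ge0 a b : 0 <= boxvol a b.
Proof. by apply: prodr_ge0 => i _; rewrite le_max lexx. Qed.

Lemma box_setI a b c d : box a b `&` box c d =
  box (\row_i Num.max (a 0 i) (c 0 i)) (\row_i Num.min (b 0 i) (d 0 i)).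
Proof.
apply/seteqP; split=> x /=.
  move=> [h1 h2] i; rewrite !mxE ge_max lt_min.
  by move: (h1 i) (h2 i) => /andP[-> ->] /andP[-> ->].
move=> h; split=> i; move: (h i); rewrite !mxE ge_max lt_min.
  by move=> /andP[/andP[-> _] /andP[-> _]].
by move=> /andP[/andP[_ ->] /andP[_ ->]].
Qed.

(** The boxes with rational corners inside [U] cover it; [unpickle] enumerates the pairs of corners.
    The alternative [set0] matters in dimension 0, where every box is the whole one-point space. *)
Lemma open_box_bigcup (U : set 'rV[R]_m) : open U ->
  exists F : nat -> set 'rV[R]_m,
    (forall k, F k = set0 \/ exists a b, F k = box a b) /\ U = \bigcup_k F k.
Proof.
move=> oU.
pose rr (q : 'rV[rat]_m) : 'rV[R]_m := \row_i ratr (q 0 i).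
exists (fun k => if unpickle k is Some (p, q) then
   if `[< box (rr p) (rr q) `<=` U >] then box (rr p) (rr q) else set0
   else set0 : set 'rV[R]_m).
split.
  move=> k; case: unpickle => [[p q]|]; last by left.
  by case: ifPn => _; [right; exists (rr p), (rr q)|left].
apply/seteqP; split=> x.
  move=> Ux; have /nbhs_ballP[e /= e0 he] := open_nbhs_nbhs (conj oU Ux).
  have h1 i : {q : rat | ratr q \in `](x 0 i - e), (x 0 i)[}.
    by apply/cid; apply: rat_in_itvoo; rewrite ltrBlDr ltrDl.
  have h2 i : {q : rat | ratr q \in `](x 0 i), (x 0 i + e)[}.
    by apply/cid; apply: rat_in_itvoo; rewrite ltrDl.
  pose p : 'rV[rat]_m := \row_i sval (h1 i).
  pose q : 'rV[rat]_m := \row_i sval (h2 i).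
  exists (pickle (p, q)) => //; rewrite pickleK.
  have -> : `[< box (rr p) (rr q) `<=` U >].
    apply/asboolP => y hy; apply: he; split=> [//|i j]; rewrite (ord1 i).
    move: (hy j); rewrite !mxE /ball /=.
    move: (svalP (h1 j)) (svalP (h2 j)); rewrite !in_itv /=.
    move=> /andP[A1 A2] /andP[A3 A4] /andP[A5 A6].
    rewrite ltr_distlC; apply/andP; split; lra.
  move=> i; rewrite !mxE.
  move: (svalP (h1 i)) (svalP (h2 i)); rewrite !in_itv /=.
  by move=> /andP[_ /ltW ->] /andP[-> _].
move=> [k _]; case: unpickle => [[p q]|] //.
by case: ifPn => // /asboolP; apply.
Qed.

Definition boxes : set (set (borelRn R m)) := [set A | exists a b, A = box a b].

Lemma open_borel (U : set 'rV[R]_m) : open U -> measurable (U : set (borelRn R m)).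
Proof. exact: sub_sigma_algebra. Qed.

Lemma continuous_on_measurable (U : set 'rV[R]_m) (f : 'rV[R]_m -> R) :
  open U -> (forall x, U x -> {for x, continuous f}) ->
  measurable_fun (U : set (borelRn R m)) (f : borelRn R m -> R).
Proof.
move=> oU cf; apply: (measurability _ (RGenOpens.measurableE R)).
move=> _ [_ [a [b ->] <-]]; apply: open_borel.
rewrite openE => x [Ux fx]; apply: filterI; first exact: open_nbhs_nbhs.
apply: cf => //; apply: open_nbhs_nbhs; split => //; exact: interval_open.
Qed.

Lemma continuous_borel_measurable (f : 'rV[R]_m -> R) :
  continuous f -> measurable_fun setT (f : borelRn R m -> R).
Proof.
by move=> cf; apply: continuous_on_measurable; [exact: openT|move=> x _; exact: cf].
Qed.

Lemma coord_measurable (i : 'I_m) :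
  measurable_fun setT (fun x : borelRn R m => x 0 i : R).
Proof. apply: continuous_borel_measurable; exact: coord_continuous. Qed.

Lemma box_measurable a b : measurable (box a b : set (borelRn R m)).
Proof.
rewrite (_ : box a b = \bigcap_(i in [set: 'I_m])
   ((fun x : borelRn R m => x 0 i : R) @^-1` `[a 0 i, b 0 i[)).
  apply: fin_bigcap_measurable; first exact: finite_finset.
  by move=> i _; rewrite -[X in measurable X]setTI; apply: coord_measurable.
apply/seteqP; split=> x /=.
  by move=> h i _; rewrite /= in_itv /=; exact: h.
by move=> h i; have := h i I; rewrite /= in_itv.
Qed.

Lemma borelRn_boxes : (@measurable _ (borelRn R m)) = <<s boxes >>.
Proof.
apply/seteqP; split.
  apply: smallest_sub; first exact: smallest_sigma_algebra.
  move=> U /open_box_bigcup[F [hF ->]].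
  apply: sigma_algebra_bigcup => k.
  case: (hF k) => [->|[a [b ->]]].
    exact: sigma_algebra0.
  by apply: sub_sigma_algebra; exists a, b.
apply: smallest_sub; first exact: sigma_algebra_measurable.
by move=> _ [a [b ->]]; exact: box_measurable.
Qed.

Lemma boxes_setI : setI_closed boxes.
Proof.
by move=> _ _ [a [b ->]] [c [d ->]]; rewrite box_setI; eexists _, _.
Qed.

Lemma boxes_cover : \bigcup_k (box (const_mx (- k%:R)) (const_mx k%:R) : set (borelRn R m)) = setT.
Proof.
apply/seteqP; split=> // x _.
exists (Num.truncn (\sum_i `|x 0 i|)).+1 => // i; rewrite !mxE.
have h : `|x 0 i| < (Num.truncn (\sum_i `|x 0 i|)).+1%:R.
  apply: le_lt_trans (truncnS_gt _).
  by rewrite (bigD1 i) //= lerDl sumr_ge0.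
by move: h; rewrite ltr_norml => /andP[/ltW -> ->].
Qed.

Lemma boxvol_measure_unique (m1 m2 : {measure set (borelRn R m) -> \bar R}) :
  (forall a b, m1 (box a b) = m2 (box a b)) ->
  (forall a b, m1 (box a b) < +oo)%E ->
  forall A, measurable A -> m1 A = m2 A.
Proof.
move=> h12 hoo A mA.
apply: (measure_unique boxes
  (fun k => box (const_mx (- k%:R)) (const_mx k%:R) : set (borelRn R m))) => //.
- exact: borelRn_boxes.
- exact: boxes_setI.
- by move=> i; eexists _, _.
- exact: boxes_cover.
- by move=> _ [a [b ->]]; exact: h12.
Qed.

Lemma measurable_fun_rV d (T : measurableType d) (D : set T) (g : T -> 'rV[R]_m) :
  (forall i, measurable_fun D (fun t => g t 0 i)) ->
  measurable_fun D (g : T -> borelRn R m).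
Proof.
move=> h mD; suff : measurable_fun D (g : T -> borelRn R m) by exact.
apply: (measurability _ borelRn_boxes) => // _ [_ [a [b ->]] <-].
rewrite (_ : _ `&` _ = \bigcap_(i in [set: 'I_m])
     (D `&` (fun t => g t 0 i) @^-1` `[a 0 i, b 0 i[) `&` D).
  apply: measurableI => //.
  apply: fin_bigcap_measurable; first exact: finite_finset.
  by move=> i _; apply: h => //; exact: measurable_itv.
apply/seteqP; split=> x /=.
  by move=> [Dx hx]; split=> // i _ /=; split => //; rewrite in_itv /=; exact: hx.
move=> [hx Dx]; split => // i; have /= [] := hx i I.
by rewrite in_itv.
Qed.

End Boxes.

Section Leb.
Variables (R : realType).

Lemma leb_ge0 m (A : set (borelRn R m)) : (0 <= leb A)%E.
Proof.
apply: le_ereal_inf_tmp => _ [ab _ <-].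
by apply: nneseries_ge0 => k _ _; rewrite lee_fin boxvol_ge0.
Qed.

Lemma leb_mono m (A B : set (borelRn R m)) : A `<=` B -> (leb A <= leb B)%E.
Proof.
move=> AB; apply: ereal_inf_le_tmp => _ [ab hB <-].
by exists ab => //; exact: subset_trans AB hB.
Qed.

Lemma boxvol0 m (a : 'rV[R]_m.+1) : boxvol a a = 0.
Proof. by rewrite /boxvol (bigD1 ord0) //= subrr maxxx mul0r. Qed.

Lemma box0 m (a : 'rV[R]_m.+1) : box a a = set0.
Proof.
rewrite -subset0 => x /(_ ord0) /andP[h1 h2].
by have := le_lt_trans h1 h2; rewrite ltxx.
Qed.

Lemma leb_box_le m (a b : 'rV[R]_m.+1) : (leb (box a b) <= (boxvol a b)%:E)%E.
Proof.
apply: ereal_inf_lbound; exists (fun k => if k is 0%N then (a, b) else (a, a)).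
  by move=> x hx; exists 0%N.
apply/cvg_lim => //; apply: (@cvg_near_cst _ _ _ _ _ _); near=> n.
have -> : n = n.-1.+1 by rewrite prednK //; near: n; exact: nbhs_infty_gt.
by rewrite big_nat_recl //= big1 ?adde0 // => i _; rewrite boxvol0.
Unshelve. all: by end_near.
Qed.

Lemma leb0 m : leb (set0 : set (borelRn R m.+1)) = 0%E.
Proof.
apply/eqP; rewrite eq_le leb_ge0 andbT -(box0 0).
by rewrite (le_trans (leb_box_le _ _)) // boxvol0.
Qed.

(** Choose for each [A n] a cover that is optimal up to e / 2^(n+1). A bijection of nat with nat *
    nat lists all these boxes as one cover of the union, and the double series is rearranged as a
    sum over pairs. *)
Lemma leb_sigma_subadditive m :
  sigma_subadditive (@leb R m).
Proof.
move=> A; have [[i ioo]|] := pselect (exists i, leb (A i) = +oo%E).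
  rewrite (eseries_pinfty _ _ ioo) ?leey// => n _.
  by rewrite -ltNye (lt_le_trans _ (leb_ge0 _)).
rewrite -forallNE => Aoo.
apply/lee_addgt0Pr => e e0.
apply: le_trans (epsilon_trick _ _ (ltW e0)); last by move=> k; exact: leb_ge0.
have hG n : {ab : nat -> 'rV[R]_m * 'rV[R]_m |
    A n `<=` \bigcup_k box (ab k).1 (ab k).2 /\
    (\sum_(k <oo) ((boxvol (ab k).1 (ab k).2)%:E) <=
     leb (A n) + (e / (2 ^ n.+1)%:R)%:E)%E}.
  apply/cid.
  have fA : leb (A n) \is a fin_num.
    by rewrite ge0_fin_numE ?leb_ge0 // ltey; apply/eqP.
  have en : 0 < e / (2 ^ n.+1)%:R by rewrite divr_gt0 // ltr0n expn_gt0.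
  have [_ [ab hab <-] hlt] := lb_ereal_inf_adherent en fA.
  by exists ab; split => //; exact: ltW.
pose G n := sval (hG n).
have G0 n k : (0 <= (boxvol (G n k).1 (G n k).2)%:E)%E by rewrite lee_fin boxvol_ge0.
have /card_esym/ppcard_eqP[f] := card_nat2.
apply: (@le_trans _ _
   (\sum_(k <oo) (boxvol (G (f k).1 (f k).2).1 (G (f k).1 (f k).2).2)%:E)%E).
  apply: ereal_inf_lbound; exists (fun k => G (f k).1 (f k).2) => //.
  move=> x [n _] /(svalP (hG n)).1 [k _ hk].
  by exists (f^-1%FUN (n, k)) => //; rewrite invK ?inE.
pose v (p : nat * nat) := (boxvol (G p.1 p.2).1 (G p.1 p.2).2)%:E.
have -> : (\sum_(k <oo) (boxvol (G (f k).1 (f k).2).1 (G (f k).1 (f k).2).2)%:E =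
  \esum_(p in setT) v p)%E.
  by rewrite nneseries_esumT // (reindex_esum setT setT f) //= => p _; exact: G0.
have -> : (\esum_(p in setT) v p = \sum_(i <oo) \sum_(j <oo) v (i, j))%E.
  have -> : (\sum_(i <oo) \sum_(j <oo) v (i, j) =
      \sum_(i <oo) \esum_(j in setT) v (i, j))%E.
    by apply: eq_eseriesr => i _; rewrite nneseries_esumT // => j; exact: G0.
  rewrite nneseries_esumT; last by move=> i; apply: esum_ge0 => j _; exact: G0.
  rewrite (@esum_esum R nat nat setT (fun=> setT) (fun i j => v (i, j))) /=; last by move=> *; exact: G0.
  rewrite (_ : [set: nat] `*`` _ = setT); last by apply/seteqP; split.
  by apply: eq_esum => -[].
apply: lee_nneseries => [n _ _|n _]; first by apply: nneseries_ge0 => k _ _; exact: G0.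
exact: (svalP (hG n)).2.
Qed.

HB.instance Definition _ m := isOuterMeasure.Build R (borelRn R m.+1) (@leb R m.+1)
  (leb0 m) (@leb_ge0 m.+1) (@leb_mono m.+1) (@leb_sigma_subadditive m.+1).

(** Cutting at the hyperplane x_i = c affects only the factor [i]; the truncation at 0 in [boxvol]
    makes the identity hold for every [c], also when a piece is empty. *)
Lemma boxvol_split m (a b : 'rV[R]_m) (i : 'I_m) (c : R) :
  boxvol a (\row_j if j == i then Num.min (b 0 j) c else b 0 j) +
  boxvol (\row_j if j == i then Num.max (a 0 j) c else a 0 j) b = boxvol a b.
Proof.
rewrite /boxvol (bigD1 i) //= [X in _ + X](bigD1 i) //= [RHS](bigD1 i) //= !mxE eqxx.
under [X in _ * X + _]eq_bigr => j /negbTE ji do rewrite !mxE ji.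
under [X in _ + _ * X]eq_bigr => j /negbTE ji do rewrite !mxE ji.
rewrite -mulrDl; congr (_ * _).
by rewrite /Num.max /Num.min; case: (ltP (b 0 i) c) => ?; case: (ltP (a 0 i) c) => ?; repeat (case: ltP => ?); lra.
Qed.

(** Each box of a cover of [X] is cut by the hyperplane. The pieces cover the two parts of [X], and
    their volumes add up to the original one. *)
Lemma caratheodory_halfspace m (i : 'I_m.+1) (c : R) :
  (@leb R m.+1).-caratheodory [set x : borelRn R m.+1 | x 0 i < c].
Proof.
apply: le_caratheodory_measurable => X.
apply: le_ereal_inf_tmp => _ [ab hX <-].
pose b' k := \row_j if j == i then Num.min ((ab k).2 0 j) c else (ab k).2 0 j.
pose a' k := \row_j if j == i then Num.max ((ab k).1 0 j) c else (ab k).1 0 j.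
under eq_eseriesr => k _ do rewrite -(boxvol_split _ _ i c) EFinD.
rewrite nneseriesD; [|by move=> *; rewrite lee_fin boxvol_ge0..].
apply: leeD.
  apply: ereal_inf_lbound; exists (fun k => ((ab k).1, b' k)) => //.
  move=> x /= [/hX[k _ hk] xc]; exists k => // j; rewrite !mxE.
  move: (hk j) => /andP[-> h]; case: eqP => // ->.
  by case/andP: (hk i) => _ {}h; rewrite lt_min xc h.
apply: ereal_inf_lbound; exists (fun k => (a' k, (ab k).2)) => //.
move=> x /= [/hX[k _ hk] /negP]; rewrite -leNgt => xc; exists k => // j; rewrite !mxE.
move: (hk j) => /andP[h ->]; rewrite andbT; case: eqP => // ->.
by case/andP: (hk i) => {}h _; rewrite ge_max xc h.
Qed.

(** A box is a finite intersection of differences of half-spaces, and the Caratheodory sets form a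
    sigma-algebra. *)
Lemma caratheodory_borel m (A : set (borelRn R m.+1)) :
  measurable A -> (@leb R m.+1).-caratheodory A.
Proof.
have hs : sigma_algebra setT (@leb R m.+1).-caratheodory.
  split; first exact: caratheodory_measurable_set0.
    by move=> B hB; rewrite setTD; exact: caratheodory_measurable_setC.
  exact: caratheodory_measurable_bigcup.
rewrite borelRn_boxes; apply: smallest_sub => // _ [a [b ->]].
rewrite (_ : box a b = \bigcap_(i : 'I_m.+1)
   ([set x : borelRn R m.+1 | x 0 i < b 0 i] `\`
    [set x : borelRn R m.+1 | x 0 i < a 0 i])).
  apply: (@fin_bigcap_measurable _ (caratheodory_type (@leb R m.+1))).
    exact: finite_finset.
  move=> i _; apply: caratheodory_measurable_setD; exact: caratheodory_halfspace.
apply/seteqP; split=> x /=.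
  by move=> h i _; case/andP: (h i) => h1 h2; split => //; apply/negP; rewrite -leNgt.
by move=> h i; have [h1 /negP] := h i I; rewrite -leNgt => ->.
Qed.

(* [leb] is degenerate in dimension 0 (every set, even the empty one, gets
   [+oo]); [lebm] is the measure that agrees with it in positive dimension. *)
Definition lebm m : set (borelRn R m) -> \bar R :=
  if m is 0 then dirac ((0 : 'rV[R]_m) : borelRn R m) else @leb R m.

Lemma lebm_set0 m : lebm (set0 : set (borelRn R m)) = 0%E.
Proof. by case: m => [|m]; [rewrite /lebm measure0|exact: leb0]. Qed.

Lemma lebm_ge0 m (A : set (borelRn R m)) : (0 <= lebm A)%E.
Proof. by case: m A => [|m] A; [rewrite /lebm measure_ge0|exact: leb_ge0]. Qed.

Lemma lebm_sigma_additive m : semi_sigma_additive (@lebm m).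
Proof.
case: m => [|m]; first exact: measure_semi_sigma_additive.
move=> F mF tF mUF.
apply: (@caratheodory_measure_sigma_additive R (borelRn R m.+1) (@leb R m.+1)) => //.
  by move=> i; exact: caratheodory_borel.
exact: caratheodory_borel.
Qed.

HB.instance Definition _ m := isMeasure.Build _ _ _ (@lebm m)
  (lebm_set0 m) (@lebm_ge0 m) (@lebm_sigma_additive m).

End Leb.

(** * Lebesgue measure of boxes, uniqueness, products and scaling *)

Section LebBox.
Variables (R : realType).

Lemma row_mx_const_measurable m :
  measurable_fun setT (fun p : borelRn R m * measurableTypeR R =>
    (row_mx (const_mx (p.2 : R) : 'rV[R]_1) (p.1 : 'rV[R]_m)) : borelRn R (1 + m)).
Proof.
apply: measurable_fun_rV => i.
case: (fintype.split_ordP i) => j ->.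
  rewrite (_ : (fun _ => _) = fun p : borelRn R m * measurableTypeR R => p.2 : R).
    exact: measurable_snd.
  by apply/funext => p; rewrite row_mxEl mxE.
rewrite (_ : (fun _ => _) =
   (fun x : borelRn R m => x 0 j) \o (fun p : borelRn R m * measurableTypeR R => p.1)).
  by apply: measurableT_comp; [exact: coord_measurable|exact: measurable_fst].
by apply/funext => p /=; rewrite row_mxEr.
Qed.

Lemma boxvol_row_mx p q (a b : 'rV[R]_(p + q)) :
  boxvol a b = boxvol (lsubmx a) (lsubmx b) * boxvol (rsubmx a) (rsubmx b).
Proof.
rewrite /boxvol big_split_ord /=.
by congr (_ * _); apply: eq_bigr => i _; rewrite !mxE.
Qed.

Lemma box_row_mx p q (a b : 'rV[R]_(p + q)) (x : 'rV[R]_p) (y : 'rV[R]_q) :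
  box a b (row_mx x y) <->
  box (lsubmx a) (lsubmx b) x /\ box (rsubmx a) (rsubmx b) y.
Proof.
split=> [h|[h1 h2] i].
  split=> i; rewrite !mxE.
    by have := h (lshift q i); rewrite row_mxEl.
  by have := h (rshift p i); rewrite row_mxEr.
case: (fintype.split_ordP i) => j ->.
  by move: (h1 j); rewrite row_mxEl !mxE.
by move: (h2 j); rewrite row_mxEr !mxE.
Qed.

Lemma lebesgue_measure_co (a b : R) :
  lebesgue_measure `[a, b[%classic = (Num.max 0 (b - a))%:E.
Proof.
rewrite lebesgue_measure_itv /= lte_fin; case: ltP => ab.
  by rewrite -EFinB max_r // subr_ge0 ltW.
by rewrite max_l // subr_le0.
Qed.

(** The lower bound needs no compactness argument: by induction the product of [lebm] in dimension m
    with one-dimensional Lebesgue measure is a measure [nu] with the right value on boxes, and its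
    countable subadditivity bounds the volume of a box by the total volume of any cover. *)
Lemma lebm_box m (a b : 'rV[R]_m) : lebm (box a b) = (boxvol a b)%:E.
Proof.
elim: m a b => [|m IH] a b.
  rewrite /lebm diracE /boxvol big_ord0 mem_set //.
  by move=> -[].
pose f (p : borelRn R m * measurableTypeR R) : borelRn R (1 + m) :=
  row_mx (const_mx (p.2 : R) : 'rV[R]_1) (p.1 : 'rV[R]_m).
pose nu := pushforward (@lebm R m \x (@lebesgue_measure R))%E f.
have mf : measurable_fun setT f := @row_mx_const_measurable m.
have nuE (c d : 'rV[R]_(1 + m)) : nu (box c d) = (boxvol c d)%:E.
  rewrite /nu /pushforward.
  rewrite (_ : f @^-1` box c d =
      (box (rsubmx c) (rsubmx d) : set (borelRn R m)) `*` `[lsubmx c 0 0, lsubmx d 0 0[%classic).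
    rewrite product_measure1E //=; last exact: box_measurable.
    rewrite IH boxvol_row_mx lebesgue_measure_co muleC /boxvol.
    by rewrite [in RHS](big_ord_recl 0) big_ord0 mulr1.
  apply/seteqP; split=> -[x t] /=.
    move/box_row_mx => [h1 h2]; split => //; rewrite in_itv /=.
    by have := h1 0; rewrite !mxE.
  rewrite in_itv /= => -[h1 h2]; apply/box_row_mx; split => // i.
  by rewrite (ord1 i) [const_mx _ _ _]mxE.
apply/eqP; rewrite eq_le leb_box_le /=.
apply: le_ereal_inf_tmp => _ [ab hX <-].
rewrite -(nuE a b).
under eq_eseriesr => k _ do rewrite -nuE.
apply: (@measure_sigma_subadditive _ _ _ (pushforward (@lebm R m \x (@lebesgue_measure R))%E f)) => //.
- by move=> k; exact: box_measurable.
- exact: box_measurable.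
Qed.

Lemma lebm_sigma_finite m : sigma_finite setT (@lebm R m).
Proof.
exists (fun k => box (const_mx (- k%:R)) (const_mx k%:R) : set (borelRn R m)).
  by rewrite boxes_cover.
by move=> k; split; [exact: box_measurable|rewrite lebm_box ltry].
Qed.

HB.instance Definition _ m := Measure_isSigmaFinite.Build _ _ _ (@lebm R m)
  (@lebm_sigma_finite m).

Lemma lebm_unique m (nu : {measure set (borelRn R m) -> \bar R}) :
  (forall a b, nu (box a b) = (boxvol a b)%:E) ->
  forall A, measurable A -> nu A = lebm A.
Proof.
move=> h; apply: boxvol_measure_unique => a b; rewrite h ?ltry //.
exact/esym/lebm_box.
Qed.

Definition catmx p q (z : borelRn R p * borelRn R q) : borelRn R (p + q) :=
  row_mx (z.1 : 'rV[R]_p) (z.2 : 'rV[R]_q).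

Lemma catmx_measurable p q : measurable_fun setT (@catmx p q).
Proof.
apply: measurable_fun_rV => i; case: (fintype.split_ordP i) => j ->.
  rewrite (_ : (fun _ => _) =
     (fun x : borelRn R p => x 0 j) \o (fun z : borelRn R p * borelRn R q => z.1)).
    by apply: measurableT_comp; [exact: coord_measurable|exact: measurable_fst].
  by apply/funext => z /=; rewrite /catmx row_mxEl.
rewrite (_ : (fun _ => _) =
   (fun x : borelRn R q => x 0 j) \o (fun z : borelRn R p * borelRn R q => z.2)).
  by apply: measurableT_comp; [exact: coord_measurable|exact: measurable_snd].
by apply/funext => z /=; rewrite /catmx row_mxEr.
Qed.

Lemma lebm_cat p q (A : set (borelRn R (p + q))) : measurable A ->
  lebm A = (@lebm R p \x @lebm R q)%E (@catmx p q @^-1` A).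
Proof.
move=> mA; apply/esym.
apply: (lebm_unique (nu := [the measure _ _ of
   pushforward (@lebm R p \x @lebm R q)%E (@catmx p q)])) => //.
  exact: catmx_measurable.
move=> ? a b /=; rewrite /pushforward.
rewrite (_ : _ @^-1` _ = (box (lsubmx a) (lsubmx b) : set (borelRn R p)) `*`
    (box (rsubmx a) (rsubmx b) : set (borelRn R q))).
  rewrite product_measure1E; [|exact: box_measurable..].
  by rewrite boxvol_row_mx EFinM -!lebm_box.
by apply/seteqP; split=> -[x y] /= /box_row_mx.
Qed.

Definition affmap m (t : R) (v : 'rV[R]_m) (x : borelRn R m) : borelRn R m :=
  t *: (x : 'rV[R]_m) + v.

Lemma affine_measurable m (t : R) (v : 'rV[R]_m) :
  measurable_fun setT (affmap t v).
Proof.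
rewrite /affmap.
apply: measurable_fun_rV => i; under eq_fun do rewrite !mxE.
apply: measurable_funD; last exact: measurable_cst.
by apply: measurable_funM; [exact: measurable_cst|exact: coord_measurable].
Qed.

(** By uniqueness it suffices to compare the two measures on boxes, whose preimages are again boxes
    because [t] is positive. *)
Lemma lebm_affine m (t : R) (v : 'rV[R]_m) (A : set (borelRn R m)) :
  0 < t -> measurable A ->
  lebm A = ((t ^+ m)%:E * lebm (affmap t v @^-1` A))%E.
Proof.
move=> t0 mA; apply/esym.
have tm0 : 0 <= t ^+ m by rewrite exprn_ge0 // ltW.
pose c : {nonneg R} := NngNum tm0.
apply: (lebm_unique (nu := mscale c (pushforward (@lebm R m) (affmap t v)))) => //.
  exact: affine_measurable.
move=> ? a b /=; rewrite /mscale /= /pushforward.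
rewrite (_ : _ @^-1` _ = box (t^-1 *: (a - v)) (t^-1 *: (b - v))).
  rewrite lebm_box -EFinM; congr EFin.
  have -> : t ^+ m = \prod_(i < m) t by rewrite prodr_const card_ord.
  rewrite -big_split; apply: eq_bigr => i _ /=; rewrite !mxE.
  rewrite maxr_pMr ?ltW // mulr0.
  by congr (Num.max _ _); field; rewrite gt_eqF.
apply/seteqP; split=> x /= h i; move: (h i); rewrite !mxE.
  by rewrite ler_pdivrMl // ltr_pdivlMl // lerBlDr ltrBrDr.
by rewrite ler_pdivrMl // ltr_pdivlMl // lerBlDr ltrBrDr.
Qed.

End LebBox.

(** * Complex-valued integrals *)

Notation cRe := complex.Re.
Notation cIm := complex.Im.

Section ComplexModulus.
Variable R : realType.
Implicit Types z w : C R.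

Lemma cabsE z : cabs z = Normc.normc z.
Proof. by case: z. Qed.

Lemma cabs_ge0 z : 0 <= cabs z. Proof. exact: sqrtr_ge0. Qed.

Lemma cabsM z w : cabs (z * w) = cabs z * cabs w.
Proof. by rewrite !cabsE Normc.normcM. Qed.

Lemma cabsD z w : cabs (z + w) <= cabs z + cabs w.
Proof. by rewrite !cabsE; exact: le_normcD. Qed.

Lemma cabs0 : cabs (0 : C R) = 0.
Proof. by rewrite cabsE Normc.normc0. Qed.

Lemma cabs1 : cabs (1 : C R) = 1.
Proof. by rewrite cabsE Normc.normc1. Qed.

Lemma cabsR (r : R) : cabs (Complex r 0) = `|r|.
Proof. by rewrite /cabs /= expr0n addr0 sqrtr_sqr. Qed.

Lemma Re_le_cabs z : `|cRe z| <= cabs z.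
Proof. by rewrite -sqrtr_sqr ler_sqrt ?addr_ge0 ?sqr_ge0 // lerDl sqr_ge0. Qed.

Lemma Im_le_cabs z : `|cIm z| <= cabs z.
Proof. by rewrite -sqrtr_sqr ler_sqrt ?addr_ge0 ?sqr_ge0 // lerDr sqr_ge0. Qed.

Lemma cabs_le_ReIm z : cabs z <= `|cRe z| + `|cIm z|.
Proof.
rewrite -(ger0_norm (addr_ge0 (normr_ge0 (cRe z)) (normr_ge0 (cIm z)))) -sqrtr_sqr.
rewrite ler_sqrt ?sqr_ge0 // sqrrD !real_normK ?num_real //.
by rewrite addrAC lerDl mulrn_wge0 ?mulr_ge0.
Qed.

Lemma cabs_sum (I : Type) (s : seq I) (F : I -> C R) :
  cabs (\sum_(i <- s) F i) <= \sum_(i <- s) cabs (F i).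
Proof.
apply: (big_ind2 (fun a b => cabs a <= b)) => [|a b c e h1 h2|//].
  by rewrite cabs0.
by apply: le_trans (cabsD _ _) _; rewrite lerD.
Qed.

Lemma cabs_prod (I : Type) (s : seq I) (F : I -> C R) :
  cabs (\prod_(i <- s) F i) = \prod_(i <- s) cabs (F i).
Proof.
apply: (big_ind2 (fun a b => cabs a = b)) => [|a b c e <- <-|//].
  by rewrite cabs1.
by rewrite cabsM.
Qed.

Lemma cexpiD (s t : R) : cexpi (s + t) = cexpi s * cexpi t.
Proof.
rewrite /cexpi cosD sinD; apply/eqP; rewrite eq_complex /=.
by apply/andP; split; apply/eqP; ring.
Qed.

Lemma cexpi0 : cexpi 0 = 1 :> C R.
Proof. by rewrite /cexpi cos0 sin0. Qed.

Lemma cabs_cexpi (t : R) : cabs (cexpi t) = 1.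
Proof. by rewrite /cabs /= cos2Dsin2 sqrtr1. Qed.

Lemma cReM z w : cRe (z * w) = cRe z * cRe w - cIm z * cIm w.
Proof. by case: z => a b; case: w. Qed.

Lemma cImM z w : cIm (z * w) = cRe z * cIm w + cIm z * cRe w.
Proof. by case: z => a b; case: w. Qed.

Lemma cReD z w : cRe (z + w) = cRe z + cRe w. Proof. by case: z => a b; case: w. Qed.
Lemma cImD z w : cIm (z + w) = cIm z + cIm w. Proof. by case: z => a b; case: w. Qed.
Lemma cReN z : cRe (- z) = - cRe z. Proof. by case: z. Qed.
Lemma cImN z : cIm (- z) = - cIm z. Proof. by case: z. Qed.

Lemma complex_ext z w : cRe z = cRe w -> cIm z = cIm w -> z = w.
Proof. by case: z => a b; case: w => c d /= -> ->. Qed.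

End ComplexModulus.

Section RealIntegral.
Context d (T : measurableType d) (R : realType) (mu : {measure set T -> \bar R}).
Implicit Types f g : T -> R.

Definition rible f := mu.-integrable setT (EFin \o f).
Definition rI f := Rintegral mu setT f.

Lemma rible_meas f : rible f -> measurable_fun setT f.
Proof. by move=> /measurable_int /measurable_EFinP. Qed.

Lemma rible_dom f g : measurable_fun setT f -> rible g ->
  (forall x, `|f x| <= g x) -> rible f.
Proof.
move=> mf ig fg; apply: le_integrable ig => //; first exact/measurable_EFinP.
by move=> x _ /=; rewrite lee_fin (le_trans (fg x)) // ler_norm.
Qed.

Lemma ribleD f g : rible f -> rible g -> rible (fun x => f x + g x).
Proof. by move=> h1 h2; exact: (integrableD measurableT h1 h2). Qed.

Lemma ribleZ k f : rible f -> rible (fun x => k * f x).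
Proof. by move=> h1; exact: (integrableZl measurableT k h1). Qed.

Lemma rID f g : rible f -> rible g -> rI (fun x => f x + g x) = rI f + rI g.
Proof. by move=> h1 h2; exact: RintegralD. Qed.

Lemma rIB f g : rible f -> rible g -> rI (fun x => f x - g x) = rI f - rI g.
Proof. by move=> h1 h2; exact: RintegralB. Qed.

Lemma rIZ k f : rible f -> rI (fun x => k * f x) = k * rI f.
Proof. by move=> h1; exact: RintegralZl. Qed.

Lemma rI_le_dom f g : measurable_fun setT f -> rible g ->
  (forall x, `|f x| <= g x) -> `|rI f| <= rI g.
Proof.
move=> mf ig fg.
apply: le_trans (le_normr_Rintegral measurableT (rible_dom mf ig fg)) _.
apply: le_Rintegral => //.
apply: rible_dom ig _; first exact: measurableT_comp.
by move=> x; rewrite normr_id.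
Qed.

Lemma rI_dct (f_ : nat -> T -> R) f g :
  (forall k, measurable_fun setT (f_ k)) -> measurable_fun setT f -> rible g ->
  (forall k x, `|f_ k x| <= g x) ->
  (forall x, f_ k x @[k --> \oo] --> f x) ->
  rI (f_ k) @[k --> \oo] --> rI f.
Proof.
move=> mf_ mf ig fg cf.
have mE (h : T -> R) : measurable_fun setT h -> measurable_fun setT (EFin \o h).
  by move=> mh; exact/measurable_EFinP.
have cf' x : (f_ k x)%:E @[k --> \oo] --> (f x)%:E.
  by apply: cvg_EFin; [apply: nearW|exact: cf].
have [h1 _ h3] := @dominated_convergence _ _ _ mu setT measurableT
  (fun k x => (f_ k x)%:E) (EFin \o f) (EFin \o g)
  (fun k => mE _ (mf_ k)) (mE _ mf)
  (aeW _ (fun x _ => cf' x)) ig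
  (aeW _ (fun x k _ => fg k x)).
apply: fine_cvg; rewrite fineK; last exact: integrable_fin_num.
exact: h3.
Qed.

End RealIntegral.

Section ComplexIntegral.
Context d (T : measurableType d) (R : realType) (mu : {measure set T -> \bar R}).
Implicit Types f g : T -> C R.

Definition cmeas f := measurable_fun setT (fun x => cRe (f x)) /\
                      measurable_fun setT (fun x => cIm (f x)).
Definition cible f := rible mu (fun x => cRe (f x)) /\ rible mu (fun x => cIm (f x)).
Definition cI f : C R := Complex (rI mu (fun x => cRe (f x))) (rI mu (fun x => cIm (f x))).

Lemma cible_meas f : cible f -> cmeas f.
Proof. by move=> [/rible_meas ? /rible_meas ?]. Qed.

Lemma cmeasM f g : cmeas f -> cmeas g -> cmeas (fun x => f x * g x).
Proof.
move=> [f1 f2] [g1 g2]; split.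
  under eq_fun do rewrite cReM.
  by apply: measurable_funB; apply: measurable_funM.
under eq_fun do rewrite cImM.
by apply: measurable_funD; apply: measurable_funM.
Qed.

Lemma cmeasD f g : cmeas f -> cmeas g -> cmeas (fun x => f x + g x).
Proof.
move=> [f1 f2] [g1 g2]; split.
  by under eq_fun do rewrite cReD; apply: measurable_funD.
by under eq_fun do rewrite cImD; apply: measurable_funD.
Qed.

Lemma cmeas_cst (c : C R) : cmeas (fun=> c).
Proof. by split; exact: measurable_cst. Qed.

Lemma cmeas_sum (I : Type) (s : seq I) (F : I -> T -> C R) :
  (forall i, cmeas (F i)) -> cmeas (fun x => \sum_(i <- s) F i x).
Proof.
move=> h; elim: s => [|i s IH].
  by under eq_fun do rewrite big_nil; exact: cmeas_cst.
by under eq_fun do rewrite big_cons; exact: cmeasD.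
Qed.

Lemma cmeas_prod (I : Type) (s : seq I) (F : I -> T -> C R) :
  (forall i, cmeas (F i)) -> cmeas (fun x => \prod_(i <- s) F i x).
Proof.
move=> h; elim: s => [|i s IH].
  by under eq_fun do rewrite big_nil; exact: cmeas_cst.
by under eq_fun do rewrite big_cons; exact: cmeasM.
Qed.

Lemma cmeasR (f : T -> R) : measurable_fun setT f -> cmeas (fun x => Complex (f x) 0).
Proof. by split=> //; exact: measurable_cst. Qed.

Lemma cmeas_cexpi (f : T -> R) : measurable_fun setT f -> cmeas (fun x => cexpi (f x)).
Proof.
move=> mf; split; apply: measurableT_comp => //; apply: continuous_measurable_fun.
  exact: continuous_cos.
exact: continuous_sin.
Qed.

Lemma cmeas_cabs f : cmeas f -> measurable_fun setT (fun x => cabs (f x)).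
Proof.
move=> [f1 f2]; rewrite /cabs.
have sc : measurable_fun setT (@Num.sqrt R).
  by apply: continuous_measurable_fun; exact: sqrt_continuous.
apply: (measurableT_comp sc).
by apply: measurable_funD; apply: measurable_funX.
Qed.

Lemma cible_dom f (g : T -> R) : cmeas f -> rible mu g ->
  (forall x, cabs (f x) <= g x) -> cible f.
Proof.
move=> [f1 f2] ig fg; split; apply: rible_dom ig _ => // x.
  exact: le_trans (Re_le_cabs _) (fg x).
exact: le_trans (Im_le_cabs _) (fg x).
Qed.

Lemma cible_cabs f : cible f -> rible mu (fun x => cabs (f x)).
Proof.
move=> hf; have [f1 f2] := hf.
apply: (rible_dom (cmeas_cabs (cible_meas hf)) (ribleD (integrable_norm f1) (integrable_norm f2))).
move=> x; rewrite ger0_norm ?cabs_ge0 //; exact: cabs_le_ReIm.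
Qed.

Lemma cibleZ (c : C R) f : cible f -> cible (fun x => c * f x).
Proof.
move=> hf.
apply: (cible_dom (cmeasM (cmeas_cst c) (cible_meas hf)) (ribleZ (cabs c) (cible_cabs hf))).
by move=> x; rewrite cabsM.
Qed.

Lemma cibleD f g : cible f -> cible g -> cible (fun x => f x + g x).
Proof.
move=> [f1 f2] [g1 g2]; split.
  by under eq_fun do rewrite cReD; apply: ribleD.
by under eq_fun do rewrite cImD; apply: ribleD.
Qed.

Lemma cIZ (c : C R) f : cible f -> cI (fun x => c * f x) = c * cI f.
Proof.
move=> [f1 f2]; apply: complex_ext; rewrite ?cReM ?cImM /=.
  under eq_fun do rewrite cReM.
  by rewrite rIB ?rIZ //; apply: ribleZ.
under eq_fun do rewrite cImM.
by rewrite rID ?rIZ //; apply: ribleZ.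
Qed.

Lemma cIZr (c : C R) f : cible f -> cI (fun x => f x * c) = cI f * c.
Proof. by move=> h; under eq_fun do rewrite mulrC; rewrite cIZ // mulrC. Qed.

Lemma cID f g : cible f -> cible g -> cI (fun x => f x + g x) = cI f + cI g.
Proof.
move=> [f1 f2] [g1 g2]; apply: complex_ext; rewrite ?cReD ?cImD /=.
  by under eq_fun do rewrite cReD; rewrite rID.
by under eq_fun do rewrite cImD; rewrite rID.
Qed.

Lemma cIN f : cible f -> cI (fun x => - f x) = - cI f.
Proof. by move=> h; under eq_fun do rewrite -mulN1r; rewrite cIZ // mulN1r. Qed.

Lemma cible0 : cible (fun=> 0).
Proof. by split; exact: integrable0. Qed.

Lemma cI0 : cI (fun=> 0) = 0.
Proof.
by apply: complex_ext; rewrite /= /rI /Rintegral integral0.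
Qed.

Lemma cI_sum (I : Type) (s : seq I) (F : I -> T -> C R) :
  (forall i, cible (F i)) ->
  cible (fun x => \sum_(i <- s) F i x) /\
  cI (fun x => \sum_(i <- s) F i x) = \sum_(i <- s) cI (F i).
Proof.
move=> h; elim: s => [|i s [IH1 IH2]].
  under eq_fun do rewrite big_nil; rewrite big_nil.
  by split; [exact: cible0|exact: cI0].
under eq_fun do rewrite big_cons.
by split; [exact: cibleD|rewrite cID // IH2 big_cons].
Qed.

(* The factor 2 comes from bounding real and imaginary parts separately. *)
Lemma cI_le_dom f (g : T -> R) : cmeas f -> rible mu g ->
  (forall x, cabs (f x) <= g x) -> cabs (cI f) <= 2 * rI mu g.
Proof.
move=> [f1 f2] ig fg; apply: le_trans (cabs_le_ReIm _) _ => /=.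
rewrite mulr2n mulrDl mul1r; apply: lerD; apply: rI_le_dom => // x.
  exact: le_trans (Re_le_cabs _) (fg x).
exact: le_trans (Im_le_cabs _) (fg x).
Qed.

End ComplexIntegral.

Section ComplexLimits.
Variable R : realType.
Implicit Types (u v : nat -> C R).

Definition ccvg u (l : C R) :=
  (cRe (u k) @[k --> \oo] --> cRe l) /\ (cIm (u k) @[k --> \oo] --> cIm l).

Lemma ccvg_cst l : ccvg (fun=> l) l.
Proof. by split; exact: cvg_cst. Qed.

Lemma ccvgM u v l l' : ccvg u l -> ccvg v l' -> ccvg (fun k => u k * v k) (l * l').
Proof.
move=> [u1 u2] [v1 v2]; split; rewrite ?cReM ?cImM.
  by under eq_fun do rewrite cReM; apply: cvgB; apply: cvgM.
by under eq_fun do rewrite cImM; apply: cvgD; apply: cvgM.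
Qed.

Lemma ccvg_unique u l l' : ccvg u l -> ccvg u l' -> l = l'.
Proof.
move=> [h1 h2] [h3 h4]; apply: complex_ext.
  exact: (cvg_unique (@Rhausdorff R) h1 h3).
exact: (cvg_unique (@Rhausdorff R) h2 h4).
Qed.

Lemma ccvg_prod (I : Type) (s : seq I) (F : I -> nat -> C R) (l : I -> C R) :
  (forall i, ccvg (F i) (l i)) ->
  ccvg (fun k => \prod_(i <- s) F i k) (\prod_(i <- s) l i).
Proof.
move=> h; elim: s => [|i s IH].
  by under eq_fun do rewrite big_nil; rewrite big_nil; exact: ccvg_cst.
by under eq_fun do rewrite big_cons; rewrite big_cons; exact: ccvgM.
Qed.

Lemma cI_dct d (T : measurableType d) (mu : {measure set T -> \bar R})
    (f_ : nat -> T -> C R) (f : T -> C R) (g : T -> R) :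
  (forall k, cmeas (f_ k)) -> cmeas f -> rible mu g ->
  (forall k x, cabs (f_ k x) <= g x) ->
  (forall x, ccvg (fun k => f_ k x) (f x)) ->
  ccvg (fun k => cI mu (f_ k)) (cI mu f).
Proof.
move=> mf_ [mf1 mf2] ig fg cf; split=> /=.
  apply: (rI_dct _ _ ig) => //; first by move=> k; case: (mf_ k).
    by move=> k x; exact: le_trans (Re_le_cabs _) (fg k x).
  by move=> x; case: (cf x).
apply: (rI_dct _ _ ig) => //; first by move=> k; case: (mf_ k).
  by move=> k x; exact: le_trans (Im_le_cabs _) (fg k x).
by move=> x; case: (cf x).
Qed.

End ComplexLimits.

(** * Fubini's theorem with integrability of every slice *)

Section Fubini.
Context d1 d2 (T1 : measurableType d1) (T2 : measurableType d2) (R : realType).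
Variable m1 : {sigma_finite_measure set T1 -> \bar R}.
Variable m2 : {sigma_finite_measure set T2 -> \bar R}.

Lemma rI_EFin d (T : measurableType d) (m : {measure set T -> \bar R}) (f : T -> R) :
  rible m f -> (rI m f)%:E = (\int[m]_x (f x)%:E)%E.
Proof. by move=> h; rewrite fineK //; exact: integrable_fin_num. Qed.

(** By Tonelli the integral of |f| is at most [K] times that of [g], and every slice, not just
    almost every one, is dominated. The second weight may depend on [x], so that translated weights
    are covered as well. *)
Lemma rible_prod (f : T1 * T2 -> R) (g : T1 -> R) (h : T1 -> T2 -> R) (K : R) :
  measurable_fun setT f -> rible m1 g -> (forall x, rible m2 (h x)) ->
  (forall x, 0 <= g x) -> (forall x, rI m2 (h x) <= K) ->
  (forall x y, `|f (x, y)| <= g x * h x y) ->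
  rible (m1 \x m2)%E f /\ (forall x, rible m2 (fun y => f (x, y))).
Proof.
move=> mf ig ih g0 hK fgh.
have mfE : measurable_fun setT (EFin \o f) by exact/measurable_EFinP.
have i2 x : rible m2 (fun y => f (x, y)).
  apply: (rible_dom _ (ribleZ (g x) (ih x)) (fgh x)).
  exact: (measurableT_comp mf (pair1_measurable x)).
split => //.
apply/integrable12ltyP => //=.
have /integrableP[mg] : rible m1 (fun x => K * g x) by exact: ribleZ.
apply: le_lt_trans; apply: ge0_le_integral => //.
- by move=> x _; apply: integral_ge0.
- apply: (measurable_fun_fubini_tonelli_F (fun z => `|(EFin \o f) z|)%E) => //.
  exact: measurableT_comp.
- exact: measurableT_comp.
- move=> x _ /=.
  have hx : (\int[m2]_y `|(f (x, y))%:E| <= (g x * rI m2 (h x))%:E)%E.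
    rewrite -(rIZ _ (ih x)) rI_EFin; last exact: ribleZ.
    apply: ge0_le_integral => //.
    + by apply: measurableT_comp => //; exact/measurable_EFinP/rible_meas/i2.
    + exact/measurable_EFinP/rible_meas/ribleZ.
    + by move=> y _; rewrite lee_fin.
  apply: le_trans hx _; rewrite lee_fin.
  apply: le_trans (ler_norm _).
  by rewrite mulrC ler_wpM2r.
Qed.

(** Since all slices are integrable, the inner extended integral is finite everywhere and coincides
    with the real number [rI], with no exceptional set. *)
Lemma rfubini1 (f : T1 * T2 -> R) :
  rible (m1 \x m2)%E f -> (forall x, rible m2 (fun y => f (x, y))) ->
  rible m1 (fun x => rI m2 (fun y => f (x, y))) /\
  rI (m1 \x m2)%E f = rI m1 (fun x => rI m2 (fun y => f (x, y))).
Proof.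
move=> hf h2.
have E : fubini_F m2 (EFin \o f) = EFin \o (fun x => rI m2 (fun y => f (x, y))).
  by apply/funext => x; rewrite /fubini_F /= rI_EFin.
split; first by rewrite /rible -E; exact: integrable_fubini_F.
by rewrite {1}/rI /Rintegral -(integral12_prod_meas1 hf) E.
Qed.

Lemma integrable_fubini_G (f : T1 * T2 -> \bar R) :
  (m1 \x m2)%E.-integrable setT f -> m2.-integrable setT (fubini_G m1 f).
Proof.
move=> hf; have mf := measurable_int _ hf.
apply/integrableP; split; first exact: (measurable_fubini_G hf).
apply: le_lt_trans ((integrable21ltyP m1 m2 mf).1 hf).
have mG : measurable_fun setT (fun y => \int[m1]_x `|f (x, y)|)%E.
  apply: (measurable_fun_fubini_tonelli_G (abse \o f)) => //=.
  exact: measurableT_comp.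
apply: ge0_le_integral => //.
  by apply: measurableT_comp => //; exact: (measurable_fubini_G hf).
move=> y _; apply: le_abse_integral => //.
exact: (measurableT_comp mf (pair2_measurable y)).
Qed.

Lemma rfubini2 (f : T1 * T2 -> R) :
  rible (m1 \x m2)%E f -> (forall y, rible m1 (fun x => f (x, y))) ->
  rible m2 (fun y => rI m1 (fun x => f (x, y))) /\
  rI (m1 \x m2)%E f = rI m2 (fun y => rI m1 (fun x => f (x, y))).
Proof.
move=> hf h2.
have E : fubini_G m1 (EFin \o f) = EFin \o (fun y => rI m1 (fun x => f (x, y))).
  by apply/funext => x; rewrite /fubini_G /= rI_EFin.
split; first by rewrite /rible -E; exact: integrable_fubini_G.
by rewrite {1}/rI /Rintegral -(integral21_prod_meas1 hf) E.
Qed.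

Lemma cible_prod (f : T1 * T2 -> C R) (g : T1 -> R) (h : T1 -> T2 -> R) (K : R) :
  cmeas f -> rible m1 g -> (forall x, rible m2 (h x)) ->
  (forall x, 0 <= g x) -> (forall x, rI m2 (h x) <= K) ->
  (forall x y, cabs (f (x, y)) <= g x * h x y) ->
  cible (m1 \x m2)%E f /\ (forall x, cible m2 (fun y => f (x, y))).
Proof.
move=> [mf1 mf2] ig ih g0 hK fgh.
have [|h1 h2] := rible_prod mf1 ig ih g0 hK.
  by move=> x y; exact: le_trans (Re_le_cabs _) (fgh x y).
have [|h3 h4] := rible_prod mf2 ig ih g0 hK.
  by move=> x y; exact: le_trans (Im_le_cabs _) (fgh x y).
by split; [split|split; [exact: h2|exact: h4]].
Qed.

Lemma cfubini1 (f : T1 * T2 -> C R) :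
  cible (m1 \x m2)%E f -> (forall x, cible m2 (fun y => f (x, y))) ->
  cible m1 (fun x => cI m2 (fun y => f (x, y))) /\
  cI (m1 \x m2)%E f = cI m1 (fun x => cI m2 (fun y => f (x, y))).
Proof.
move=> [h1 h2] h.
have [a1 b1] := rfubini1 h1 (fun x => (h x).1).
have [a2 b2] := rfubini1 h2 (fun x => (h x).2).
by split; [split|rewrite /cI b1 b2].
Qed.

Lemma cfubini2 (f : T1 * T2 -> C R) :
  cible (m1 \x m2)%E f -> (forall y, cible m1 (fun x => f (x, y))) ->
  cible m2 (fun y => cI m1 (fun x => f (x, y))) /\
  cI (m1 \x m2)%E f = cI m2 (fun y => cI m1 (fun x => f (x, y))).
Proof.
move=> [h1 h2] h.
have [a1 b1] := rfubini2 h1 (fun x => (h x).1).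
have [a2 b2] := rfubini2 h2 (fun x => (h x).2).
by split; [split|rewrite /cI b1 b2].
Qed.

End Fubini.

(** * Change of variables when one measure is a multiple of the image of another *)

Section ChangeOfVariables.
Context d1 d2 (T1 : measurableType d1) (T2 : measurableType d2) (R : realType).
Variables (mu : {measure set T1 -> \bar R}) (nu : {measure set T2 -> \bar R}).
Variables (c : R) (phi : T1 -> T2).
Hypotheses (c0 : 0 < c) (mphi : measurable_fun setT phi).
Hypothesis nuE : forall A, measurable A -> nu A = (c%:E * mu (phi @^-1` A))%E.

Lemma ge0_integral_chvar (f : T2 -> \bar R) : measurable_fun setT f ->
  (forall x, 0 <= f x)%E ->
  (\int[nu]_x f x = c%:E * \int[mu]_x f (phi x))%E.
Proof.
move=> mf f0.
have -> : (\int[mu]_x f (phi x) = \int[pushforward mu phi]_x f x)%E.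
  by rewrite (ge0_integral_pushforward mphi).
pose cc : {nonneg R} := NngNum (ltW c0).
rewrite (_ : c = cc%:num) // -ge0_integral_mscale //.
by apply: eq_measure_integral => A mA _; rewrite nuE.
Qed.

Lemma rible_chvar (f : T2 -> R) : measurable_fun setT f ->
  rible mu (fun x => f (phi x)) <-> rible nu f.
Proof.
move=> mf.
have mfE : measurable_fun setT (EFin \o f) by exact/measurable_EFinP.
have E : (\int[nu]_x `|(EFin \o f) x| = c%:E * \int[mu]_x `|(EFin \o f) (phi x)|)%E.
  have mA : measurable_fun setT (fun x => `|(EFin \o f) x|)%E by exact: measurableT_comp.
  by rewrite (ge0_integral_chvar mA).
split=> /integrableP[h1 h2]; apply/integrableP; split => //=.
- rewrite E lte_mul_pinfty //; first by rewrite lee_fin ltW.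
- exact: measurableT_comp mfE mphi.
- move: h2; rewrite E; apply: contraTT; rewrite -!leNgt !leye_eq => /eqP ->.
  by rewrite gt0_muley ?lte_fin.
Qed.

Lemma rI_chvar (f : T2 -> R) : measurable_fun setT f ->
  rible mu (fun x => f (phi x)) -> rI nu f = c * rI mu (fun x => f (phi x)).
Proof.
move=> mf hf.
have mfE : measurable_fun setT (EFin \o f) by exact/measurable_EFinP.
apply: EFin_inj; rewrite EFinM !rI_EFin //; last exact/rible_chvar.
rewrite integralE (ge0_integral_chvar (measurable_funepos mfE)) //.
rewrite (ge0_integral_chvar (measurable_funeneg mfE)) //.
have Ep : (EFin \o (fun x => f (phi x)))^\+%E = (EFin \o f)^\+%E \o phi.
  exact: (funepos_comp (EFin \o f) phi).
have En : (EFin \o (fun x => f (phi x)))^\-%E = (EFin \o f)^\-%E \o phi.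
  exact: (funeneg_comp (EFin \o f) phi).
have fn := integrable_neg_fin_num measurableT hf; rewrite En in fn.
rewrite -muleBr //.
  by congr (_ * _)%E; rewrite [RHS]integralE Ep En.
by rewrite fin_num_adde_defl // fin_numN; exact: fn.
Qed.

Lemma cible_chvar (f : T2 -> C R) : cmeas f ->
  cible mu (fun x => f (phi x)) <-> cible nu f.
Proof.
move=> [m1 m2]; split=> -[h1 h2]; split.
- exact/(rible_chvar m1).
- exact/(rible_chvar m2).
- exact/(rible_chvar m1).
- exact/(rible_chvar m2).
Qed.

Lemma cI_chvar (f : T2 -> C R) : cmeas f ->
  cible mu (fun x => f (phi x)) -> cI nu f = Complex c 0 * cI mu (fun x => f (phi x)).
Proof.
move=> [m1 m2] [h1 h2]; apply: complex_ext; rewrite ?cReM ?cImM /= rI_chvar //; ring.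
Qed.

Lemma cmeas_chvar (f : T2 -> C R) : cmeas f -> cmeas (fun x => f (phi x)).
Proof. by move=> [f1 f2]; split; [exact: measurableT_comp f1 mphi|exact: measurableT_comp f2 mphi]. Qed.

End ChangeOfVariables.

(** * Null sets and integrals of arbitrary functions *)

Section Null.
Context d (T : measurableType d) (R : realType) (mu : {measure set T -> \bar R}).
Variable N : set T.
Hypotheses (mN : measurable N) (N0 : mu N = 0%E).

Import HBNNSimple.

(** The functions need not be measurable: the integral is a supremum over simple functions below
    [f], and cutting such a function off on [N] leaves its integral unchanged while putting it below
    [g]. This allows the values of the symbol on the axes to be replaced. *)
Lemma ge0_integral_null_le (f g : T -> \bar R) :
  (forall x, 0 <= f x)%E -> (forall x, 0 <= g x)%E ->
  (forall x, ~ N x -> f x = g x) ->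
  (\int[mu]_x f x <= \int[mu]_x g x)%E.
Proof.
move=> f0 g0 fg; rewrite ge0_integralTE //.
apply: ge_ereal_sup => _ [h hf <-].
pose h' := proj_nnsfun h (measurableC mN).
rewrite [leRHS]ge0_integralTE //.
have hE x : h' x = h x * \1_(~` N) x by [].
apply: le_trans (ereal_sup_ubound (ex_intro2 _ _ h' _ erefl)); last first.
  move=> x; rewrite hE indicE; have [xN|xN] := pselect (N x).
    by rewrite memNset ?mulr0 //=; apply.
  by rewrite mem_set // mulr1 -fg.
rewrite -!integralT_nnsfun.
rewrite (ae_eq_integral (EFin \o h')) //.
- exact/measurable_EFinP.
- exact/measurable_EFinP.
exists N; split => // x hx; apply: contrapT => xN; apply: hx => _.
by rewrite /comp hE indicE mem_set // mulr1.
Qed.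

Lemma integral_null (f g : T -> \bar R) : (forall x, ~ N x -> f x = g x) ->
  (\int[mu]_x f x = \int[mu]_x g x)%E.
Proof.
move=> fg; rewrite [LHS]integralE [RHS]integralE.
have gf x : ~ N x -> g x = f x by move=> /fg.
congr (_ - _)%E; apply/eqP; rewrite eq_le; apply/andP; split;
  apply: ge0_integral_null_le => // x /fg E;
  by rewrite ?funeposE ?funenegE E.
Qed.

End Null.

Section LebIntegral.
Variable R : realType.

(** In positive dimension [lebm] reduces to [leb], so the two integrals are convertible. *)
Lemma cintE m (f : 'rV[R]_m -> C R) : (0 < m)%N ->
  cint f = cI (@lebm R m) (f : borelRn R m -> C R).
Proof. by case: m f. Qed.

Definition one_pos : 0 < 1 :> R := ltr01.

Lemma lebm_catE p q (A : set (borelRn R (p + q))) : measurable A ->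
  lebm A = (1%:E * (@lebm R p \x @lebm R q)%E (@catmx R p q @^-1` A))%E.
Proof. by move=> mA; rewrite mul1e lebm_cat. Qed.

Lemma cI_cat p q (f : 'rV[R]_(p + q) -> C R) :
  cmeas (f : borelRn R (p + q) -> C R) ->
  cible (@lebm R p \x @lebm R q)%E (fun z => f (row_mx z.1 z.2)) ->
  cI (@lebm R (p + q)) (f : borelRn R (p + q) -> C R) =
  cI (@lebm R p \x @lebm R q)%E (fun z => f (row_mx z.1 z.2)).
Proof.
move=> mf hf.
by rewrite (cI_chvar one_pos (catmx_measurable (R := R) (p := p) (q := q)) (@lebm_catE p q) mf hf) mul1r.
Qed.

Lemma cmeas_cat p q (f : 'rV[R]_(p + q) -> C R) :
  cmeas (f : borelRn R (p + q) -> C R) ->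
  cmeas (fun z : borelRn R p * borelRn R q => f (row_mx z.1 z.2)).
Proof. exact: (cmeas_chvar (catmx_measurable (R := R) (p := p) (q := q))). Qed.

Lemma lebm_affineE m (t : R) (v : 'rV[R]_m) : 0 < t ->
  forall A : set (borelRn R m), measurable A ->
  lebm A = ((t ^+ m)%:E * lebm (affmap t v @^-1` A))%E.
Proof. by move=> t0 A mA; exact: lebm_affine. Qed.

Lemma cI_affine m (t : R) (v : 'rV[R]_m) (f : 'rV[R]_m -> C R) : 0 < t ->
  cible (@lebm R m) (f : borelRn R m -> C R) ->
  cible (@lebm R m) (fun x : borelRn R m => f (t *: (x : 'rV[R]_m) + v)) /\
  cI (@lebm R m) (f : borelRn R m -> C R) =
  Complex (t ^+ m) 0 * cI (@lebm R m) (fun x : borelRn R m => f (t *: (x : 'rV[R]_m) + v)).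
Proof.
move=> t0 hf; have mf := cible_meas hf.
have tm0 : 0 < t ^+ m by rewrite exprn_gt0.
have hf' := (cible_chvar tm0 (@affine_measurable R m t v) (lebm_affineE v t0) mf).2 hf.
by split => //; exact: (cI_chvar tm0 (@affine_measurable R m t v) (lebm_affineE v t0) mf hf').
Qed.

Lemma rI_affine m (t : R) (v : 'rV[R]_m) (f : 'rV[R]_m -> R) : 0 < t ->
  rible (@lebm R m) (f : borelRn R m -> R) ->
  rible (@lebm R m) (fun x : borelRn R m => f (t *: (x : 'rV[R]_m) + v)) /\
  rI (@lebm R m) (f : borelRn R m -> R) =
  t ^+ m * rI (@lebm R m) (fun x : borelRn R m => f (t *: (x : 'rV[R]_m) + v)).
Proof.
move=> t0 hf; have mf := rible_meas hf.
have tm0 : 0 < t ^+ m by rewrite exprn_gt0.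
have hf' := (rible_chvar tm0 (@affine_measurable R m t v) (lebm_affineE v t0) mf).2 hf.
by split => //; exact: (rI_chvar tm0 (@affine_measurable R m t v) (lebm_affineE v t0) mf hf').
Qed.

End LebIntegral.

(** * Integrals of tensor products *)

Section ProductIntegrals.
Variable R : realType.
Notation leb1 := (@lebesgue_measure R).

(** The sign [s] treats together the identification of the line with rows of length 1 and its
    composite with the reflection. Under the reflection the half-open interval changes its closed
    end, which does not affect its length. *)
Lemma lebm1_chvar (s : R) (A : set (borelRn R 1)) : s = 1 \/ s = -1 -> measurable A ->
  lebm A = (1%:E * leb1
    ((fun t : measurableTypeR R => const_mx (s * (t : R))%R : borelRn R 1) @^-1` A))%E.
Proof.
move=> hs mA; rewrite mul1e; apply/esym.
have mf : measurable_fun setT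
    (fun t : measurableTypeR R => const_mx (s * (t : R)) : borelRn R 1).
  apply: measurable_fun_rV => i; under eq_fun do rewrite mxE.
  by apply: measurable_funM; [exact: measurable_cst|exact: measurable_id].
apply: (lebm_unique (nu := [the measure _ _ of
   pushforward (@lebesgue_measure R)
   (fun t : measurableTypeR R => const_mx (s * (t : R))%R : borelRn R 1)])) => // a b /=.
rewrite /pushforward /boxvol big_ord_recl big_ord0 mulr1.
case: hs => ->.
  rewrite (_ : _ @^-1` _ = `[a 0 0, b 0 0[%classic) ?lebesgue_measure_co //.
  apply/seteqP; split=> t /=; rewrite in_itv /=.
    by move=> /(_ 0); rewrite mxE mul1r.
  by move=> h i; rewrite mxE (ord1 i) mul1r.
rewrite (_ : _ @^-1` _ = `](- b 0 0), (- a 0 0)]%classic).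
  rewrite lebesgue_measure_itv /= lte_fin ltrN2; case: ltP => ab.
    by rewrite -EFinB max_r ?subr_ge0 ?ltW //; congr EFin; ring.
  by rewrite max_l // subr_le0.
apply/seteqP; split=> t /=; rewrite in_itv /=.
  by move=> /(_ 0); rewrite mxE mulN1r => /andP[h1 h2]; apply/andP; split; lra.
by move=> h i; rewrite mxE (ord1 i) mulN1r; case/andP: h => h1 h2; apply/andP; split; lra.
Qed.

Lemma const_mx_measurable (s : R) : measurable_fun setT
    (fun t : measurableTypeR R => const_mx (s * (t : R)) : borelRn R 1).
Proof.
apply: measurable_fun_rV => i; under eq_fun do rewrite mxE.
by apply: measurable_funM; [exact: measurable_cst|exact: measurable_id].
Qed.

Lemma cI_lebm1 (F : R -> C R) : cible leb1 F ->
  cible (@lebm R 1) (fun x : borelRn R 1 => F (x 0 0)) /\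
  cI (@lebm R 1) (fun x : borelRn R 1 => F (x 0 0)) = cI leb1 F.
Proof.
move=> hF.
have E : (fun t : R => F ((const_mx (1 * t) : 'rV[R]_1) 0 0)) = F.
  by apply/funext => t; rewrite mxE mul1r.
have mF : cmeas (fun x : borelRn R 1 => F (x 0 0)).
  by case: (cible_meas hF) => m1 m2; split; [exact: (measurableT_comp m1 (coord_measurable _))|exact: (measurableT_comp m2 (coord_measurable _))].
have nuE := fun A => @lebm1_chvar 1 A (or_introl erefl).
split.
  by apply/(cible_chvar (one_pos R) (const_mx_measurable 1) nuE mF); rewrite E.
rewrite (cI_chvar (one_pos R) (const_mx_measurable 1) nuE mF) ?E //.
by rewrite mul1r.
Qed.

Lemma cI_lebN (F : R -> C R) : cible leb1 F ->
  cI leb1 (fun t => F (- t)) = cI leb1 F.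
Proof.
move=> hF; have [h1 h2] := cI_lebm1 hF; rewrite -h2.
have mF := cible_meas h1.
have nuE := fun A => @lebm1_chvar (-1) A (or_intror erefl).
have E : (fun t : R => F ((const_mx (-1 * t) : 'rV[R]_1) 0 0)) = (fun t => F (- t)).
  by apply/funext => t; rewrite mxE mulN1r.
have := (cible_chvar (one_pos R) (const_mx_measurable (-1)) nuE mF).2 h1.
by move=> h3; rewrite (cI_chvar (one_pos R) (const_mx_measurable (-1)) nuE mF) // E mul1r.
Qed.

Lemma cI_prod m (F : 'I_m -> R -> C R) : (forall i, cible leb1 (F i)) ->
  cible (@lebm R m) (fun x : borelRn R m => \prod_(i < m) F i (x 0 i)) /\
  cI (@lebm R m) (fun x : borelRn R m => \prod_(i < m) F i (x 0 i)) =
  \prod_(i < m) cI leb1 (F i).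
Proof.
elim: m F => [|m IH] F hF.
  under eq_fun do rewrite big_ord0; rewrite big_ord0.
  have h (f : R) : (\int[@lebm R 0]_x f%:E = f%:E)%E.
    by rewrite /lebm integral_dirac // diracT mul1e.
  split; last by apply: complex_ext; rewrite /= /rI /Rintegral h.
  split; apply/integrableP; split; try exact: measurable_cst.
    by rewrite /= h ltry.
  by rewrite /= h ltry.
pose G (x : borelRn R 1) : C R := F ord0 (x 0 0).
pose H (y : borelRn R m) : C R := \prod_(j < m) F (lift ord0 j) (y 0 j).
have [hG IG] : cible (@lebm R 1) G /\ cI (@lebm R 1) G = cI leb1 (F ord0) := cI_lebm1 (hF ord0).
have [hH IH'] := IH (fun j => F (lift ord0 j)) (fun j => hF _).
have E (x : 'rV[R]_1) (y : 'rV[R]_m) :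
    \prod_(i < 1 + m) F i ((row_mx x y) 0 i) = G x * H y.
  rewrite (big_ord_recl m) /G /H; congr (_ * _).
    by rewrite (_ : ord0 = lshift m (0 : 'I_1)) ?row_mxEl //; exact: val_inj.
  apply: eq_bigr => j _.
  by rewrite (_ : lift ord0 j = rshift 1 j) ?row_mxEr //; exact: val_inj.
have mf : cmeas (fun x : borelRn R (1 + m) => \prod_(i < 1 + m) F i (x 0 i)).
  apply: cmeas_prod => i; case: (cible_meas (hF i)) => m1 m2.
  by split; [exact: (measurableT_comp m1 (coord_measurable _))|exact: (measurableT_comp m2 (coord_measurable _))].
have Ef : (fun z : borelRn R 1 * borelRn R m =>
      \prod_(i < 1 + m) F i ((row_mx (z.1 : 'rV[R]_1) (z.2 : 'rV[R]_m)) 0 i)) =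
    (fun z => G z.1 * H z.2) by apply/funext => z; exact: E.
have mf' : cmeas (fun z : borelRn R 1 * borelRn R m => G z.1 * H z.2).
  by rewrite -Ef; exact: (cmeas_cat mf).
have [hp hs] : cible (@lebm R 1 \x @lebm R m)%E (fun z => G z.1 * H z.2) /\
    (forall x, cible (@lebm R m) (fun y => G x * H y)).
  apply: (cible_prod (K := rI (@lebm R m) (fun y => cabs (H y))) mf' (cible_cabs hG)
     (h := fun _ y => cabs (H y))) => //.
  - by move=> _; exact: cible_cabs.
  - by move=> x; exact: cabs_ge0.
  - by move=> x y /=; rewrite cabsM.
split.
  apply/(cible_chvar (one_pos R) (catmx_measurable (R := R) (p := 1) (q := m)) (@lebm_catE R 1 m) mf).
  by rewrite /catmx Ef.
rewrite (@cI_cat R 1 m _ mf); last by rewrite Ef.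
rewrite Ef (cfubini1 hp hs).2 big_ord_recl -IH' -IG -/(H) -cIZr //.
by congr cI; apply/funext => x; rewrite -cIZ.
Qed.

End ProductIntegrals.

(** * Fourier inversion *)

Section IsDerive.
Variables (R : realType) (V : normedModType R).
Implicit Types (f g : V -> R) (x v : V).

Lemma isderD f g x v (df dg : R) : is_derive x v f df -> is_derive x v g dg ->
  is_derive x v (fun y => f y + g y) (df + dg).
Proof. by move=> h1 h2; exact: is_deriveD. Qed.

Lemma isderB f g x v (df dg : R) : is_derive x v f df -> is_derive x v g dg ->
  is_derive x v (fun y => f y - g y) (df - dg).
Proof. by move=> h1 h2; exact: is_deriveB. Qed.

Lemma isderN f x v (df : R) : is_derive x v f df ->
  is_derive x v (fun y => - f y) (- df).
Proof. by move=> h1; exact: is_deriveN. Qed.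

Lemma isderM f g x v (df dg : R) : is_derive x v f df -> is_derive x v g dg ->
  is_derive x v (fun y => f y * g y) (df * g x + f x * dg).
Proof.
move=> h1 h2; have h := is_deriveM h1 h2.
by apply: (is_derive_eq h); rewrite /GRing.scale /= addrC mulrC.
Qed.

Lemma isderZ f x v (k df : R) : is_derive x v f df ->
  is_derive x v (fun y => k * f y) (k * df).
Proof. by move=> h1; exact: is_deriveZ. Qed.

Lemma isder_cst x v (c : R) : is_derive x v (fun=> c) 0.
Proof. exact: is_derive_cst. Qed.

Lemma isder_eq f x v (d d' : R) : is_derive x v f d -> d = d' -> is_derive x v f d'.
Proof. by move=> h <-. Qed.

End IsDerive.

Lemma isder_comp (R : realType) (f g : R -> R) (x a b : R) :
  is_derive (g x) 1 f a -> is_derive x 1 g b ->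
  is_derive x 1 (fun y => f (g y)) (a * b).
Proof. by move=> h1 h2; exact: is_derive1_comp. Qed.

Lemma isder_lin (R : realType) (a x : R) : is_derive x 1 (fun t => a * t) a.
Proof.
apply: (isder_eq (isderZ a (is_derive_id x 1))); exact: mulr1.
Qed.

(** * The Laplace kernel on the line and its Fourier transform *)

Section Kernel1.
Variable R : realType.
Notation leb1 := (@lebesgue_measure R).
Implicit Types a t : R.

(** The summability kernel of the inversion theorem. Its transform is a multiple of [wgt], which
    also provides the integrable majorants. *)
Definition lapl t : R := expR (- `|t|).
Definition wgt t : R := (1 + t ^+ 2)^-1.

Lemma oneD_neq0 t : 1 + t ^+ 2 != 0.
Proof. by rewrite gt_eqF // ltr_pwDl // sqr_ge0. Qed.

Lemma wgt_gt0 t : 0 < wgt t.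
Proof. by rewrite invr_gt0 ltr_pwDl // sqr_ge0. Qed.

Lemma lapl_continuous : continuous lapl.
Proof.
move=> t; apply: continuous_comp; last exact: continuous_expR.
by apply: continuousN; exact: norm_continuous.
Qed.

(** Evenness reduces to the half-line, where the improper fundamental theorem of calculus for
    nonnegative integrands applies. *)
Lemma ge0_even_rible (f F : R -> R) (l : R) :
  (forall x, 0 <= f x) -> continuous f -> (forall x, f (- x) = f x) ->
  F x @[x --> +oo] --> l ->
  (forall x, derivable F x 1) ->
  (forall x, 0 < x -> derive1 F x = f x) ->
  rible leb1 f /\ rI leb1 f = 2 * (l - F 0).
Proof.
move=> f0 cf fN Fl dF Ff.
have E : (\int[leb1]_x (f x)%:E = (2 * (l - F 0))%:E)%E.
  rewrite ge0_symfun_integralT //; last by move=> x /=; rewrite fN.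
  rewrite (_ : [set x | 0 <= x] = `[0, +oo[%classic); last first.
    by apply/seteqP; split => x /=; rewrite in_itv /= andbT.
  rewrite (@ge0_continuous_FTC2y _ f F 0 l) ?EFinM ?EFinB //.
  - by apply: continuous_subspaceT.
  - apply: cvg_at_right_filter; apply: differentiable_continuous.
    exact/derivable1_diffP.
  - by move=> x; rewrite in_itv /= andbT => x0; exact: Ff.
split; last by rewrite /rI /Rintegral E.
apply/integrableP; split.
  by apply/measurable_EFinP; exact: continuous_measurable_fun.
rewrite (_ : (fun x => _) = (fun x => (f x)%:E)); last first.
  by apply/funext => x /=; rewrite ger0_norm.
by rewrite E ltry.
Qed.

Lemma wgt_rible : rible leb1 wgt.
Proof.
apply: (ge0_even_rible (F := atan) (l := pi / 2) _ _ _ _ _ _).1 => //.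
- by move=> x; exact/ltW/wgt_gt0.
- exact: continuous_oneDsqrV.
- by move=> x; rewrite /wgt sqrrN.
- exact: cvgy_atan.
- by move=> x _; rewrite derive1E derive_val.
Qed.

Definition lapl_prim a t : R :=
  expR (- t) * ((a * sin (a * t) - cos (a * t)) / (1 + a ^+ 2) - 1).

Lemma lapl_prim_is_derive a t :
  is_derive t 1 (lapl_prim a) (expR (- t) * (1 + cos (a * t))).
Proof.
have h1 : is_derive t 1 (fun t => expR (- t)) (expR (- t) * (- 1)).
  by apply: isder_comp.
have h2 : is_derive t 1 (fun t => sin (a * t)) (cos (a * t) * a).
  by apply: isder_comp; exact: isder_lin.
have h3 : is_derive t 1 (fun t => cos (a * t)) (- sin (a * t) * a).
  by apply: isder_comp; exact: isder_lin.
have h4 := isderM (isderB (isderZ a h2) h3) (isder_cst t 1 (1 + a ^+ 2)^-1).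
have h5 := isderM h1 (isderB h4 (isder_cst t 1 1)).
by apply: (isder_eq h5); field; exact: oneD_neq0.
Qed.

Lemma lapl_prim_cvg a : lapl_prim a x @[x --> +oo] --> (0 : R).
Proof.
pose K := (`|a| + 1) / (1 + a ^+ 2) + 1.
have e0 : K * expR (- x) @[x --> +oo] --> (0 : R).
  by rewrite -[X in _ --> X](mulr0 K); apply: cvgM; [exact: cvg_cst|exact: cvgr_expR].
have b x : `|lapl_prim a x| <= K * expR (- x).
  rewrite /lapl_prim normrM (ger0_norm (expR_ge0 _)) mulrC ler_wpM2r ?expR_ge0 //.
  apply: le_trans (ler_normB _ _) _; rewrite normr1 lerD2r normrM.
  have p : 0 <= (1 + a ^+ 2)^-1 by rewrite invr_ge0 addr_ge0 // sqr_ge0.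
  rewrite (ger0_norm p) ler_wpM2r //.
  apply: le_trans (ler_normB _ _) _; apply: lerD.
    by rewrite normrM ler_piMr // ler_norml sin_geN1 sin_le1.
  by rewrite ler_norml cos_geN1 cos_le1.
apply: (@squeeze_cvgr _ _ _ _ (fun x => - (K * expR (- x))) (fun x => K * expR (- x))) => //.
  by near=> x; rewrite -ler_norml; exact: b.
by rewrite -[X in _ --> X]oppr0; exact: cvgN.
Unshelve. all: by end_near. Qed.

(** The summand 1 makes the integrand nonnegative, as [ge0_even_rible] requires; the case [a = 0]
    yields the integral of [lapl], which [cker1_cI] subtracts again. On the positive half-line
    [lapl_prim a] is a primitive. *)
Lemma lapl_cos a : rible leb1 (fun t => lapl t * (1 + cos (a * t))) /\
  rI leb1 (fun t => lapl t * (1 + cos (a * t))) = 2 * (1 + wgt a).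
Proof.
have dF x : derivable (lapl_prim a) x 1 by exact: (@ex_derive _ _ _ _ _ _ _ (lapl_prim_is_derive a x)).
have [h1 h2] : rible leb1 (fun t => lapl t * (1 + cos (a * t))) /\
  rI leb1 (fun t => lapl t * (1 + cos (a * t))) = 2 * (0 - lapl_prim a 0).
  apply: ge0_even_rible (lapl_prim_cvg a) dF _ => //.
  - move=> x; apply: mulr_ge0; first exact: expR_ge0.
    by rewrite -lerBlDl sub0r cos_geN1.
  - move=> x; apply: continuousM; first exact: lapl_continuous.
    apply: continuousD; first exact: cst_continuous.
    apply: continuous_comp; last exact: continuous_cos.
    exact: mulrl_continuous.
  - by move=> x; rewrite /lapl normrN mulrN cosN.
  - move=> x x0; rewrite derive1E (@derive_val _ _ _ _ _ _ _ (lapl_prim_is_derive a x)).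
    by rewrite /lapl gtr0_norm.
split => //; rewrite h2 /lapl_prim /wgt oppr0 expR0 mulr0 sin0 cos0 mulr0.
by field; exact: oneD_neq0.
Qed.

Lemma lapl_rible : rible leb1 lapl /\ rI leb1 lapl = 2.
Proof.
have [h1 h2] := lapl_cos 0.
have E : (fun t => lapl t * (1 + cos (0 * t))) = (fun t => 2 * lapl t).
  by apply/funext => t; rewrite mul0r cos0 mulrC.
rewrite E in h1 h2.
have h3 : rible leb1 lapl.
  rewrite (_ : lapl = (fun t => 2^-1 * (2 * lapl t))); first exact: ribleZ.
  by apply/funext => t; field.
split => //; move: h2; rewrite rIZ // /wgt expr0n /= addr0 invr1; lra.
Qed.

Definition cker1 a t : C R := Complex (lapl t) 0 * cexpi (a * t).

Lemma cker1_cible a : cible leb1 (cker1 a).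
Proof.
apply: (cible_dom _ lapl_rible.1).
  apply: cmeasM.
    by apply: cmeasR; apply: continuous_measurable_fun; exact: lapl_continuous.
  apply: cmeas_cexpi; apply: measurable_funM; first exact: measurable_cst.
  exact: measurable_id.
by move=> t; rewrite cabsM cabs_cexpi mulr1 cabsR ger0_norm ?expR_ge0.
Qed.

Lemma cker1_cI a : cI leb1 (cker1 a) = Complex (2 * wgt a) 0.
Proof.
have h := cker1_cible a.
apply: complex_ext => /=.
  rewrite (_ : (fun x => cRe (cker1 a x)) = fun t => lapl t * (1 + cos (a * t)) - lapl t); last first.
    by apply/funext => t; rewrite /cker1 cReM /= mul0r subr0; ring.
  by rewrite rIB ?(lapl_cos a).2 ?lapl_rible.2 ?(lapl_cos a).1 ?lapl_rible.1 //; ring.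
(* The imaginary part lapl t * sin (a t) is odd, so reflection changes the sign of its integral. *)
have : cIm (cI leb1 (cker1 a)) = - cIm (cI leb1 (cker1 a)).
  have imE F : cIm (cI leb1 F) = rI leb1 (fun t => cIm (F t)) by [].
  rewrite -{1}(cI_lebN h) -cImN -cIN // !imE.
  congr rI; apply/funext => t; rewrite /cker1 cImN !cImM /= !mul0r !addr0.
  by rewrite /lapl normrN mulrN sinN mulrN.
move=> /= e; lra.
Qed.

End Kernel1.

Section KernelN.
Variable R : realType.
Notation leb1 := (@lebesgue_measure R).

Lemma poisson_rible : rible leb1 (fun t : R => 2 * wgt (2 * pi * t)) /\
  rI leb1 (fun t : R => 2 * wgt (2 * pi * t)) = 1.
Proof.
have pi0 : pi != 0 :> R by rewrite gt_eqF // pi_gt0.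
have dF (x : R) : is_derive x 1 (fun t : R => pi^-1 * atan (2 * pi * t)) (2 * wgt (2 * pi * x)).
  have h : is_derive x 1 (fun t : R => atan (2 * pi * t)) ((1 + (2 * pi * x) ^+ 2)^-1 * (2 * pi)).
    by apply: isder_comp; exact: isder_lin.
  by apply: (isder_eq (isderZ pi^-1 h)); rewrite /wgt (mulrC 2 pi) mulrCA mulKf // [LHS]mulrC.
have [||||||h1 h2] := @ge0_even_rible R (fun t : R => 2 * wgt (2 * pi * t))
    (fun t => pi^-1 * atan (2 * pi * t)) (2^-1).
- by move=> x; rewrite mulr_ge0 // ltW // wgt_gt0.
- move=> x; apply: cvgM; first exact: cvg_cst.
  apply: (@continuous_comp _ _ _ (fun t : R => 2 * pi * t) (@wgt R)).
    exact: mulrl_continuous.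
  exact: continuous_oneDsqrV.
- by move=> x; rewrite /wgt mulrN sqrrN.
- rewrite (_ : 2^-1 = pi^-1 * (pi / 2)); last by rewrite mulrA mulVf // mul1r.
  apply: cvgM; first exact: cvg_cst.
  apply: (@cvg_comp _ _ _ (fun x : R => 2 * pi * x) (@atan R) _ _ _ _ (@cvgy_atan R)).
  by apply: gt0_cvgMry; [rewrite mulr_gt0 // pi_gt0|exact: cvg_id].
- by move=> x; apply: (@ex_derive _ _ _ _ _ _ _ (dF x)).
- by move=> x x0; rewrite derive1E (@derive_val _ _ _ _ _ _ _ (dF x)).
by split => //; rewrite h2 mulr0 atan0 mulr0 subr0; field.
Qed.

Definition wgtn m (x : 'rV[R]_m) : R := \prod_(i < m) wgt (x 0 i).
Definition lapln m (x : 'rV[R]_m) : R := \prod_(i < m) lapl (x 0 i).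
(** A product of Cauchy densities of scale 1/(2 pi), hence of total mass 1: the Fourier transform of
    [lapln]. *)
Definition poissonn m (x : 'rV[R]_m) : R := \prod_(i < m) (2 * wgt (2 * pi * x 0 i)).

Lemma complexRM (a b : R) : Complex (a * b) 0 = Complex a 0 * Complex b 0 :> C R.
Proof. by apply: complex_ext; rewrite ?cReM ?cImM /=; ring. Qed.

Lemma complexR_prod (I : Type) (s : seq I) (f : I -> R) :
  Complex (\prod_(i <- s) f i) 0 = \prod_(i <- s) Complex (f i) 0 :> C R.
Proof.
elim: s => [|i s IH]; first by rewrite !big_nil.
by rewrite !big_cons complexRM IH.
Qed.

Lemma cexpi_sum (I : Type) (s : seq I) (f : I -> R) :
  cexpi (\sum_(i <- s) f i) = \prod_(i <- s) cexpi (f i).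
Proof.
elim: s => [|i s IH]; first by rewrite !big_nil cexpi0.
by rewrite !big_cons cexpiD IH.
Qed.

Lemma rible_prodn m (f : R -> R) : rible leb1 f ->
  rible (@lebm R m) (fun x : borelRn R m => \prod_(i < m) f (x 0 i)) /\
  rI (@lebm R m) (fun x : borelRn R m => \prod_(i < m) f (x 0 i)) = rI leb1 f ^+ m.
Proof.
move=> hf.
have hc : cible leb1 (fun t => Complex (f t) 0) by split => //; exact: integrable0.
have [h1 h2] := cI_prod (fun _ : 'I_m => hc).
have E : (fun x : borelRn R m => \prod_(i < m) f (x 0 i)) =
   (fun x => cRe (\prod_(i < m) Complex (f (x 0 i)) 0)).
  by apply/funext => x; rewrite -complexR_prod.
split; first by rewrite E; exact: h1.1.
have := congr1 (fun z : C R => cRe z) h2; rewrite /= -E => ->.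
rewrite /cI /= (_ : rI leb1 (fun=> 0) = 0); last by rewrite /rI /Rintegral integral0.
by rewrite -complexR_prod /= prodr_const card_ord.
Qed.

Lemma wgtn_rible m : rible (@lebm R m) (@wgtn m).
Proof. exact: (rible_prodn m (wgt_rible R)).1. Qed.

Lemma wgtn_gt0 m (x : 'rV[R]_m) : 0 < wgtn x.
Proof. by apply: prodr_gt0 => i _; exact: wgt_gt0. Qed.

Lemma lapln_rible m : rible (@lebm R m) (@lapln m).
Proof. exact: (rible_prodn m (lapl_rible R).1).1. Qed.

Lemma lapln_ge0 m (x : 'rV[R]_m) : 0 <= lapln x.
Proof. by apply: prodr_ge0 => i _; exact: expR_ge0. Qed.

Lemma lapln_le1 m (x : 'rV[R]_m) : lapln x <= 1.
Proof.
apply: prodr_ile1 => i _; rewrite expR_ge0 /= /lapl -expR0 ler_expR.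
by rewrite oppr_le0.
Qed.

Lemma poissonn_rible m : rible (@lebm R m) (@poissonn m) /\ rI (@lebm R m) (@poissonn m) = 1.
Proof.
have [h1 h2] := rible_prodn m poisson_rible.1.
by split => //; rewrite h2 poisson_rible.2 expr1n.
Qed.

Lemma poissonn_ge0 m (x : 'rV[R]_m) : 0 <= poissonn x.
Proof. by apply: prodr_ge0 => i _; rewrite mulr_ge0 // ltW // wgt_gt0. Qed.

Lemma lapln_fourier m (u : 'rV[R]_m) :
  cible (@lebm R m) (fun y : borelRn R m => Complex (lapln y) 0 * cexpi (2 * pi * dotp y u)) /\
  cI (@lebm R m) (fun y : borelRn R m => Complex (lapln y) 0 * cexpi (2 * pi * dotp y u)) =
  Complex (poissonn u) 0.
Proof.
have [h1 h2] := cI_prod (fun i : 'I_m => cker1_cible (2 * pi * u 0 i)).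
have E : (fun y : borelRn R m => Complex (lapln y) 0 * cexpi (2 * pi * dotp y u)) =
    (fun y => \prod_(i < m) cker1 (2 * pi * u 0 i) (y 0 i)).
  apply/funext => y; rewrite /lapln /dotp complexR_prod mulr_sumr cexpi_sum -big_split.
  by apply: eq_bigr => i _; rewrite /cker1; congr (_ * cexpi _); rewrite (mulrC (y 0 i)) mulrA.
rewrite E; split => //; rewrite h2 /poissonn complexR_prod.
by apply: eq_bigr => i _; rewrite cker1_cI.
Qed.

End KernelN.

(** * Inversion through Poisson averages *)

Section Inversion.
Variable R : realType.

Lemma cmeas_comp d d' (T : measurableType d) (T' : measurableType d')
  (f : T' -> C R) (g : T -> T') : cmeas f -> measurable_fun setT g ->
  cmeas (fun x => f (g x)).
Proof.
by move=> [f1 f2] mg; split; [exact: (measurableT_comp f1 mg)|exact: (measurableT_comp f2 mg)].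
Qed.

Lemma dotp_measurable d (T : measurableType d) m (f g : T -> borelRn R m) :
  measurable_fun setT f -> measurable_fun setT g ->
  measurable_fun setT (fun t => dotp (f t) (g t)).
Proof.
move=> mf mg; rewrite /dotp; apply: measurable_sum => i.
apply: measurable_funM.
  exact: (measurableT_comp (coord_measurable i) mf).
exact: (measurableT_comp (coord_measurable i) mg).
Qed.

Lemma dotpC m (x y : 'rV[R]_m) : dotp x y = dotp y x.
Proof. by apply: eq_bigr => i _; rewrite mulrC. Qed.

Lemma dotpDr m (x y z : 'rV[R]_m) : dotp x (y + z) = dotp x y + dotp x z.
Proof. by rewrite /dotp -big_split; apply: eq_bigr => i _; rewrite mxE mulrDr. Qed.

Lemma dotpZr m (x y : 'rV[R]_m) t : dotp x (t *: y) = t * dotp x y.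
Proof. by rewrite /dotp mulr_sumr; apply: eq_bigr => i _; rewrite mxE; ring. Qed.

Lemma dotpNr m (x y : 'rV[R]_m) : dotp x (- y) = - dotp x y.
Proof. by rewrite -scaleN1r dotpZr mulN1r. Qed.

Lemma dotpDl m (x y z : 'rV[R]_m) : dotp (y + z) x = dotp y x + dotp z x.
Proof. by rewrite dotpC dotpDr !(dotpC x). Qed.

Lemma dotpZl m (x y : 'rV[R]_m) t : dotp (t *: x) y = t * dotp x y.
Proof. by rewrite dotpC dotpZr dotpC. Qed.

Lemma cmeas_char m (y : 'rV[R]_m) :
  cmeas (fun x : borelRn R m => cexpi (2 * pi * dotp y x)).
Proof.
apply: cmeas_cexpi; apply: measurable_funM; first exact: measurable_cst.
by apply: dotp_measurable; [exact: measurable_cst|exact: measurable_id].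
Qed.

Lemma cible_char m (f : 'rV[R]_m -> C R) (g : 'rV[R]_m -> R) :
  measurable_fun setT (g : borelRn R m -> R) ->
  cible (@lebm R m) (f : borelRn R m -> C R) ->
  cible (@lebm R m) (fun x : borelRn R m => f x * cexpi (g x)).
Proof.
move=> mg hf; apply: (cible_dom _ (cible_cabs hf)).
  by apply: cmeasM; [exact: (cible_meas hf)|exact: cmeas_cexpi].
by move=> x; rewrite cabsM cabs_cexpi mulr1.
Qed.

Definition tk (k : nat) : R := k.+1%:R^-1.
Lemma tk_gt0 k : 0 < tk k. Proof. by rewrite invr_gt0. Qed.

Lemma tk_cvg : tk k @[k --> \oo] --> (0 : R).
Proof. exact: cvg_harmonic. Qed.

Lemma mul_tk_cvg (a : R) : tk k * a @[k --> \oo] --> (0 : R).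
Proof. by rewrite -[X in _ --> X](mul0r a); apply: cvgM; [exact: tk_cvg|exact: cvg_cst]. Qed.

Lemma lapln_cvg m (x : 'rV[R]_m) : ccvg (fun k => Complex (lapln (tk k *: x)) 0) 1.
Proof.
rewrite (_ : (fun k => _) = fun k => \prod_(i < m) Complex (lapl (tk k * x 0 i)) 0); last first.
  apply/funext => k; rewrite /lapln complexR_prod.
  by apply: eq_bigr => i _; rewrite mxE.
rewrite [X in ccvg _ X](_ : (1 : C R) = \prod_(i < m) 1); last by rewrite big1_eq.
apply: (@ccvg_prod R _ _ (fun i k => Complex (lapl (tk k * x 0 i)) 0) (fun=> 1)) => i.
split => /=; last exact: cvg_cst.
rewrite [X in _ --> X](_ : _ = @lapl R 0); last by rewrite /lapl normr0 oppr0 expR0.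
exact: (cvg_comp _ _ (mul_tk_cvg (x 0 i)) (@lapl_continuous R 0)).
Qed.

(* Pairing [V] with the rescaled Laplace weight turns into averaging [v]
   against the Poisson kernel, by Fubini and two dilations. *)
Lemma poisson_average m (v V : 'rV[R]_m -> C R) (z0 : 'rV[R]_m) (t : R) : 0 < t ->
  cible (@lebm R m) (v : borelRn R m -> C R) ->
  (forall x, V x = cI (@lebm R m) (fun z : borelRn R m => v z * cexpi (2 * pi * dotp x z))) ->
  cible (@lebm R m) (V : borelRn R m -> C R) ->
  cI (@lebm R m) (fun u : borelRn R m => v (t *: (u : 'rV[R]_m) + z0) * Complex (poissonn u) 0) =
  cI (@lebm R m) (fun x : borelRn R m => Complex (lapln (t *: (x : 'rV[R]_m))) 0 *
     (V x * cexpi (- (2 * pi * dotp x z0)))).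
Proof.
move=> t0 hv VE hV.
have tm0 : Complex (t ^+ m) 0 != 0 :> C R by rewrite eq_complex /= eqxx andbT expf_neq0 // gt_eqF.
pose F (p : borelRn R m * borelRn R m) : C R := v (t *: (p.1 : 'rV[R]_m) + z0) *
   (Complex (lapln p.2) 0 * cexpi (2 * pi * dotp p.2 p.1)).
have [hvt _] := cI_affine z0 t0 hv.
have mF : cmeas F.
  apply: cmeasM.
    exact: (cmeas_comp (cible_meas hvt) (@measurable_fst _ _ _ _)).
  apply: cmeasM.
    apply: cmeasR.
    exact: (measurableT_comp (rible_meas (lapln_rible R m)) (@measurable_snd _ _ _ _)).
  apply: cmeas_cexpi; apply: measurable_funM; first exact: measurable_cst.
  by apply: dotp_measurable; [exact: measurable_snd|exact: measurable_fst].
have bF x y : cabs (F (x, y)) <= cabs (v (t *: (x : 'rV[R]_m) + z0)) * lapln y.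
  by rewrite /F /= !cabsM cabs_cexpi mulr1 cabsR ger0_norm // lapln_ge0.
have [hF1 hF2] := cible_prod (K := rI (@lebm R m) (@lapln R m)) mF (cible_cabs hvt)
  (fun _ => lapln_rible R m) (fun _ => cabs_ge0 _) (fun _ => lexx _) bF.
have hF3 y : cible (@lebm R m) (fun x => F (x, y)).
  rewrite (_ : (fun x => F (x, y)) = fun x => Complex (lapln y) 0 *
      (v (t *: (x : 'rV[R]_m) + z0) * cexpi (2 * pi * dotp y x))); last first.
    by apply/funext => x; rewrite /F /= mulrCA.
  apply: cibleZ.
  apply: cible_char => //; apply: measurable_funM; first exact: measurable_cst.
  by apply: dotp_measurable; [exact: measurable_cst|exact: measurable_id].
transitivity (cI (@lebm R m \x @lebm R m)%E F).
  rewrite (cfubini1 hF1 hF2).2; congr cI; apply/funext => u.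
  by rewrite /F /= cIZ ?(lapln_fourier u).2 //; exact: (lapln_fourier u).1.
rewrite (cfubini2 hF1 hF3).2.
pose g (x : 'rV[R]_m) := V x * cexpi (- (2 * pi * dotp x z0)).
have hg : cible (@lebm R m) (g : borelRn R m -> C R).
  apply: cible_char => //; apply: measurableT_comp => //.
  apply: measurable_funM; first exact: measurable_cst.
  by apply: dotp_measurable; [exact: measurable_id|exact: measurable_cst].
(* The substitution z = t u + z0 in the integral defining [V] at y / t. Its Jacobian t^m is
   cancelled at the end by that of the dilation in [y]. *)
have inner y : Complex (t ^+ m) 0 * cI (@lebm R m) (fun x => F (x, y)) =
    Complex (lapln y) 0 * g (t^-1 *: y).
  pose q (u : 'rV[R]_m) := v (t *: u + z0) * cexpi (2 * pi * dotp y u).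
  have hq : cible (@lebm R m) (q : borelRn R m -> C R).
    apply: cible_char => //; apply: measurable_funM; first exact: measurable_cst.
    by apply: dotp_measurable; [exact: measurable_cst|exact: measurable_id].
  pose f (z : 'rV[R]_m) := v z * cexpi (2 * pi * dotp (t^-1 *: y) z).
  have hf : cible (@lebm R m) (f : borelRn R m -> C R).
    apply: cible_char => //; apply: measurable_funM; first exact: measurable_cst.
    by apply: dotp_measurable; [exact: measurable_cst|exact: measurable_id].
  have [_ ft] := cI_affine z0 t0 hf.
  pose a := 2 * pi * dotp (t^-1 *: y) z0.
  have fq : (fun x : borelRn R m => f (t *: (x : 'rV[R]_m) + z0)) = (fun x => q x * cexpi a).
    apply/funext => u; rewrite /f /q -[RHS]mulrA -cexpiD /a; congr (_ * cexpi _).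
    by rewrite dotpDr dotpZr dotpZl (mulrA t) divff ?gt_eqF // mul1r mulrDr.
  have Fq : (fun x : borelRn R m => F (x, y)) = (fun x => Complex (lapln y) 0 * q x).
    by apply/funext => u; rewrite /F /q /= mulrCA.
  have ea : cexpi a * cexpi (- a) = 1 :> C R by rewrite -cexpiD subrr cexpi0.
  rewrite /g VE -/(f) ft fq Fq cIZ // cIZr // -/a.
  transitivity (Complex (lapln y) 0 * (Complex (t ^+ m) 0 * cI (@lebm R m) (q : borelRn R m -> C R)) *
     (cexpi a * cexpi (- a))).
    by rewrite ea mulr1 mulrCA.
  by rewrite !mulrA.
pose h (y : 'rV[R]_m) := Complex (lapln y) 0 * g (t^-1 *: y).
have Eh : (h : borelRn R m -> C R) = (fun y => Complex (t ^+ m) 0 * cI (@lebm R m) (fun x => F (x, y))).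
  by apply/funext => y; rewrite inner.
have hh : cible (@lebm R m) (h : borelRn R m -> C R).
  by rewrite Eh; apply: cibleZ; exact: (cfubini2 hF1 hF3).1.
apply: (mulfI tm0); rewrite -cIZ; last exact: (cfubini2 hF1 hF3).1.
rewrite -Eh (cI_affine 0 t0 hh).2; congr (_ * cI _ _); apply/funext => x.
by rewrite /h addr0 scalerA mulVf ?gt_eqF // scale1r.
Qed.

(** Dominated convergence on both sides of [poisson_average] at scale [tk k]: the averages tend to
    [v z0] because the kernel has mass 1, and the Laplace weights are at most 1 and tend to 1. Since
    only this sequence of scales occurs, continuity of [v] is asked for along the sequences
    [tk k *: u + z0] alone. *)
Theorem fourier_inversion m (v V : 'rV[R]_m -> C R) (z0 : 'rV[R]_m) (M : R) :
  cible (@lebm R m) (v : borelRn R m -> C R) ->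
  (forall z, cabs (v z) <= M) ->
  (forall x, V x = cI (@lebm R m) (fun z : borelRn R m => v z * cexpi (2 * pi * dotp x z))) ->
  cible (@lebm R m) (V : borelRn R m -> C R) ->
  (forall u, ccvg (fun k => v (tk k *: u + z0)) (v z0)) ->
  v z0 = cI (@lebm R m) (fun x : borelRn R m => V x * cexpi (- (2 * pi * dotp x z0))).
Proof.
move=> hv hM VE hV cv.
have hP : cible (@lebm R m) (fun u : borelRn R m => Complex (poissonn u) 0).
  by split; [exact: (poissonn_rible R m).1|exact: integrable0].
have hg : cible (@lebm R m) (fun x : borelRn R m => V x * cexpi (- (2 * pi * dotp x z0))).
  apply: cible_char => //; apply: measurableT_comp => //.
  apply: measurable_funM; first exact: measurable_cst.
  by apply: dotp_measurable; [exact: measurable_id|exact: measurable_cst].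
have l1 : ccvg (fun k => cI (@lebm R m) (fun u : borelRn R m =>
    v (tk k *: (u : 'rV[R]_m) + z0) * Complex (poissonn u) 0)) (v z0).
  rewrite (_ : v z0 = cI (@lebm R m) (fun u : borelRn R m => v z0 * Complex (poissonn u) 0)); last first.
    rewrite cIZ // /cI /= (poissonn_rible R m).2.
    rewrite (_ : rI _ (fun=> 0) = 0) ?mulr1 //.
    by rewrite /rI /Rintegral integral0.
  apply: (cI_dct (g := (fun u : borelRn R m => M * poissonn u))).
  - move=> k; apply: cmeasM; last exact: (cible_meas hP).
    exact: (cible_meas (cI_affine z0 (tk_gt0 k) hv).1).
  - by apply: cmeasM; [exact: cmeas_cst|exact: (cible_meas hP)].
  - by apply: ribleZ; exact: (poissonn_rible R m).1.
  - move=> k u; rewrite cabsM cabsR ger0_norm ?poissonn_ge0 //.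
    by rewrite ler_wpM2r ?poissonn_ge0.
  - by move=> u; apply: ccvgM; [exact: cv|exact: ccvg_cst].
have l2 : ccvg (fun k => cI (@lebm R m) (fun x : borelRn R m =>
    Complex (lapln (tk k *: (x : 'rV[R]_m))) 0 * (V x * cexpi (- (2 * pi * dotp x z0)))))
    (cI (@lebm R m) (fun x : borelRn R m => V x * cexpi (- (2 * pi * dotp x z0)))).
  apply: (cI_dct (g := (fun x : borelRn R m => cabs (V x)))).
  - move=> k; apply: cmeasM; last exact: (cible_meas hg).
    apply: cmeasR.
    have := rible_meas (rI_affine 0 (tk_gt0 k) (lapln_rible R m)).1.
    by under eq_fun do rewrite addr0.
  - exact: (cible_meas hg).
  - exact: cible_cabs.
  - move=> k x; rewrite !cabsM cabs_cexpi mulr1 cabsR ger0_norm ?lapln_ge0 //.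
    by rewrite ler_piMl ?cabs_ge0 // lapln_le1.
  - by move=> x; rewrite -[X in ccvg _ X]mul1r; apply: ccvgM; [exact: lapln_cvg|exact: ccvg_cst].
apply: (ccvg_unique l1); rewrite (_ : (fun k => _) = (fun k => cI (@lebm R m) (fun x : borelRn R m =>
    Complex (lapln (tk k *: (x : 'rV[R]_m))) 0 * (V x * cexpi (- (2 * pi * dotp x z0)))))) //.
by apply/funext => k; exact: (poisson_average z0 (tk_gt0 k) hv VE hV).
Qed.

End Inversion.

(** * Fourier transforms of smooth functions *)

Section LineDerivatives.
Variables (R : realType) (V : normedModType R).
Implicit Types (f g : V -> R) (x v : V).

Lemma isderP f x v (d : R) :
  is_derive x v f d <-> h^-1 * (f (h *: v + x) - f x) @[h --> 0^'] --> d.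
Proof.
split=> [[h1 h2]|h].
  have : derivable f x v by exact: h1.
  move=> /cvg_ex[l hl]; have El : l = d by rewrite -h2; apply/esym/cvg_lim.
  by rewrite -El; exact: hl.
by apply: DeriveDef; [apply/cvg_ex; exists d; exact: h|apply/cvg_lim => //; exact: h].
Qed.

End LineDerivatives.

Section ComplexDerivatives.
Variables (R : realType) (V : normedModType R).
Implicit Types (f g : V -> R) (x v : V).

Lemma isder_line f x v (s d : R) :
  is_derive s 1 (fun t : R => f (t *: v + x)) d <-> is_derive (s *: v + x) v f d.
Proof.
rewrite !isderP /=.
under eq_fun do rewrite scalerDl /GRing.scale /= mulr1 -[X in f X]addrA.
by [].
Qed.

Lemma isder_unique f x v (d d' : R) : is_derive x v f d -> is_derive x v f d' -> d = d'.
Proof. by move=> [_ <-] [_ <-]. Qed.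

Definition cder (f : V -> C R) x v (d : C R) :=
  is_derive x v (fun y => cRe (f y)) (cRe d) /\ is_derive x v (fun y => cIm (f y)) (cIm d).

Lemma cderD (f g : V -> C R) x v df dg : cder f x v df -> cder g x v dg ->
  cder (fun y => f y + g y) x v (df + dg).
Proof.
move=> [f1 f2] [g1 g2]; split; rewrite ?cReD ?cImD.
  by under eq_fun do rewrite cReD; exact: isderD.
by under eq_fun do rewrite cImD; exact: isderD.
Qed.

Lemma cder_cst x v (c : C R) : cder (fun=> c) x v 0.
Proof. by split; exact: isder_cst. Qed.

Lemma cderM (f g : V -> C R) x v df dg : cder f x v df -> cder g x v dg ->
  cder (fun y => f y * g y) x v (df * g x + f x * dg).
Proof.
move=> [f1 f2] [g1 g2]; split.
  under eq_fun do rewrite cReM.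
  apply: (isder_eq (isderB (isderM f1 g1) (isderM f2 g2))).
  by rewrite cReD !cReM; ring.
under eq_fun do rewrite cImM.
apply: (isder_eq (isderD (isderM f1 g2) (isderM f2 g1))).
by rewrite cImD !cImM; ring.
Qed.

Lemma cder_unique (f : V -> C R) x v d d' : cder f x v d -> cder f x v d' -> d = d'.
Proof.
move=> [h1 h2] [h3 h4].
by apply: complex_ext; [exact: (isder_unique h1 h3)|exact: (isder_unique h2 h4)].
Qed.

Lemma cderZ (f : V -> C R) x v df (c : C R) : cder f x v df ->
  cder (fun y => c * f y) x v (c * df).
Proof.
by move=> h; have := cderM (cder_cst x v c) h; rewrite mul0r add0r.
Qed.

Lemma cder_sum (I : Type) (s : seq I) (F : I -> V -> C R) (dF : I -> C R) x v :
  (forall i, cder (F i) x v (dF i)) ->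
  cder (fun y => \sum_(i <- s) F i y) x v (\sum_(i <- s) dF i).
Proof.
move=> h; elim: s => [|i s IH].
  by under eq_fun do rewrite big_nil; rewrite big_nil; exact: cder_cst.
by under eq_fun do rewrite big_cons; rewrite big_cons; exact: cderD.
Qed.

End ComplexDerivatives.

Lemma cder_line (R : realType) (V : normedModType R) (f : V -> C R) (x v : V) (s : R) (d : C R) :
  cder (fun t : R => f (t *: v + x)) s 1 d <-> cder f (s *: v + x) v d.
Proof.
split=> -[h1 h2]; split.
- exact/(@isder_line R V (fun y => cRe (f y))).
- exact/(@isder_line R V (fun y => cIm (f y))).
- exact/(@isder_line R V (fun y => cRe (f y))).
- exact/(@isder_line R V (fun y => cIm (f y))).
Qed.

(** * Differentiation under the integral sign *)

Section UnderIntegral.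
Context d (Y : measurableType d) (R : realType) (mu : {measure set Y -> \bar R}).

(** The parameter 0 and the window (-1, 1) suffice: a directional derivative at [x] is the
    derivative at 0 along the line t *: v + x, by [cder_line]. *)
Lemma rI_is_derive (f df : R -> Y -> R) (G : Y -> R) :
  (forall t : R, -1 < t < 1 -> rible mu (f t)) ->
  (forall (t : R) y, -1 < t < 1 -> is_derive t 1 (f^~ y) (df t y)) ->
  rible mu G -> (forall (t : R) y, -1 < t < 1 -> `|df t y| <= G y) ->
  is_derive (0 : R) 1 (fun t => rI mu (f t)) (rI mu (df 0)).
Proof.
move=> hf hd hG hb.
have I0 : [set` `](-1 : R), 1[ ] 0 by rewrite /= in_itv /= ltrN10 ltr01.
have E t y : -1 < t < 1 -> partial1of2 f t y = df t y.
  by move=> ht; rewrite partial1of2E; apply: derive_val; exact: hd.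
have D := @cvg_differentiation_under_integral R d Y mu f setT measurableT 0 (-1) 1 I0.
have -> : rI mu (df 0) = rI mu (fun y => partial1of2 f 0 y).
  by congr rI; apply/funext => y; rewrite E // ltrN10 ltr01.
apply/isderP; under eq_fun do rewrite [_ *: (1 : R)]mulr1.
apply: (D _ _ G).
- by move=> t; rewrite /= in_itv /=; exact: hf.
- move=> t y; rewrite /= in_itv /= => ht _; apply: (@ex_derive _ _ _ _ _ _ _ (hd t y ht)).
- move=> y; apply: le_trans (normr_ge0 _) (hb 0 y _).
  by rewrite ltrN10 ltr01.
- exact: hG.
- by move=> t y; rewrite /= in_itv /= => ht _; rewrite E //; exact: hb.
Qed.

Lemma cI_cder (f df : R -> Y -> C R) (G : Y -> R) :
  (forall t : R, -1 < t < 1 -> cible mu (f t)) ->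
  (forall (t : R) y, -1 < t < 1 -> cder (f^~ y) t 1 (df t y)) ->
  rible mu G -> (forall (t : R) y, -1 < t < 1 -> cabs (df t y) <= G y) ->
  cder (fun t => cI mu (f t)) 0 (1 : R) (cI mu (df 0)).
Proof.
move=> hf hd hG hb; split => /=.
  apply: (rI_is_derive (f := fun t y => cRe (f t y)) (df := fun t y => cRe (df t y)) (G := G)) => //.
  - by move=> t /hf[].
  - by move=> t y /(hd t y)[].
  - by move=> t y ht; exact: le_trans (Re_le_cabs _) (hb t y ht).
apply: (rI_is_derive (f := fun t y => cIm (f t y)) (df := fun t y => cIm (df t y)) (G := G)) => //.
- by move=> t /hf[].
- by move=> t y /(hd t y)[].
- by move=> t y ht; exact: le_trans (Im_le_cabs _) (hb t y ht).
Qed.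

End UnderIntegral.

Lemma cder_cexpi (R : realType) (c : C R) (a b t : R) :
  cder (fun t : R => c * cexpi (a * t + b)) t 1 (Complex 0 a * (c * cexpi (a * t + b))).
Proof.
have hl : is_derive t 1 (fun t => a * t + b) a.
  by apply: (isder_eq (isderD (isder_lin a t) (isder_cst t 1 b))); rewrite addr0.
have hc : is_derive t 1 (fun t => cos (a * t + b)) (- sin (a * t + b) * a).
  by apply: (@isder_comp _ cos).
have hs : is_derive t 1 (fun t => sin (a * t + b)) (cos (a * t + b) * a).
  by apply: (@isder_comp _ sin).
have h : cder (fun t : R => cexpi (a * t + b)) t 1 (Complex 0 a * cexpi (a * t + b)).
  split; rewrite ?cReM ?cImM /=.
    by apply: (isder_eq hc); ring.
  by apply: (isder_eq hs); ring.
have := cderZ c h; rewrite mulrCA; exact.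
Qed.

Section CompactSupport.
Variables (R : realType) (m : nat).
Implicit Types (f g : 'rV[R]_m -> C R) (x y xi : 'rV[R]_m).

Definition ccont f := continuous (fun x => cRe (f x)) /\ continuous (fun x => cIm (f x)).
(** Compact support expressed through coordinates; [cbox_compact] and [compact_cbox] relate it to
    the closure of the nonvanishing set. *)
Definition cbox f := exists r : R, forall x i, r < `|x 0 i| -> f x = 0.
Definition cc f := ccont f /\ cbox f.

Lemma rcontM (f g : 'rV[R]_m -> R) : continuous f -> continuous g ->
  continuous (fun x => f x * g x).
Proof. by move=> hf hg x; exact: (cvgM (hf x) (hg x)). Qed.

Lemma rcontD (f g : 'rV[R]_m -> R) : continuous f -> continuous g ->
  continuous (fun x => f x + g x).
Proof. by move=> hf hg x; exact: (cvgD (hf x) (hg x)). Qed.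

Lemma rcontB (f g : 'rV[R]_m -> R) : continuous f -> continuous g ->
  continuous (fun x => f x - g x).
Proof. by move=> hf hg x; exact: (cvgB (hf x) (hg x)). Qed.

Lemma rcontZ (a : R) (f : 'rV[R]_m -> R) : continuous f -> continuous (fun x => a * f x).
Proof.
move=> hf x; have h := cvgM (cvg_cst a) (hf x); exact: h.
Qed.

Lemma ccontM f g : ccont f -> ccont g -> ccont (fun x => f x * g x).
Proof.
move=> [f1 f2] [g1 g2]; split.
  by under eq_fun do rewrite cReM; apply: rcontB; exact: rcontM.
by under eq_fun do rewrite cImM; apply: rcontD; exact: rcontM.
Qed.

Lemma ccontD f g : ccont f -> ccont g -> ccont (fun x => f x + g x).
Proof.
move=> [f1 f2] [g1 g2]; split.
  by under eq_fun do rewrite cReD; apply: rcontD.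
by under eq_fun do rewrite cImD; apply: rcontD.
Qed.

Lemma ccont_cst (c : C R) : ccont (fun=> c).
Proof. by split => x; exact: cst_continuous. Qed.

Lemma ccont_prod (I : Type) (s : seq I) (F : I -> 'rV[R]_m -> C R) :
  (forall i, ccont (F i)) -> ccont (fun x => \prod_(i <- s) F i x).
Proof.
move=> h; elim: s => [|i s IH].
  rewrite (_ : (fun x => _) = fun=> 1); first exact: ccont_cst.
  by apply/funext => x; rewrite big_nil.
rewrite (_ : (fun x => _) = fun x => F i x * \prod_(i <- s) F i x); first exact: ccontM.
by apply/funext => x; rewrite big_cons.
Qed.

Lemma ccont_meas f : ccont f -> cmeas (f : borelRn R m -> C R).
Proof. by move=> [f1 f2]; split; exact: continuous_borel_measurable. Qed.

Lemma ccM f g : ccont f -> cc g -> cc (fun x => f x * g x).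
Proof.
move=> hf [hg [r hr]]; split; first exact: ccontM.
by exists r => x i xi; rewrite (hr _ _ xi) mulr0.
Qed.

Lemma ccD f g : cc f -> cc g -> cc (fun x => f x + g x).
Proof.
move=> [hf [r hr]] [hg [s hs]]; split; first exact: ccontD.
exists (Num.max r s) => x i; rewrite gt_max => /andP[h1 h2].
by rewrite (hr _ _ h1) (hs _ _ h2) addr0.
Qed.

Lemma ccZ c f : cc f -> cc (fun x => c * f x).
Proof. by move=> hf; apply: ccM => //; exact: ccont_cst. Qed.

Lemma cabs_continuous f : ccont f -> continuous (fun x => cabs (f x)).
Proof.
move=> [f1 f2] x; rewrite /cabs.
apply: (@continuous_comp _ _ _ (fun x => cRe (f x) ^+ 2 + cIm (f x) ^+ 2) (@Num.sqrt R)).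
  exact: (rcontD (rcontM f1 f1) (rcontM f2 f2)).
exact: sqrt_continuous.
Qed.

Lemma cc_bounded f : cc f -> exists2 B, 0 <= B & forall x, cabs (f x) <= B.
Proof.
move=> [cf [r hr]].
pose A := [set x : 'rV[R]_m | forall i, [set` `[- r, r]] (x 0 i)].
have cA : compact A by apply: (rV_compact (A := fun=> [set` `[- r, r]])) => _; exact: segment_compact.
have /compact_bounded[B [_ hB]] := continuous_compact (continuous_subspaceT (cabs_continuous cf)) cA.
exists (Num.max 0 (B + 1)); first by rewrite le_max lexx.
move=> x; rewrite le_max; apply/orP.
have [xA|xA] := pselect (A x).
  right; have := hB (B + 1); rewrite ltrDl => /(_ ltr01 (cabs (f x))).
  by rewrite /= ger0_norm ?cabs_ge0 //; apply; exists x.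
left; have [i /negP] := (existsNP _).2 xA; rewrite in_itv /= -ler_norml -ltNge => xi.
by rewrite (hr _ _ xi) cabs0.
Qed.

(** A majorant common to all translates by at most 1, as differentiation under the integral needs.
    Outside the cube of half-side s = |r| + 1 these translates vanish; inside, [wgtn] is at least (1
    + s^2)^(-m), whence the constant. *)
Lemma cc_dom f (j : 'I_m) : cc f ->
  exists2 K, 0 <= K & forall x t, `|t| <= 1 -> cabs (f (t *: ev R j + x)) <= K * wgtn x.
Proof.
move=> hf; have [B B0 hB] := cc_bounded hf; case: hf => _ [r hr].
pose s := `|r| + 1.
have s0 : 0 < 1 + s ^+ 2 by rewrite ltr_pwDl // sqr_ge0.
exists (B * (1 + s ^+ 2) ^+ m); first by rewrite mulr_ge0 // exprn_ge0 // ltW.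
move=> x t t1; have [[i hi]|h] := pselect (exists i, s < `|x 0 i|).
  rewrite (hr _ i) ?cabs0.
    by rewrite !mulr_ge0 ?exprn_ge0 // ltW // wgtn_gt0.
  rewrite !mxE /=.
  have a : `|t * (i == j)%:R| <= 1 by case: (i == j); rewrite ?mulr1 // mulr0 normr0.
  have b := ler_normB (t * (i == j)%:R + x 0 i) (t * (i == j)%:R).
  rewrite addrAC subrr add0r in b.
  have c := ler_norm r; rewrite /s in hi; lra.
apply: le_trans (hB _) _; rewrite -mulrA -[leLHS]mulr1 ler_wpM2l //.
have -> : (1 + s ^+ 2) ^+ m = \prod_(i < m) (1 + s ^+ 2) by rewrite prodr_const card_ord.
rewrite /wgtn -big_split /=.
apply: (big_ind (fun z => 1 <= z)) => // [y z|i _]; first exact: mulr_ege1.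
rewrite /wgt ler_pdivlMr ?mul1r ?ltr_pwDl ?sqr_ge0 //.
rewrite lerD2l -(real_normK (num_real (x 0 i))) lerXn2r ?nnegrE ?addr_ge0 //.
by rewrite leNgt; apply/negP => hi; apply: h; exists i.
Qed.

Lemma cc_dom0 f : cc f -> exists2 K, 0 <= K & forall x, cabs (f x) <= K * wgtn x.
Proof.
move=> hf; have [m0|m0] := posnP m.
  have [B B0 hB] := cc_bounded hf; exists B => // x.
  rewrite /wgtn big1 ?mulr1 // => i _; have := ltn_ord i.
  by rewrite [X in (_ < X)%N]m0.
have [K K0 hK] := cc_dom (Ordinal m0) hf; exists K => // x.
by have := hK x 0; rewrite scale0r add0r normr0; apply.
Qed.

Lemma cc_cible f : cc f -> cible (@lebm R m) (f : borelRn R m -> C R).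
Proof.
move=> hf; have [K _ hK] := cc_dom0 hf.
by apply: (cible_dom (ccont_meas hf.1) (ribleZ K (wgtn_rible R m))).
Qed.

Lemma dotp_continuous y : continuous (fun x => dotp x y).
Proof.
rewrite /dotp; elim: (index_enum _) => [|i s IH].
  by under eq_fun do rewrite big_nil; exact: cst_continuous.
under eq_fun do rewrite big_cons; apply: rcontD => //.
by under eq_fun do rewrite mulrC; apply: rcontZ; exact: coord_continuous.
Qed.

(* [xmul v] is multiplication by [-2 pi i (x . v)], which the Fourier
   transform turns into the derivative in direction [v]. *)
Definition xmul (v x : 'rV[R]_m) : C R := Complex 0 (- (2 * pi * dotp x v)).

Lemma ccont_xmul v : ccont (xmul v).
Proof.
split; first exact: cst_continuous.
have h : continuous (fun x => 2 * pi * dotp x v) by apply: rcontZ; exact: dotp_continuous.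
by move=> x; exact: (cvgN (h x)).
Qed.

Definition ft f xi : C R :=
  cI (@lebm R m) (fun x : borelRn R m => f x * cexpi (- (2 * pi * dotp x xi))).

Lemma ft_cible f xi : cible (@lebm R m) (f : borelRn R m -> C R) ->
  cible (@lebm R m) (fun x : borelRn R m => f x * cexpi (- (2 * pi * dotp x xi))).
Proof.
move=> hf; apply: cible_char => //; apply: measurableT_comp => //.
apply: measurable_funM; first exact: measurable_cst.
by apply: dotp_measurable; [exact: measurable_id|exact: measurable_cst].
Qed.

Lemma ft_bounded f : cible (@lebm R m) (f : borelRn R m -> C R) ->
  exists2 B, 0 <= B & forall xi, cabs (ft f xi) <= B.
Proof.
move=> hf; exists (2 * rI (@lebm R m) (fun x : borelRn R m => cabs (f x))).
  by rewrite mulr_ge0 //; apply: Rintegral_ge0 => x _; exact: cabs_ge0.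
move=> xi; apply: cI_le_dom; [exact: cible_meas (ft_cible xi hf)|exact: cible_cabs|].
by move=> x; rewrite cabsM cabs_cexpi mulr1.
Qed.

(** The derivative of the integrand has modulus |xmul v x * f x|, independent of the frequency. Only
    integrability is assumed because the lemma is also applied to [Tsig], whose support need not be
    compact. *)
Lemma ft_cder_cible f xi v : cible (@lebm R m) (f : borelRn R m -> C R) ->
  cible (@lebm R m) (fun x : borelRn R m => xmul v x * f x) ->
  cder (ft f) xi v (ft (fun x => xmul v x * f x) xi).
Proof.
move=> hf hvf.
have E t x : f x * cexpi (- (2 * pi * dotp x (t *: v + xi))) =
    f x * cexpi (- (2 * pi * dotp x v) * t + - (2 * pi * dotp x xi)).
  by rewrite dotpDr dotpZr; congr (_ * cexpi _); ring.
have := @cI_cder _ _ R (@lebm R m) (fun t x => f x * cexpi (- (2 * pi * dotp x (t *: v + xi))))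
  (fun t x => xmul v x * (f x * cexpi (- (2 * pi * dotp x (t *: v + xi)))))
  (fun x => cabs (xmul v x * f x)).
move=> h; have {h} : cder (fun t : R => ft f (t *: v + xi)) 0 1
    (ft (fun x => xmul v x * f x) (0 *: v + xi)).
  rewrite /ft (_ : (fun x => xmul v x * f x * _) =
    (fun x => xmul v x * (f x * cexpi (- (2 * pi * dotp x (0 *: v + xi)))))); last first.
    by apply/funext => x; rewrite mulrA.
  apply: h.
  - by move=> t _; exact: ft_cible hf.
  - move=> t x _; rewrite /xmul E; under eq_fun do rewrite E; exact: cder_cexpi.
  - exact: cible_cabs hvf.
  - by move=> t x _; rewrite !cabsM cabs_cexpi mulr1.
by move=> /cder_line; rewrite scale0r add0r.
Qed.

Lemma ft_cder f xi v : cc f -> cder (ft f) xi v (ft (fun x => xmul v x * f x) xi).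
Proof.
move=> hf; apply: ft_cder_cible; apply: cc_cible => //.
by apply: ccM => //; exact: ccont_xmul.
Qed.

Lemma dotp_ev x (j : 'I_m) : dotp x (ev R j) = x 0 j.
Proof.
rewrite /dotp (bigD1 j) //= !mxE !eqxx mulr1 big1 ?addr0 // => i ij.
by rewrite !mxE (negbTE ij) andbF mulr0.
Qed.

(** Instead of integrating by parts, the transform of the translate of [f] by [t *: ev R j] is
    computed twice: as an integral that can be differentiated in [t], and as [ft f xi] times a
    character of [t]. The derivatives at 0 agree. *)
Lemma ft_diff (f df : 'rV[R]_m -> C R) (j : 'I_m) xi : cc f -> cc df ->
  (forall x, cder f x (ev R j) (df x)) ->
  ft df xi = Complex 0 (2 * pi * xi 0 j) * ft f xi.
Proof.
move=> hf hdf hd; have [K _ hK] := cc_dom j hdf.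
pose e x : C R := cexpi (- (2 * pi * dotp x xi)).
have T t : cible (@lebm R m) (fun x : borelRn R m => f (t *: ev R j + x) * e x) /\ cI (@lebm R m) (fun x : borelRn R m => f (t *: ev R j + x) * e x) =
   ft f xi * cexpi (2 * pi * xi 0 j * t + 0).
  pose F y := f y * e y * cexpi (2 * pi * xi 0 j * t + 0).
  have hF : cible (@lebm R m) (F : borelRn R m -> C R).
    rewrite /F; under eq_fun do rewrite mulrC; apply: cibleZ.
    exact: ft_cible (cc_cible hf).
  have [h1 h2] := cI_affine (t *: ev R j) ltr01 hF.
  have EF : (fun x : borelRn R m => F (1 *: (x : 'rV[R]_m) + t *: ev R j)) =
     (fun x => f (t *: ev R j + x) * e x).
    apply/funext => x; rewrite /F scale1r [x + _]addrC -mulrA; congr (_ * _).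
    rewrite /e -cexpiD; congr cexpi.
    rewrite dotpDl dotpZl (dotpC _ xi) dotp_ev; ring.
  rewrite EF in h1 h2; split => //.
  move: h2; rewrite expr1n mul1r => <-; rewrite cIZr //.
  exact: ft_cible (cc_cible hf).
have h : cder (fun t : R => ft f xi * cexpi (2 * pi * xi 0 j * t + 0)) 0 1 (ft df xi).
  have -> : ft df xi = cI (@lebm R m) (fun x => df (0 *: ev R j + x) * e x).
    by congr cI; apply/funext => x; rewrite scale0r add0r.
  rewrite (_ : (fun t => _) = (fun t => cI (@lebm R m) (fun x : borelRn R m => f (t *: ev R j + x) * e x))).
    apply: (@cI_cder _ _ R (@lebm R m) (fun t x => f (t *: ev R j + x) * e x)
      (fun t x => df (t *: ev R j + x) * e x) (fun x => K * wgtn x)).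
    - by move=> t _; exact: (T t).1.
    - move=> t x _.
      have := cderM ((cder_line f x (ev R j) t (df (t *: ev R j + x))).2 (hd _)) (cder_cst t (1 : R) (e x)).
      by rewrite mulr0 addr0; apply.
    - exact: ribleZ (wgtn_rible R m).
    - move=> t x ht; rewrite cabsM cabs_cexpi mulr1; apply: hK.
      by rewrite ler_norml; case/andP: ht => /ltW -> /ltW ->.
  by apply/funext => t; rewrite (T t).2.
rewrite (cder_unique h (cder_cexpi _ _ _ _)) mulr0 addr0 cexpi0 mulr1; ring.
Qed.

End CompactSupport.

(** * Smooth functions and the decay of their transforms *)

Section Smooth.
Variables (R : realType) (m : nat).
Implicit Types (f g : 'rV[R]_m -> R) (x : 'rV[R]_m).

Notation sm := (smooth_on [set: 'rV[R]_m]).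
Notation pd j f := (fun x => derive f x (ev R j)).

Lemma sm_continuous f : sm f -> continuous f.
Proof. by move=> h x; exact: (h [::] x I).2. Qed.

Lemma sm_derivable f x j : sm f -> derivable f x (ev R j).
Proof. by move=> h; exact: ((h [::] x I).1 j). Qed.

Lemma sm_is_derive f x j : sm f -> is_derive x (ev R j) f (derive f x (ev R j)).
Proof. by move=> h; apply: DeriveDef => //; exact: sm_derivable. Qed.

Lemma sm_pd f j : sm f -> sm (pd j f).
Proof.
move=> h ds x _; have := h (rcons ds j) x I.
by rewrite -cats1 /pdseq foldr_cat.
Qed.

(** Coinduction: a class of continuous functions with partial derivatives in the same class consists
    of smooth functions. *)
Lemma sm_coind (P : ('rV[R]_m -> R) -> Prop) :
  (forall f, P f -> continuous f /\
     forall j, (forall x, derivable f x (ev R j)) /\ P (pd j f)) ->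
  forall f, P f -> sm f.
Proof.
move=> h f Pf ds x _.
have Pd : P (pdseq ds f) by elim: ds => [//|j ds /h[_ /(_ j)[]]].
by have [c d] := h _ Pd; split => [j|]; [exact: (d j).1|exact: c].
Qed.

(** Products of smooth functions alone are not stable under differentiation, since a derivative is a
    sum of two products. The algebra generated by the smooth functions is stable, so [sm_coind]
    applies to it. *)
Inductive smalg : ('rV[R]_m -> R) -> Prop :=
| smalg_base f : sm f -> smalg f
| smalg_add f g : smalg f -> smalg g -> smalg (fun x => f x + g x)
| smalg_mul f g : smalg f -> smalg g -> smalg (fun x => f x * g x).

Lemma smalg_sm f : smalg f -> sm f.
Proof.
apply: sm_coind => {}f hf; split.
  elim: hf => [{}f /sm_continuous //|{}f g _ h1 _ h2|{}f g _ h1 _ h2].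
    exact: rcontD.
  exact: rcontM.
move=> j; suff : (forall x, is_derive x (ev R j) f (derive f x (ev R j))) /\ smalg (pd j f).
  by case=> h1 h2; split => // x; apply: (@ex_derive _ _ _ _ _ _ _ (h1 x)).
elim: hf => [{}f h|{}f g h1 [d1 s1] h2 [d2 s2]|{}f g h1 [d1 s1] h2 [d2 s2]].
- by split => [x|]; [exact: sm_is_derive|apply: smalg_base; exact: sm_pd].
- have d x := isderD (d1 x) (d2 x).
  have E : pd j (fun x => f x + g x) = (fun x => derive f x (ev R j) + derive g x (ev R j)).
    by apply/funext => x; apply: derive_val.
  by split => [x|]; rewrite ?E; [apply: (isder_eq (d x)); rewrite -[LHS]/((fun x => _ + _) x) -E|exact: smalg_add].
- have d x := isderM (d1 x) (d2 x).
  have E : pd j (fun x => f x * g x) =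
      (fun x => derive f x (ev R j) * g x + f x * derive g x (ev R j)).
    by apply/funext => x; apply: derive_val.
  split => [x|].
    by apply: (isder_eq (d x)); rewrite -[LHS]/((fun x => _ + _) x) -E.
  by rewrite E; apply: smalg_add; apply: smalg_mul => //.
Qed.

Lemma smD f g : sm f -> sm g -> sm (fun x => f x + g x).
Proof. by move=> h1 h2; apply: smalg_sm; apply: smalg_add; exact: smalg_base. Qed.

Lemma smM f g : sm f -> sm g -> sm (fun x => f x * g x).
Proof. by move=> h1 h2; apply: smalg_sm; apply: smalg_mul; exact: smalg_base. Qed.

Lemma sm_cst (c : R) : sm (fun=> c).
Proof.
apply: (@sm_coind (fun f => exists c, f = fun=> c)); last by exists c.
move=> _ [{}c ->]; split=> [x|j]; first exact: cst_continuous.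
split=> [x|]; first exact: derivable_cst.
by exists 0; apply/funext => x; exact: derive_cst.
Qed.

Lemma smN f : sm f -> sm (fun x => - f x).
Proof.
move=> h; rewrite (_ : (fun x => _) = fun x => (-1) * f x).
  by apply: smM => //; exact: sm_cst.
by apply/funext => x; rewrite mulN1r.
Qed.

Lemma sm_prod (I : Type) (s : seq I) (F : I -> 'rV[R]_m -> R) :
  (forall i, sm (F i)) -> sm (fun x => \prod_(i <- s) F i x).
Proof.
move=> h; elim: s => [|i s IH].
  rewrite (_ : (fun x => _) = fun=> 1); first exact: sm_cst.
  by apply/funext => x; rewrite big_nil.
rewrite (_ : (fun x => _) = fun x => F i x * \prod_(i <- s) F i x); first exact: smM.
by apply/funext => x; rewrite big_cons.
Qed.

Implicit Types F G : 'rV[R]_m -> C R.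
Definition csm F := csmooth_on [set: 'rV[R]_m] F.

Definition cpd (j : 'I_m) F x : C R :=
  Complex (derive (fun y => cRe (F y)) x (ev R j)) (derive (fun y => cIm (F y)) x (ev R j)).

Lemma csm_ccont F : csm F -> ccont F.
Proof. by move=> [h1 h2]; split; exact: sm_continuous. Qed.

Lemma csm_cder F x j : csm F -> cder F x (ev R j) (cpd j F x).
Proof. by move=> [h1 h2]; split; exact: sm_is_derive. Qed.

Lemma csm_cpd F j : csm F -> csm (cpd j F).
Proof. by move=> [h1 h2]; split; exact: sm_pd. Qed.

Lemma csmD F G : csm F -> csm G -> csm (fun x => F x + G x).
Proof.
move=> [f1 f2] [g1 g2]; split.
  by under eq_fun do rewrite cReD; exact: smD.
by under eq_fun do rewrite cImD; exact: smD.
Qed.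

Lemma csmM F G : csm F -> csm G -> csm (fun x => F x * G x).
Proof.
move=> [f1 f2] [g1 g2]; split.
  by under eq_fun do rewrite cReM; apply: smD; [|apply: smN]; exact: smM.
by under eq_fun do rewrite cImM; apply: smD; exact: smM.
Qed.

Lemma csm_cst c : csm (fun=> c).
Proof. by split; exact: sm_cst. Qed.

Lemma csmR f : sm f -> csm (fun x => Complex (f x) 0).
Proof. by split => //; exact: sm_cst. Qed.

Lemma cpd_cbox F j : csm F -> cbox F -> cbox (cpd j F).
Proof.
move=> hF [r hr]; exists r => x i xi.
apply: (cder_unique (csm_cder x j hF)).
have d0 : 0 < `|x 0 i| - r by rewrite subr_gt0.
have near0 : \forall h \near (0 : R)^', F (h *: ev R j + x) = 0.
  have := @dnbhs0_lt _ R^o _ d0.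
  apply: filterS => h hh; apply: (hr _ i); rewrite !mxE /=.
  have b : `|h * (i == j)%:R| <= `|h| by case: (i == j); rewrite ?mulr1 // mulr0 normr0.
  have a := ler_normB (h * (i == j)%:R + x 0 i) (h * (i == j)%:R).
  rewrite addrAC subrr add0r in a.
  move: hh; rewrite /= => hh; lra.
have F0 := hr _ _ xi.
split; apply/isderP => /=.
  apply: cvg_near_cst; apply: filterS near0 => h ->.
  by rewrite F0 subrr mulr0.
apply: cvg_near_cst; apply: filterS near0 => h ->.
by rewrite F0 subrr mulr0.
Qed.

Definition SC F := csm F /\ cbox F.

Lemma SC_cc F : SC F -> cc F.
Proof. by move=> [h1 h2]; split => //; exact: csm_ccont. Qed.

Lemma SC_cpd F j : SC F -> SC (cpd j F).
Proof. by move=> [h1 h2]; split; [exact: csm_cpd|exact: cpd_cbox]. Qed.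

Lemma SC_D F G : SC F -> SC G -> SC (fun x => F x + G x).
Proof.
move=> hF hG; split; first exact: (csmD hF.1 hG.1).
exact: (ccD (SC_cc hF) (SC_cc hG)).2.
Qed.

Lemma SC_M F G : csm F -> SC G -> SC (fun x => F x * G x).
Proof.
move=> hF hG; split; first exact: (csmM hF hG.1).
exact: (ccM (csm_ccont hF) (SC_cc hG)).2.
Qed.

Lemma ft_cpd F j xi : SC F -> ft (cpd j F) xi = Complex 0 (2 * pi * xi 0 j) * ft F xi.
Proof.
move=> hF; apply: ft_diff; [exact: SC_cc|exact: (SC_cc (SC_cpd j hF))|].
by move=> x; exact: (csm_cder x j hF.1).
Qed.

Lemma ftD F G xi : cc F -> cc G -> ft (fun x => F x + G x) xi = ft F xi + ft G xi.
Proof.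
move=> hF hG; rewrite /ft -cID; [|exact: (ft_cible xi (cc_cible hF))|exact: (ft_cible xi (cc_cible hG))].
by congr cI; apply/funext => x; rewrite mulrDl.
Qed.

Lemma ftZ c F xi : cc F -> ft (fun x => c * F x) xi = c * ft F xi.
Proof.
move=> hF; rewrite /ft -cIZ; last exact: (ft_cible xi (cc_cible hF)).
by congr cI; apply/funext => x; rewrite mulrA.
Qed.

(* [1 - (d_j / 2 pi)^2], whose Fourier multiplier is [1 + xi_j^2] *)
Definition bessel (j : 'I_m) F x : C R :=
  F x + Complex (- ((2 * pi) ^+ 2)^-1) 0 * cpd j (cpd j F) x.

Lemma SC_bessel j F : SC F -> SC (bessel j F).
Proof.
move=> h; apply: SC_D => //; apply: SC_M; first exact: csm_cst.
exact: SC_cpd (SC_cpd _ h).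
Qed.

Lemma ft_bessel j F xi : SC F -> ft (bessel j F) xi = Complex (1 + xi 0 j ^+ 2) 0 * ft F xi.
Proof.
move=> h; have h2 := SC_cpd j (SC_cpd j h).
rewrite ftD; [|exact: SC_cc|exact: (ccZ _ (SC_cc h2))].
rewrite ftZ ?ft_cpd //; [|exact: (SC_cpd j h)|exact: SC_cc].
have pi0 : 2 * pi != 0 :> R by rewrite gt_eqF // mulr_gt0 // pi_gt0.
rewrite -{1}[ft F xi]mul1r !mulrA -mulrDl; congr (_ * _).
move: pi0; move: (2 * pi) => p p0.
apply: complex_ext; rewrite /= ?cReM ?cImM /=; by field.
Qed.

(** Applying [bessel] once in every coordinate multiplies the transform by prod_i (1 + xi_i^2), the
    inverse of [wgtn], and the result is still bounded. *)
Lemma ft_decay F : SC F -> exists2 K, 0 <= K & forall xi, cabs (ft F xi) <= K * wgtn xi.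
Proof.
move=> h; pose Q := foldr bessel F (enum 'I_m).
have [hQ eQ] : SC Q /\ forall xi, ft Q xi = Complex (\prod_(i <- enum 'I_m) (1 + xi 0 i ^+ 2)) 0 * ft F xi.
  rewrite /Q; elim: (enum 'I_m) => [|j s [IH1 IH2]] /=.
    by split => // xi; rewrite big_nil mul1r.
  split; first exact: SC_bessel.
  by move=> xi; rewrite ft_bessel // IH2 big_cons complexRM mulrA.
have [B B0 hB] := ft_bounded (cc_cible (SC_cc hQ)).
exists B => // xi; have := hB xi; rewrite eQ cabsM cabsR big_enum /=.
have p0 : 0 < \prod_(i < m) (1 + xi 0 i ^+ 2).
  by apply: prodr_gt0 => i _; rewrite ltr_pwDl // sqr_ge0.
rewrite gtr0_norm // => hb.
have -> : wgtn xi = (\prod_(i < m) (1 + xi 0 i ^+ 2))^-1 by rewrite -prodfV.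
by rewrite ler_pdivlMr // mulrC.
Qed.

End Smooth.

(** * Bump functions and vanishing moments *)

Section FlatFunctions.
Variable R : realType.
Implicit Types (p q : {poly R}) (s t : R).

(** The polynomial makes the family stable under differentiation: with s = 1/t the derivative of
    p(s) exp(-s) is s^2 (p - p')(s) exp(-s). *)
Definition flat p t : R := if 0 < t then p.[t^-1] * expR (- t^-1) else 0.

Lemma expr_le_expR (k : nat) s : 0 <= s -> s ^+ k <= k%:R ^+ k * expR s.
Proof.
case: k => [|k] s0; first by rewrite !expr0 mul1r -expR0 ler_expR.
have k0 : 0 < k.+1%:R :> R by rewrite ltr0n.
have h : s / k.+1%:R <= expR (s / k.+1%:R).
  by apply: le_trans (expR_ge1Dx _); rewrite lerDr.
have h2 : (s / k.+1%:R) ^+ k.+1 <= expR s.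
  rewrite -[X in expR X](divfK (lt0r_neq0 k0)) expRM_natr.
  by rewrite lerXn2r // nnegrE ?expR_ge0 // divr_ge0 // ltW.
move: h2; rewrite expr_div_n ler_pdivrMr ?exprn_gt0 //.
by rewrite mulrC.
Qed.

Lemma poly_le_expR p : exists2 c, 0 <= c & forall s, 0 <= s -> `|p.[s]| <= c * expR s.
Proof.
exists (\sum_(i < size p) `|p`_i| * i%:R ^+ i).
  by apply: sumr_ge0 => i _; rewrite mulr_ge0 // exprn_ge0.
move=> s s0; rewrite horner_coef mulr_suml; apply: le_trans (ler_norm_sum _ _ _) _.
apply: ler_sum => i _; rewrite normrM -mulrA ler_wpM2l //.
by rewrite ger0_norm ?exprn_ge0 // expr_le_expR.
Qed.

Lemma flat_is_derive p t : is_derive t 1 (flat p) (flat ('X^2 * (p - p^`()))%R t).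
Proof.
have [t0|t0|t0] := ltgtP t 0.
- rewrite /flat ltNge (ltW t0) /=.
  apply: (near_eq_is_derive (f := fun=> 0)).
  by near=> x; rewrite ltNge; have -> : x <= 0 by apply: ltW; near: x; exact: lt_nbhsl.
- have d1 : is_derive t 1 (fun x : R => x^-1) (- t ^- 2).
    have := @is_deriveV R id t 1 1 (lt0r_neq0 t0) (is_derive_id _ _).
    by rewrite [_ *: (1 : R)]mulr1.
  have d2 : is_derive t 1 (fun x : R => p.[x^-1]) (p^`().[t^-1] * - t ^- 2).
    exact: (@isder_comp R (horner p)).
  have d3 : is_derive t 1 (fun x : R => expR (- x^-1)) (expR (- t^-1) * - - t ^- 2).
    by apply: (@isder_comp R expR); exact: isderN.
  have d4 : is_derive t 1 (fun x : R => p.[x^-1] * expR (- x^-1))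
      (flat ('X^2 * (p - p^`()))%R t).
    apply: (isder_eq (isderM d2 d3)); rewrite /flat t0 !hornerE /=.
    move: (p.[_]) (p^`().[_]) (expR _) => a b c; field.
    by rewrite gt_eqF.
  apply: near_eq_is_derive d4.
  by near=> x; have x0 : 0 < x by [near: x; exact: lt_nbhsr]; rewrite /flat x0.
- rewrite t0 {2}/flat ltxx; apply/isderP.
  (* For h > 0 and s = 1/h the difference quotient at 0 is h * s^2 p(s) exp(-s), which is at most c
     h in modulus. *)
  have [c c0 hc] := poly_le_expR ('X^2 * p).
  have b h : h != 0 -> `|h^-1 * (flat p (h *: 1 + 0) - flat p 0)| <= c * `|h|.
    move=> h0; rewrite /flat ltxx subr0 addr0 [_ *: (1 : R)]mulr1.
    case: ltP => hp; last by rewrite mulr0 normr0 mulr_ge0.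
    have := hc h^-1; rewrite invr_ge0 ltW // hornerM hornerXn => /(_ isT).
    rewrite !normrM (ger0_norm (expR_ge0 _)) expRN.
    have hi : 0 < h^-1 by rewrite invr_gt0.
    have e0 := expR_gt0 h^-1; rewrite !(gtr0_norm hi) !(gtr0_norm hp).
    move: (expR _) e0 => e e0; move: (`|p.[_]|) => a.
    rewrite ?expr2 => hh; rewrite mulrA ler_pdivrMr //.
    have -> : h^-1 * a = h * (h^-1 * h^-1 * a) by field.
    by rewrite [leRHS]mulrAC [leRHS]mulrC ler_wpM2l // ltW.
  have cl : c * `|h| @[h --> (0 : R)^'] --> (0 : R).
    have l1 : h @[h --> (0 : R)^'] --> (0 : R) by exact: cvg_within.
    have := cvgM (cvg_cst c) (cvg_norm l1); rewrite normr0 mulr0.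
    by apply.
  apply: (@squeeze_cvgr _ _ _ _ (fun h => - (c * `|h|)) (fun h => c * `|h|)).
  + near=> h; rewrite -ler_norml; apply: b.
    by near: h; exact: nbhs_dnbhs_neq.
  + by rewrite -[X in _ --> X]oppr0; apply: cvgN.
  + exact: cl.
Unshelve. all: by end_near. Qed.

End FlatFunctions.

Section Bump.
Variables (R : realType) (m : nat).
Implicit Types (x y xi : 'rV[R]_m) (F : 'rV[R]_m -> C R) (i j : 'I_m).

Lemma isder_coord (f : R -> R) (df : R) x i j : is_derive (x 0 i) 1 f df ->
  is_derive x (ev R j) (fun z : 'rV[R]_m => f (z 0 i)) (df * (i == j)%:R).
Proof.
move=> h; have -> : x = 0 *: ev R j + x by rewrite scale0r add0r.
apply/isder_line.
have -> : (fun t : R => f ((t *: ev R j + x) 0 i)) = (fun t => f ((i == j)%:R * t + x 0 i)).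
  by apply/funext => t; rewrite !mxE /= mulrC.
apply: (@isder_comp R f); first by rewrite mulr0 add0r.
by apply: (isder_eq (isderD (isder_lin _ _) (isder_cst _ _ _))); rewrite addr0.
Qed.

Lemma sm_flat p (c s : R) i : smooth_on [set: 'rV[R]_m] (fun x => flat p (c + s * x 0 i)).
Proof.
have D k q x j : is_derive x (ev R j) (fun z : 'rV[R]_m => k * flat q (c + s * z 0 i))
   ((i == j)%:R * s * k * flat ('X^2 * (q - q^`()))%R (c + s * x 0 i)).
  have h1 : is_derive (x 0 i) 1 (fun u : R => c + s * u) s.
    by apply: (isder_eq (isderD (isder_cst _ _ c) (isder_lin s _))); rewrite add0r.
  have h2 := @isder_comp R (flat q) (fun u => c + s * u) (x 0 i) _ _ (flat_is_derive q (c + s * x 0 i)) h1.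
  apply: (isder_eq (isderZ k (isder_coord j h2))); ring.
apply: (@sm_coind R m (fun f => exists k q, f = fun x => k * flat q (c + s * x 0 i))); last first.
  by exists 1, p; apply/funext => x; rewrite mul1r.
move=> _ [k [q ->]]; split.
  apply: rcontZ => x.
  have cf : {for c + s * x 0 i, continuous (flat q)}.
    apply: differentiable_continuous; apply/derivable1_diffP.
    by apply: (@ex_derive _ _ _ _ _ _ _ (flat_is_derive q _)).
  apply: (@continuous_comp _ _ _ (fun x : 'rV[R]_m => c + s * x 0 i) (flat q)); last exact: cf.
  have cc : continuous (fun x : 'rV[R]_m => c + s * x 0 i).
    apply: rcontD; first exact: cst_continuous.
    by apply: rcontZ; exact: coord_continuous.
  exact: cc.
move=> j; split => [x|]; first by apply: (@ex_derive _ _ _ _ _ _ _ (D k q x j)).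
exists ((i == j)%:R * s * k), ('X^2 * (q - q^`()))%R.
by apply/funext => x; apply: derive_val.
Qed.

(** Positive exactly on the open cube of half-side [r] around [y]; the arguments have the shape
    [c + s * x 0 i] of [sm_flat]. *)
Definition bump (r : R) y x : R :=
  \prod_i (flat 1 (r - y 0 i + 1 * x 0 i) * flat 1 (r + y 0 i + (-1) * x 0 i)).

Lemma flat1_gt0 (t : R) : 0 < t -> 0 < flat 1 t.
Proof. by move=> t0; rewrite /flat t0 hornerC mul1r expR_gt0. Qed.

Lemma flat1_ge0 (t : R) : 0 <= flat 1 t.
Proof. by have [/flat1_gt0/ltW //|h] := ltP 0 t; rewrite /flat ltNge h. Qed.

Lemma flat_le0 p (t : R) : t <= 0 -> flat p t = 0.
Proof. by move=> h; rewrite /flat ltNge h. Qed.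

Lemma bump_ge0 r y x : 0 <= bump r y x.
Proof. by apply: prodr_ge0 => i _; rewrite mulr_ge0 // flat1_ge0. Qed.

Lemma bump_gt0 r y x : (forall i, `|x 0 i - y 0 i| < r) -> 0 < bump r y x.
Proof.
move=> h; apply: prodr_gt0 => i _; move: (h i); rewrite ltr_norml => /andP[h1 h2].
by rewrite mulr_gt0 // flat1_gt0 //; lra.
Qed.

Lemma bump_eq0 r y x i : r <= `|x 0 i - y 0 i| -> bump r y x = 0.
Proof.
move=> h; rewrite /bump (bigD1 i) //=; have [h1|h1] := leP 0 (x 0 i - y 0 i).
  rewrite ger0_norm // in h; rewrite (@flat_le0 _ (r + y 0 i + _)) ?mulr0 ?mul0r //; lra.
rewrite ltr0_norm // in h; rewrite flat_le0 ?mul0r //; lra.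
Qed.

Definition cbump r y x : C R := Complex (bump r y x) 0.

Lemma SC_cbump r y : SC (cbump r y).
Proof.
split.
  by apply: csmR; apply: sm_prod => i; apply: smM; exact: sm_flat.
exists (r + \sum_i `|y 0 i|) => x i hi; rewrite /cbump (@bump_eq0 _ _ _ i) //.
have h1 : `|y 0 i| <= \sum_i `|y 0 i| by rewrite (bigD1 i) //= lerDl sumr_ge0.
have := lerB_dist (x 0 i) (y 0 i); lra.
Qed.

Lemma cbump_translate r y xi : ft (cbump r y) xi = ft (cbump r 0) xi * cexpi (- (2 * pi * dotp y xi)).
Proof.
have [h1 h2] := cI_affine y ltr01 (ft_cible xi (cc_cible (SC_cc (SC_cbump r y)))).
rewrite {1}/ft h2 expr1n mul1r /ft -cIZr; last exact: ft_cible (cc_cible (SC_cc (SC_cbump r 0))).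
congr cI; apply/funext => x; rewrite -[RHS]mulrA -cexpiD scale1r.
congr (_ * cexpi _).
  rewrite /cbump; congr Complex; apply: eq_bigr => i _; rewrite !mxE.
  by congr (flat _ _ * flat _ _); ring.
by rewrite dotpDl; ring.
Qed.

(** For small support the phase stays below pi/2, so the real part of the integrand is nonnegative,
    and positive on a cube. A zero integral would make it vanish almost everywhere, although the
    cube has positive volume. *)
Lemma ft_cbump_neq0 xi : (0 < m)%N -> exists r, ft (cbump r 0) xi != 0.
Proof.
move=> m0; pose S := \sum_i `|xi 0 i| + 1.
have S0 : 0 < S by rewrite ltr_wpDl // sumr_ge0.
(* On the cube of half-side [r] this gives |2 pi x . xi| <= 2 pi r S = 1/2. *)
pose r := (2 * pi * (2 * S))^-1.
have pi0 : 0 < 2 * pi :> R by rewrite mulr_gt0 // pi_gt0.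
have r0 : 0 < r by rewrite invr_gt0 !mulr_gt0 // pi_gt0.
exists r; apply/negP => /eqP h.
pose f (x : 'rV[R]_m) := bump r 0 x * cos (2 * pi * dotp x xi).
have hc := ft_cible xi (cc_cible (SC_cc (SC_cbump r 0))).
have fE : (fun x : borelRn R m => cRe (cbump r 0 x * cexpi (- (2 * pi * dotp x xi)))) = f.
  by apply/funext => x; rewrite cReM /= mul0r subr0 cosN.
have fi : rible (@lebm R m) f by rewrite -fE; exact: hc.1.
have If : rI (@lebm R m) f = 0.
  by rewrite -fE; have := congr1 (fun z : C R => cRe z) h.
have cpos x : (forall i, `|x 0 i| < r) -> 0 < cos (2 * pi * dotp x xi).
  move=> hx; have b : `|2 * pi * dotp x xi| <= 2^-1.
    rewrite normrM (gtr0_norm pi0).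
    have : `|dotp x xi| <= r * S.
      apply: le_trans (ler_norm_sum _ _ _) _.
      rewrite /S mulrDr mulr1 mulr_sumr; apply: ler_wpDr; first exact: ltW.
      by apply: ler_sum => i _; rewrite normrM ler_wpM2r // ltW.
    have -> : r * S = (2 * pi)^-1 * 2^-1.
      rewrite /r; move: (2 * pi) pi0 => p p0; field; rewrite !gt_eqF //.
    by rewrite -ler_pdivlMl.
  have p2 : 1 <= pi / 2 :> R by exact: pihalf_ge1.
  apply: cos_gt0_pihalf; move: b; rewrite ler_norml => /andP[b1 b2].
  by apply/andP; split; lra.
have f0 x : 0 <= f x.
  have [hx|] := pselect (forall i, `|x 0 i| < r).
    by rewrite mulr_ge0 ?bump_ge0 // ltW // cpos.
  move=> /existsNP[i /negP]; rewrite -leNgt => hi.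
  by rewrite /f (@bump_eq0 _ _ _ i) ?mul0r // !mxE subr0.
have fpos x : (forall i, `|x 0 i| < r) -> 0 < f x.
  by move=> hx; rewrite mulr_gt0 ?cpos // bump_gt0 // => i; rewrite !mxE subr0.
have ae : ae_eq (@lebm R m) setT (EFin \o f) (cst 0%E).
  apply/ae_eq_integral_abs => //; first exact: measurable_int fi.
  have -> : (fun x : borelRn R m => `|(EFin \o f) x|)%E = (fun x => (f x)%:E).
    by apply/funext => x /=; rewrite ger0_norm.
  by rewrite -rI_EFin // If.
case: ae => N [mN N0 hN].
pose B : set (borelRn R m) := box (const_mx (- (r / 2))) (const_mx (r / 2)).
have BN : B `<=` N.
  move=> x hx; apply: hN => /= /(_ I) [] fx.
  have : 0 < f x.
    apply: fpos => i; have := hx i; rewrite !mxE => /andP[a b].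
    by rewrite ltr_norml; apply/andP; split; lra.
  by rewrite fx ltxx.
have : (lebm B <= lebm N)%E by apply: le_measure; rewrite ?inE //; exact: box_measurable.
rewrite [X in (_ <= X)%E]N0 lebm_box lee_fin leNgt => /negP; apply.
apply: prodr_gt0 => i _; rewrite !mxE lt_max; apply/orP; right; lra.
Qed.

End Bump.

(** * Vanishing moments of iterated derivatives *)

Section Moments.
Variables (R : realType) (m : nat).
Implicit Types (x y xi eta : 'rV[R]_m) (F f : 'rV[R]_m -> C R) (i j : 'I_m) (be : 'I_m -> nat).

Lemma rV_coord_le x i : `|x 0 i| <= `|x|.
Proof. by rewrite [leRHS]/Num.Def.normr /= mx_normrE; apply/bigmax_geP; right => /=; exists (0, i). Qed.

Lemma sm_coord i : smooth_on [set: 'rV[R]_m] (fun x => x 0 i).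
Proof.
have D a b x j : is_derive x (ev R j) (fun z : 'rV[R]_m => a * z 0 i + b) (a * (i == j)%:R).
  have h1 : is_derive (x 0 i) 1 (fun u : R => a * u + b) a.
    by apply: (isder_eq (isderD (isder_lin a _) (isder_cst _ _ b))); rewrite addr0.
  exact: (isder_coord j h1).
apply: (@sm_coind R m (fun f : 'rV[R]_m -> R => exists a b : R, f = fun x : 'rV[R]_m => a * x 0 i + b)); last first.
  by exists 1, 0; apply/funext => x; rewrite mul1r addr0.
move=> _ [a [b ->]]; split.
  apply: rcontD; last exact: cst_continuous.
  by apply: rcontZ; exact: coord_continuous.
move=> j; split => [x|]; first by apply: (@ex_derive _ _ _ _ _ _ _ (D a b x j)).
exists 0, (a * (i == j)%:R); apply/funext => x; rewrite mul0r add0r.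
by apply: derive_val.
Qed.

Lemma sm_expn (f : 'rV[R]_m -> R) k : smooth_on [set: 'rV[R]_m] f -> smooth_on [set: 'rV[R]_m] (fun x => f x ^+ k).
Proof.
move=> h; elim: k => [|k IH].
  by under [X in smooth_on _ X]eq_fun do rewrite expr0; exact: sm_cst.
rewrite (_ : (fun x => _) = fun x => f x * f x ^+ k); first exact: smM.
by apply/funext => x; rewrite exprS.
Qed.

Definition cmono be x : C R := Complex (mono be x) 0.

Lemma csm_cmono be : csm (cmono be).
Proof. by apply: csmR; apply: sm_prod => i; apply: sm_expn; exact: sm_coord. Qed.

(** When [be i = 0] the truncated predecessor leaves [be] unchanged; the coefficient [be i] in front
    of the monomial is then 0. *)
Definition decr be i : 'I_m -> nat := fun k => if k == i then (be i).-1 else be k.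

Lemma cder_cmono be i x :
  cder (cmono be) x (ev R i) (Complex ((be i)%:R * mono (decr be i) x) 0).
Proof.
split; last exact: isder_cst.
rewrite /= [x in is_derive x](_ : x = 0 *: ev R i + x); last by rewrite scale0r add0r.
apply/isder_line.
pose M := \prod_(k < m | k != i) x 0 k ^+ be k.
have -> : (fun t : R => mono be (t *: ev R i + x)) = (fun t => (t + x 0 i) ^+ be i * M).
  apply/funext => t; rewrite /mono (bigD1 i) //= !mxE !eqxx mulr1; congr (_ * _).
  by apply: eq_bigr => k ki; rewrite !mxE (negbTE ki) andbF mulr0 add0r.
have h1 : is_derive (0 : R) 1 (fun t : R => t + x 0 i) 1.
  by apply: (isder_eq (isderD (is_derive_id _ _) (isder_cst _ _ _))); rewrite addr0.
have h2 := is_deriveX (be i) h1; rewrite exprfctE in h2.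
apply: (isder_eq (isderM h2 (isder_cst _ _ M))).
rewrite mulr0 addr0 [_ *: 1]mulr1 /= add0r -mulrA; congr (_ * _).
rewrite /mono [in RHS](bigD1 i) //= /decr eqxx; congr (_ * _).
by apply: eq_bigr => k ki; rewrite (negbTE ki).
Qed.

Lemma ft0E F : ft F 0 = cI (@lebm R m) (F : borelRn R m -> C R).
Proof.
congr cI; apply/funext => x.
by rewrite /dotp big1 ?mulr0 ?oppr0 ?cexpi0 ?mulr1 // => i _; rewrite mxE mulr0.
Qed.

(** Integration by parts: at frequency 0 the multiplier 2 pi i xi_i vanishes, so the derivative of
    [cmono be * F] has integral 0. *)
Lemma moment_cpd be i F : SC F ->
  cI (@lebm R m) (fun x : borelRn R m => cmono be x * cpd i F x) =
  - (Complex (be i)%:R 0 * cI (@lebm R m) (fun x : borelRn R m => cmono (decr be i) x * F x)).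
Proof.
move=> hF.
have hG : SC (fun x => cmono be x * F x) by apply: SC_M => //; exact: csm_cmono.
have h1 : SC (fun x => cmono (decr be i) x * F x) by apply: SC_M => //; exact: csm_cmono.
have h2 : SC (fun x => cmono be x * cpd i F x).
  by apply: SC_M; [exact: csm_cmono|exact: SC_cpd].
have := ft_cpd i 0 hG; rewrite mxE mulr0 (_ : Complex 0 0 = 0) // mul0r ft0E => h0.
have E : cpd i (fun x => cmono be x * F x) =
    (fun x => Complex (be i)%:R 0 * (cmono (decr be i) x * F x) + cmono be x * cpd i F x).
  apply/funext => x; apply: (cder_unique (csm_cder x i hG.1)).
  have := cderM (cder_cmono be i x) (csm_cder x i hF.1).
  by rewrite complexRM -mulrA.
move: h0; rewrite E cID; [|exact: cibleZ (cc_cible (SC_cc h1))|exact: (cc_cible (SC_cc h2))].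
rewrite cIZ; last exact: (cc_cible (SC_cc h1)).
by move=> /eqP; rewrite addrC addr_eq0 => /eqP.
Qed.

Lemma SC_iter F i k : SC F -> SC (iter k (cpd i) F).
Proof. by move=> h; elim: k => //= k IH; exact: SC_cpd. Qed.

(** Each integration by parts lowers the exponent [be i] and uses up one derivative; with more
    derivatives than degree, a step with [be i = 0] occurs and gives 0. *)
Lemma moments_iter F i k be : SC F -> (mlen be < k)%N ->
  cI (@lebm R m) (fun x : borelRn R m => cmono be x * iter k (cpd i) F x) = 0.
Proof.
move=> hF; elim: k be => // k IH be hk; rewrite iterS moment_cpd; last exact: SC_iter.
have [b0|b0] := posnP (be i); first by rewrite b0 mul0r oppr0.
rewrite IH ?mulr0 ?oppr0 //.
suff E : mlen be = (mlen (decr be i)).+1 by rewrite E ltnS in hk.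
rewrite /mlen (bigD1 i) //= [in RHS](bigD1 i) //= /decr eqxx -addSn prednK //.
by congr (_ + _)%N; apply: eq_bigr => k' /negbTE ->.
Qed.

Lemma ft_iter F i k xi : SC F ->
  ft (iter k (cpd i) F) xi = (Complex 0 (2 * pi * xi 0 i)) ^+ k * ft F xi.
Proof.
move=> h; elim: k => [|k IH]; first by rewrite expr0 mul1r.
by rewrite iterS ft_cpd ?IH ?exprS ?mulrA //; exact: SC_iter.
Qed.

Lemma cbox_compact F : cbox F -> compact (closure [set x | F x != 0]).
Proof.
move=> [r hr].
pose A := [set x : 'rV[R]_m | forall i, [set` `[- r, r]] (x 0 i)].
have cA : compact A by apply: (rV_compact (A := fun=> [set` `[- r, r]])) => _; exact: segment_compact.
apply: (subclosed_compact _ cA); first exact: closed_closure.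
have clA : closed A by apply: compact_closed => //; exact: norm_hausdorff.
rewrite ((closure_id A).1 clA); apply: closure_subset => x /= /eqP hx i.
rewrite /= in_itv /= -ler_norml leNgt; apply/negP => hi; apply: hx; exact: hr hi.
Qed.

Lemma compact_cbox F : compact (closure [set x | F x != 0]) -> cbox F.
Proof.
move=> /compact_bounded[B [_ hB]]; exists (B + 1) => x i hi; apply/eqP/negPn/negP => hF.
have := hB (B + 1); rewrite ltrDl => /(_ ltr01 x) h.
have : `|x| <= B + 1 by apply: h; exact: subset_closure.
by rewrite leNgt => /negP; apply; exact: lt_le_trans hi (rV_coord_le _ _).
Qed.

Lemma ON_SC N f : ON N f -> SC f.
Proof. by move=> [h1 h2 _]; split => //; exact: compact_cbox. Qed.

Lemma ON_iter N F i : (0 < m)%N -> SC F -> ON N (iter N.+1 (cpd i) F).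
Proof.
move=> m0 hF; have [h1 h2] := SC_iter i N.+1 hF; split => //.
  exact: cbox_compact.
by move=> be hb; rewrite cintE //; exact: moments_iter.
Qed.

End Moments.

(** * Order of vanishing of the transform at the origin *)

Section Vanishing.
Variables (R : realType) (m : nat).
Implicit Types (x y xi eta v : 'rV[R]_m) (F f : 'rV[R]_m -> C R) (i j : 'I_m) (ds : seq 'I_m).

Lemma rmvt (f df : R -> R) (B : R) : (forall t : R, is_derive t 1 f (df t)) ->
  (forall t, 0 <= t <= 1 -> `|df t| <= B) -> `|f 1 - f 0| <= B.
Proof.
move=> hd hB.
have cf : {within `[(0 : R), 1], continuous f}.
  apply: continuous_subspaceT => s; apply: differentiable_continuous.
  by apply/derivable1_diffP; apply: (@ex_derive _ _ _ _ _ _ _ (hd s)).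
have [c hc ->] := MVT_segment ler01 (fun s _ => hd s) cf.
by rewrite subr0 mulr1; apply: hB; move: hc; rewrite in_itv.
Qed.

Lemma cmvt (f df : R -> C R) (B : R) : (forall t : R, cder f t (1 : R) (df t)) ->
  (forall t, 0 <= t <= 1 -> cabs (df t) <= B) -> cabs (f 1 - f 0) <= 2 * B.
Proof.
move=> hd hB; apply: le_trans (cabs_le_ReIm _) _.
rewrite cReD cReN cImD cImN mulr2n mulrDl mul1r; apply: lerD.
  apply: (@rmvt (fun t => cRe (f t)) (fun t => cRe (df t))) => [t|t ht].
    exact: (hd t).1.
  exact: le_trans (Re_le_cabs _) (hB t ht).
apply: (@rmvt (fun t => cIm (f t)) (fun t => cIm (df t))) => [t|t ht].
  exact: (hd t).2.
exact: le_trans (Im_le_cabs _) (hB t ht).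
Qed.

(** Its transform is the iterated partial derivative of [ft F] along [ds]. A list instead of a
    multiindex lets derivatives be added one at a time, as in [pdseq]. *)
Definition Xds ds F x : C R := (\prod_(j <- ds) xmul (ev R j) x) * F x.

Lemma Xds_cc ds F : cc F -> cc (Xds ds F).
Proof. by move=> h; apply: ccM => //; apply: ccont_prod => j; exact: ccont_xmul. Qed.

Lemma Xds_nil F : Xds [::] F = F.
Proof. by apply/funext => x; rewrite /Xds big_nil mul1r. Qed.

Lemma Xds_cons j ds F : Xds (j :: ds) F = (fun x => xmul (ev R j) x * Xds ds F x).
Proof. by apply/funext => x; rewrite /Xds big_cons mulrA. Qed.

Lemma ft_Xds_cder ds F xi j : cc F ->
  cder (ft (Xds ds F)) xi (ev R j) (ft (Xds (j :: ds) F) xi).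
Proof. by move=> h; rewrite Xds_cons; apply: ft_cder; exact: Xds_cc. Qed.

Lemma ft_xmul F xi v : cc F ->
  ft (fun x => xmul v x * F x) xi = \sum_j Complex (v 0 j) 0 * ft (fun x => xmul (ev R j) x * F x) xi.
Proof.
move=> hF.
have hj j : cc (fun x => xmul (ev R j) x * F x) by apply: ccM => //; exact: ccont_xmul.
have [_ E] := cI_sum (F := fun (j : 'I_m) (x : borelRn R m) =>
    Complex (v 0 j) 0 * (xmul (ev R j) x * F x * cexpi (- (2 * pi * dotp x xi)))) (index_enum _)
  (fun j => cibleZ _ (ft_cible xi (cc_cible (hj j)))).
transitivity (\sum_j cI (@lebm R m) (fun x : borelRn R m =>
    Complex (v 0 j) 0 * (xmul (ev R j) x * F x * cexpi (- (2 * pi * dotp x xi))))); last first.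
  by apply: eq_bigr => j _; rewrite cIZ //; exact: ft_cible xi (cc_cible (hj j)).
rewrite -E; congr cI; apply/funext => x.
under eq_bigr do rewrite !mulrA; rewrite -!mulr_suml; congr (_ * _ * _).
rewrite /xmul; under eq_bigr do rewrite dotp_ev.
rewrite /dotp mulr_sumr; apply: complex_ext.
  rewrite (big_morph (fun z : C R => cRe z) (@cReD R) (erefl : cRe (0 : C R) = 0)).
  by apply/esym/big1 => j _ /=; ring.
rewrite (big_morph (fun z : C R => cIm z) (@cImD R) (erefl : cIm (0 : C R) = 0)) /= -sumrN.
by apply: eq_bigr => j _; rewrite /=; ring.
Qed.

Lemma ft_ray_bound F xi v (B : R) : cc F ->
  (forall j, cabs (ft (fun x => xmul (ev R j) x * F x) xi) <= B) ->
  cabs (ft (fun x => xmul v x * F x) xi) <= m%:R * `|v| * B.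
Proof.
move=> hF hB; rewrite ft_xmul //; apply: le_trans (cabs_sum _ _) _.
apply: (@le_trans _ _ (\sum_(j < m) `|v| * B)); last first.
  by rewrite sumr_const card_ord -[X in X <= _]mulr_natl mulrA.
apply: ler_sum => j _; rewrite cabsM cabsR ler_pM ?cabs_ge0 //.
exact: rV_coord_le.
Qed.

(** Mean value theorem on the segment from [xi] to [v + xi]. The factor m |v| comes from expanding
    [v] in coordinates, with the sup norm; the factor 2 from treating real and imaginary parts
    separately. *)
Lemma ft_increment F xi v (B : R) : cc F ->
  (forall t j, 0 <= t <= 1 -> cabs (ft (fun x => xmul (ev R j) x * F x) (t *: v + xi)) <= B) ->
  cabs (ft F (v + xi) - ft F xi) <= 2 * (m%:R * `|v| * B).
Proof.
move=> hF hB.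
have := @cmvt (fun t => ft F (t *: v + xi)) (fun t => ft (fun x => xmul v x * F x) (t *: v + xi))
  (m%:R * `|v| * B).
rewrite scale1r scale0r add0r; apply.
  by move=> t; apply/cder_line; exact: ft_cder.
by move=> t ht; apply: ft_ray_bound => // j; exact: hB.
Qed.

Lemma fin_bound (I : finType) (P : I -> R -> Prop) :
  (forall (i : I) (a b : R), a <= b -> P i a -> P i b) -> (forall i : I, exists2 B, 0 <= B & P i B) ->
  exists2 B : R, 0 <= B & forall i : I, P i B.
Proof.
move=> mono h; have {}h (i : I) : {B | 0 <= B & P i B} by apply/cid2/h.
exists (\sum_i s2val (h i)) => [|i]; first by apply: sumr_ge0 => i _; exact: (s2valP (h i)).
apply: mono (s2valP' (h i)); rewrite (bigD1 i) //= lerDl.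
by apply: sumr_ge0 => k _; exact: (s2valP (h k)).
Qed.

Lemma ft_lipschitz F : cc F ->
  exists2 K, 0 <= K & forall xi v, cabs (ft F (v + xi) - ft F xi) <= K * `|v|.
Proof.
move=> hF.
have [B B0 hB] : exists2 B, 0 <= B & forall j, forall xi, cabs (ft (fun x => xmul (ev R j) x * F x) xi) <= B.
  apply: (@fin_bound _ (fun j B => forall xi, cabs (ft (fun x => xmul (ev R j) x * F x) xi) <= B)).
    by move=> j a b ab h xi; exact: le_trans (h xi) ab.
  move=> j; apply: ft_bounded; apply: cc_cible; apply: ccM => //; exact: ccont_xmul.
exists (2 * m%:R * B); first by rewrite !mulr_ge0.
move=> xi v; apply: le_trans (ft_increment (B := B) hF _) _; first by move=> t j _; exact: hB.
by rewrite le_eqVlt; apply/orP; left; apply/eqP; ring.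
Qed.

Lemma lipschitz_at (f : 'rV[R]_m -> R) (K : R) xi : 0 <= K ->
  (forall v, `|f (v + xi) - f xi| <= K * `|v|) -> {for xi, continuous f}.
Proof.
move=> K0 h; apply/(@cvgrPdist_le _ _ _ _ (nbhs_filter xi)) => e e0.
have K1 : 0 < K + 1 by rewrite ltr_wpDl.
have e1 : 0 < e / (K + 1) by rewrite divr_gt0.
near=> eta.
have := h (eta - xi); rewrite subrK distrC => h1; apply: le_trans h1 _.
have h2 : `|eta - xi| <= e / (K + 1).
  rewrite distrC; near: eta; apply: filterS (nbhsx_ballx xi _ e1) => y.
  by rewrite -ball_normE /= => /ltW.
apply: (@le_trans _ _ ((K + 1) * (e / (K + 1)))); last by rewrite mulrC divfK // gt_eqF.
by apply: ler_pM => //; rewrite lerDl.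
Unshelve. all: by end_near. Qed.

Lemma ft_ccont F : cc F -> ccont (ft F).
Proof.
move=> /ft_lipschitz[K K0 hK]; split=> xi; apply: lipschitz_at K0 _ => v.
  by apply: le_trans (hK xi v); rewrite -cReN -cReD; exact: Re_le_cabs.
by apply: le_trans (hK xi v); rewrite -cImN -cImD; exact: Im_le_cabs.
Qed.

Lemma mlen_count ds : mlen (fun i => count_mem i ds) = size ds.
Proof.
rewrite /mlen; elim: ds => [|j ds IH] /=; first by rewrite big1.
by rewrite big_split /= IH (bigD1 j) //= eqxx big1 ?addn0 // => i; rewrite eq_sym => /negbTE ->.
Qed.

Lemma mono_count ds x : mono (fun i => count_mem i ds) x = \prod_(j <- ds) x 0 j.
Proof.
rewrite /mono; elim: ds => [|j ds IH] /=; first by rewrite big_nil big1.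
under eq_bigr do rewrite exprD.
rewrite big_split /= IH big_cons (bigD1 j) //= eqxx expr1 big1 ?mulr1 // => i.
by rewrite eq_sym => /negbTE ->.
Qed.

Lemma prod_xmul ds x : \prod_(j <- ds) xmul (ev R j) x =
  Complex 0 (- (2 * pi)) ^+ size ds * cmono (fun i => count_mem i ds) x.
Proof.
rewrite /cmono mono_count; elim: ds => [|j ds IH]; first by rewrite !big_nil mul1r.
have E : xmul (ev R j) x = Complex 0 (- (2 * pi)) * Complex (x 0 j) 0 :> C R.
  by rewrite /xmul dotp_ev; apply: complex_ext => /=; ring.
rewrite !big_cons IH E exprS (complexRM (x 0 j)) -!mulrA; congr (_ * _).
by rewrite mulrCA.
Qed.

Lemma ON_Xds0 N ds f : (0 < m)%N -> ON N f -> (size ds <= N)%N -> ft (Xds ds f) 0 = 0.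
Proof.
move=> m0 hf hs; have hc := SC_cc (ON_SC hf).
have E : (Xds ds f : borelRn R m -> C R) = (fun x => Complex 0 (- (2 * pi)) ^+ size ds *
    (cmono (fun i => count_mem i ds) x * f x)).
  by apply/funext => x; rewrite /Xds prod_xmul mulrA.
have [_ _ /(_ (fun i => count_mem i ds))] := hf; rewrite mlen_count => /(_ hs).
rewrite cintE // => h0; rewrite ft0E E cIZ ?h0 ?mulr0 //.
by apply: cc_cible; apply: ccM => //; apply: csm_ccont; exact: csm_cmono.
Qed.

(** Taylor's bound by descending order of differentiation: derivatives of order N + 1 are bounded,
    those of lower order vanish at 0 by the moment conditions, and each integration along the ray
    from 0 gains one power of |eta|. *)
Lemma ON_vanish N f k ds : (0 < m)%N -> ON N f -> (size ds + k = N.+1)%N ->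
  exists2 K, 0 <= K & forall eta, cabs (ft (Xds ds f) eta) <= K * `|eta| ^+ k.
Proof.
move=> m0 hf; have hc := SC_cc (ON_SC hf); elim: k ds => [|k IH] ds hs.
  have [B B0 hB] := ft_bounded (cc_cible (Xds_cc ds hc)).
  by exists B => // eta; rewrite expr0 mulr1.
have [B B0 hB] : exists2 B, 0 <= B & forall j : 'I_m, forall eta,
    cabs (ft (Xds (j :: ds) f) eta) <= B * `|eta| ^+ k.
  apply: (@fin_bound _ (fun (j : 'I_m) B => forall eta, cabs (ft (Xds (j :: ds) f) eta) <= B * `|eta| ^+ k)).
    by move=> j a b ab h eta; apply: le_trans (h eta) _; rewrite ler_wpM2r // exprn_ge0.
  by move=> j; apply: IH; rewrite /= -hs addnS addSn.
exists (2 * m%:R * B); first by rewrite !mulr_ge0.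
move=> eta; have := @ft_increment (Xds ds f) 0 eta (B * `|eta| ^+ k) (Xds_cc ds hc).
rewrite addr0 (ON_Xds0 m0 hf) ?subr0; last first.
  by rewrite -ltnS -hs addnS ltnS leq_addr.
move=> h; apply: le_trans (h _) _.
  move=> t j /andP[t0 t1]; rewrite -Xds_cons addr0; apply: le_trans (hB j _) _.
  rewrite ler_wpM2l // lerXn2r ?nnegrE // normrZ ger0_norm //.
  by rewrite ler_piMl.
by rewrite exprS le_eqVlt; apply/orP; left; apply/eqP; ring.
Qed.

End Vanishing.

(** * The symbol and its Leibniz expansion *)

Section Splits.
Variable T : eqType.
Implicit Types (ds : seq T) (p : seq T * seq T).

(** All distributions of the derivatives in [ds] over two factors. Pairs are repeated, which
    replaces the binomial coefficients of the Leibniz rule. *)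
Fixpoint splits ds : seq (seq T * seq T) :=
  if ds is j :: ds' then [seq (j :: p.1, p.2) | p <- splits ds'] ++ [seq (p.1, j :: p.2) | p <- splits ds']
  else [:: ([::], [::])].

Lemma splits_cons j ds p : p \in splits (j :: ds) ->
  exists2 q, q \in splits ds & p = (j :: q.1, q.2) \/ p = (q.1, j :: q.2).
Proof. by rewrite mem_cat => /orP[] /mapP[q hq ->]; exists q => //; [left|right]. Qed.

Lemma splits_size ds p : p \in splits ds -> (size p.1 + size p.2)%N = size ds.
Proof.
elim: ds p => [|j ds IH] p; first by rewrite inE => /eqP ->.
by move=> /splits_cons[q /IH + [] ->] /=; rewrite ?addnS ?addSn => ->.
Qed.

Lemma splits_all a ds p : p \in splits ds -> all a ds -> all a p.1.
Proof.
elim: ds p => [|j ds IH] p; first by rewrite inE => /eqP ->.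
by move=> /splits_cons[q /IH h [] ->] /= /andP[aj] /h // ->; rewrite aj.
Qed.

Lemma splits_pairwise (r : rel T) ds p : p \in splits ds -> pairwise r ds -> pairwise r p.1.
Proof.
elim: ds p => [|j ds IH] p; first by rewrite inE => /eqP ->.
move=> /splits_cons[q hq [] ->] /= /andP[aj] /(IH _ hq) // ->.
by rewrite (splits_all hq aj).
Qed.

(** Isolates the term in which all derivatives fall on the symbol; in the others the symbol receives
    fewer, so an induction on the order disposes of them. *)
Lemma splitsE ds : exists2 ps, splits ds = (ds, [::]) :: ps &
  forall p, p \in ps -> (size p.1 < size ds)%N.
Proof.
elim: ds => [|j ds [ps E hps]]; first by exists [::].
exists ([seq (j :: p.1, p.2) | p <- ps] ++ [seq (p.1, j :: p.2) | p <- splits ds]).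
  by rewrite /= {1}E.
move=> p; rewrite mem_cat => /orP[] /mapP[q hq ->] /=; first by rewrite ltnS hps.
by rewrite ltnS -(splits_size hq) leq_addr.
Qed.

End Splits.

Section Canonical.
Variable n : nat.
Implicit Types (al : 'I_n -> nat) (ds : seq 'I_n).

(* Partial derivatives of the symbol are controlled only in the order of [canon].
   A list of indices is in that order exactly when it is sorted, and sortedness
   passes to tails and to the sublists occurring in the Leibniz rule; so the
   derivatives are never exchanged. *)
Definition ordle : rel 'I_n := fun i j => (i <= j)%N.
Definition osorted ds := pairwise ordle ds.
Definition canon al := flatten [seq nseq (al j) j | j <- enum 'I_n].

Lemma canon_count al : (fun i => count_mem i (canon al)) = al.
Proof.
apply/funext => i; rewrite /canon.
have h (s : seq 'I_n) : uniq s ->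
    count_mem i (flatten [seq nseq (al j) j | j <- s]) = ((i \in s) * al i)%N.
  elim: s => [|j s IH] //= /andP[js us]; rewrite count_cat IH // count_nseq /=.
  rewrite inE [i == j]eq_sym; have [E|_] := eqVneq j i; last by rewrite mul0n.
  by rewrite -E (negbTE js) addn0.
by rewrite h ?enum_uniq // mem_enum mul1n.
Qed.

Lemma canon_osorted al : osorted (canon al).
Proof.
rewrite /osorted /canon.
have : pairwise ordle (enum 'I_n).
  have -> : ordle = relpre val leq by [].
  by rewrite -pairwise_map val_enum_ord -(sorted_pairwise leq_trans) iota_sorted.
elim: (enum _) => [|j s IH] //= /andP[hj hs]; rewrite pairwise_cat IH // andbT.
apply/andP; split.
  apply/allrelP => x y /nseqP[-> _] /flattenP[_ /mapP[k ks ->]] /nseqP[-> _].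
  exact: (allP hj).
elim: (al j) => [|k IHk] //=; rewrite IHk andbT.
by apply/allP => x /nseqP[-> _]; rewrite /ordle.
Qed.

Lemma osortedE ds : osorted ds -> ds = canon (fun i => count_mem i ds).
Proof.
have tr : transitive ordle by move=> ? ? ?; exact: leq_trans.
move=> h; apply: (@sorted_eq _ ordle).
- exact: tr.
- by move=> i j h'; apply/val_inj/eqP; rewrite eqn_leq.
- by rewrite sorted_pairwise.
- by rewrite sorted_pairwise //; exact: canon_osorted.
- by apply/allP => i _ /=; rewrite (congr1 (fun f => f i) (canon_count _)).
Qed.

Lemma enum_ord_add p q : enum 'I_(p + q) =
  [seq lshift q i | i <- enum 'I_p] ++ [seq rshift p i | i <- enum 'I_q].
Proof.
have hl (s : seq 'I_p) : map val (map (@lshift p q) s) = map val s by elim: s => //= i s ->.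
have hr (s : seq 'I_q) : map val (map (@rshift p q) s) = map (addn p) (map val s).
  by elim: s => //= i s ->.
by apply: (inj_map val_inj); rewrite map_cat hl hr !val_enum_ord iotaD -iotaDl addn0.
Qed.

(** With first multiindex 0 only the second block of indices contributes; hence [pd12] is a value of
    [sder0]. *)
Lemma canon_mcat al :
  flatten [seq nseq (mcat (fun=> 0%N) al k) k | k <- enum 'I_(n + n)] = map (@rshift n n) (canon al).
Proof.
rewrite enum_ord_add map_cat flatten_cat.
rewrite [X in X ++ _](_ : _ = [::]); last first.
  elim: (enum _) => [//|i s IH] /=; rewrite {}IH /mcat /=.
  by case: (fintype.split_ordP (lshift n i)) => j // /eqP; rewrite eq_lrshift.
rewrite /canon /=; elim: (enum _) => [//|i s IH] /=; rewrite {}IH map_cat map_nseq.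
congr (nseq _ _ ++ _); rewrite /mcat.
case: (fintype.split_ordP (rshift n i)) => j; first by move/eqP; rewrite eq_rlshift.
by move/rshift_inj ->.
Qed.

Lemma mlen_canon al : mlen al = size (canon al).
Proof. by rewrite -mlen_count canon_count. Qed.

End Canonical.

Section NormLemmas.
Variables (R : realType) (m : nat).
Implicit Types (x y : 'rV[R]_m).

Lemma rV_norm_le x (a : R) : 0 <= a -> (forall i, `|x 0 i| <= a) -> `|x| <= a.
Proof.
move=> a0 h; rewrite [leLHS]/Num.Def.normr /= mx_normrE; apply/bigmax_leP.
by split=> // -[i j] _ /=; rewrite ord1.
Qed.

Lemma normr_le_enorm x : `|x| <= enorm x.
Proof.
apply: rV_norm_le; rewrite /enorm ?sqrtr_ge0 // => i.
rewrite -sqrtr_sqr ler_wsqrtr // /dotp (bigD1 i) //= -expr2 lerDl.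
by apply: sumr_ge0 => j _; rewrite -expr2 sqr_ge0.
Qed.

Lemma near_neq0 x : x != 0 -> \near x, x != 0.
Proof.
rewrite -normr_gt0 => x0; apply: filterS (nbhsx_ballx x _ x0) => y.
by rewrite -ball_normE /=; apply: contraTneq => ->; rewrite subr0 ltxx.
Qed.

Lemma isder_sqr_bound (f : 'rV[R]_m -> R) x y (K : R) : 0 <= K ->
  (forall h : R, `|f (h *: y + x) - f x| <= K * h ^+ 2) -> is_derive x y f 0.
Proof.
move=> K0 hK; apply/isderP; apply/cvgrPdist_le => e e0.
have K1 : 0 < K + 1 by rewrite ltr_wpDl.
near=> h; rewrite sub0r normrN normrM normfV.
have h0 : h != 0 by near: h; exact: nbhs_dnbhs_neq.
have h1 : `|h| <= e / (K + 1).
  near: h; apply: nbhs_dnbhs; apply: filterS (nbhsx_ballx (0 : R) _ (divr_gt0 e0 K1)) => t.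
  by rewrite -ball_normE /= sub0r normrN => /ltW.
rewrite mulrC ler_pdivrMr ?normr_gt0 //; apply: le_trans (hK h) _.
rewrite -[h ^+ 2]ger0_norm ?sqr_ge0 // normrX expr2 mulrA ler_wpM2r //.
apply: (@le_trans _ _ ((K + 1) * (e / (K + 1)))); last by rewrite mulrC divfK // gt_eqF.
by apply: ler_pM => //; rewrite lerDl.
Unshelve. all: by end_near. Qed.

End NormLemmas.

Lemma nonexpansive_continuous (R : realType) p q (f : 'rV[R]_p -> 'rV[R]_q) :
  (forall x y, `|f x - f y| <= `|x - y|) -> continuous f.
Proof.
move=> hf x; apply/(@cvgrPdist_lt _ _ _ _ (nbhs_filter x)) => e e0.
apply: filterS (nbhsx_ballx x _ e0) => y; rewrite -ball_normE /= => h.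
exact: le_lt_trans (hf _ _) h.
Qed.

Lemma row_mx_continuous (R : realType) p q (x : 'rV[R]_p) :
  continuous (fun y : 'rV[R]_q => row_mx x y).
Proof.
apply: nonexpansive_continuous => y z.
rewrite -[- row_mx _ _]scaleN1r scale_row_mx add_row_mx !scaleN1r subrr.
apply: rV_norm_le => // i; case: (fintype.split_ordP i) => j ->.
  by rewrite row_mxEl mxE normr0.
by rewrite row_mxEr rV_coord_le.
Qed.

Lemma lsubmx_continuous (R : realType) p q : continuous (@lsubmx R 1 p q).
Proof.
apply: nonexpansive_continuous => y z; apply: rV_norm_le => // i.
rewrite !mxE (_ : y 0 _ - z 0 _ = (y - z) 0 (lshift q i)) ?rV_coord_le //.
by rewrite !mxE.
Qed.

Lemma rsubmx_continuous (R : realType) p q : continuous (@rsubmx R 1 p q).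
Proof.
apply: nonexpansive_continuous => y z; apply: rV_norm_le => // i.
rewrite !mxE (_ : y 0 _ - z 0 _ = (y - z) 0 (rshift p i)) ?rV_coord_le //.
by rewrite !mxE.
Qed.

Section ContinuityAt.
Variables (R : realType) (m : nat).
Implicit Types (f g : 'rV[R]_m -> C R) (x : 'rV[R]_m).

Definition ccontat f x :=
  (cRe (f y) @[y --> x] --> cRe (f x)) /\ (cIm (f y) @[y --> x] --> cIm (f x)).

Lemma ccontatM f g x : ccontat f x -> ccontat g x -> ccontat (fun y => f y * g y) x.
Proof.
move=> [f1 f2] [g1 g2]; split; rewrite ?cReM ?cImM ?cReD ?cImD.
  by under eq_fun do rewrite cReM; exact: (cvgB (cvgM f1 g1) (cvgM f2 g2)).
by under eq_fun do rewrite cImM; exact: (cvgD (cvgM f1 g2) (cvgM f2 g1)).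
Qed.

Lemma ccontatD f g x : ccontat f x -> ccontat g x -> ccontat (fun y => f y + g y) x.
Proof.
move=> [f1 f2] [g1 g2]; split; rewrite ?cReM ?cImM ?cReD ?cImD.
  by under eq_fun do rewrite cReD; exact: (cvgD f1 g1).
by under eq_fun do rewrite cImD; exact: (cvgD f2 g2).
Qed.

Lemma ccontat_sum (I : Type) (s : seq I) (F : I -> 'rV[R]_m -> C R) x :
  (forall i, ccontat (F i) x) -> ccontat (fun y => \sum_(i <- s) F i y) x.
Proof.
move=> h; elim: s => [|i s IH].
  by split; under eq_fun do rewrite big_nil; rewrite big_nil; exact: cst_continuous.
have [h1 h2] := ccontatD (h i) IH.
by split; under eq_fun do rewrite big_cons; rewrite big_cons.
Qed.

Lemma near_ccontat f g x : (\near x, f x = g x) -> f x = g x -> ccontat f x -> ccontat g x.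
Proof.
move=> h E [f1 f2]; split; rewrite -E.
  by apply: cvg_trans f1; apply: (@near_eq_cvg _ _ _ (nbhs_filter x)); apply: (@filterS _ _ (nbhs_filter x) _ _ _ h) => y ->.
by apply: cvg_trans f2; apply: (@near_eq_cvg _ _ _ (nbhs_filter x)); apply: (@filterS _ _ (nbhs_filter x) _ _ _ h) => y ->.
Qed.

End ContinuityAt.

Section SumBound.
Variables (R : realType) (T : Type) (I : eqType).

Lemma sum_bound (s : seq I) (F : I -> T -> C R) (w : T -> R) : (forall x, 0 <= w x) ->
  (forall i, i \in s -> exists2 K, 0 <= K & forall x, cabs (F i x) <= K * w x) ->
  exists2 K, 0 <= K & forall x, cabs (\sum_(i <- s) F i x) <= K * w x.
Proof.
move=> w0; elim: s => [|i s IH] h.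
  by exists 0 => // x; rewrite big_nil cabs0 mul0r.
have [K K0 hK] := h i (mem_head _ _).
have [|L L0 hL] := IH; first by move=> j js; apply: h; rewrite inE js orbT.
exists (K + L); first by rewrite addr_ge0.
move=> x; rewrite big_cons mulrDl; apply: le_trans (cabsD _ _) _.
exact: lerD.
Qed.

End SumBound.

Section Symbol.
Variables (R : realType) (n N : nat) (sigma : 'rV[R]_n -> 'rV[R]_n -> C R).
Hypothesis Hsmooth : csmooth_on
  [set z : 'rV[R]_(n + n) | lsubmx z != 0 /\ rsubmx z != 0] (uncurry2 sigma).
Hypothesis Hbound : forall a1 a2 : 'I_n -> nat, exists Ca : R,
  forall xi eta : 'rV[R]_n, xi != 0 -> eta != 0 ->
    cabs (pd12 a1 a2 sigma xi eta) <= Ca * (enorm xi ^- mlen a1) * (enorm eta ^- mlen a2).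
Implicit Types (ds : seq 'I_n) (xi eta v : 'rV[R]_n) (j : 'I_n).

Definition sder0 ds (z : 'rV[R]_(n + n)) : C R :=
  Complex (pdseq (map (@rshift n n) ds) (fun z => cRe (uncurry2 sigma z)) z)
          (pdseq (map (@rshift n n) ds) (fun z => cIm (uncurry2 sigma z)) z).

(* The junk value 0 on the axes makes the products with [ft a], for [a] in [ON N],
   differentiable across [eta = 0]. *)
Definition sder ds xi eta : C R :=
  if (xi == 0) || (eta == 0) then 0 else sder0 ds (row_mx xi eta).

Lemma sder_pd12 al xi eta : xi != 0 -> eta != 0 ->
  sder (canon al) xi eta = pd12 (fun=> 0%N) al sigma xi eta.
Proof.
move=> /negbTE x0 /negbTE e0.
by rewrite /sder x0 e0 /= /sder0 /pd12 /cpdiff /pdiff canon_mcat.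
Qed.

Lemma sder_nil xi eta : xi != 0 -> eta != 0 -> sder [::] xi eta = sigma xi eta.
Proof.
move=> /negbTE x0 /negbTE e0.
by rewrite /sder x0 e0 /sder0 /= /uncurry2 row_mxKl row_mxKr; case: (sigma xi eta).
Qed.

Lemma row_mx_line xi eta j (h : R) :
  row_mx xi (h *: ev R j + eta) = h *: ev R (rshift n j) + row_mx xi eta.
Proof.
apply/rowP => k; case: (fintype.split_ordP k) => i -> /=.
  by rewrite row_mxEl [RHS]mxE row_mxEl !mxE eqxx eq_lrshift andbF mulr0 add0r.
by rewrite row_mxEr [RHS]mxE row_mxEr !mxE !eqxx eq_rshift.
Qed.

Lemma near_sder ds xi eta : xi != 0 -> eta != 0 ->
  \near eta, sder0 ds (row_mx xi eta) = sder ds xi eta.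
Proof.
move=> /negbTE x0 e0; near=> y.
have /negbTE y0 : y != 0 by near: y; exact: near_neq0.
by rewrite /sder x0 y0.
Unshelve. all: by end_near. Qed.

Lemma is_derive_row (f : 'rV[R]_(n + n) -> R) xi eta j (d : R) :
  is_derive (row_mx xi eta) (ev R (rshift n j)) f d ->
  is_derive eta (ev R j) (fun y => f (row_mx xi y)) d.
Proof.
by move=> /isderP h; apply/isderP; under eq_fun do rewrite row_mx_line.
Qed.

Lemma sder_cder ds xi eta j : xi != 0 -> eta != 0 ->
  cder (sder ds xi) eta (ev R j) (sder (j :: ds) xi eta).
Proof.
move=> x0 e0.
have U : [set z : 'rV[R]_(n + n) | lsubmx z != 0 /\ rsubmx z != 0] (row_mx xi eta).
  by rewrite /= row_mxKl row_mxKr.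
have [/(_ (map (@rshift n n) ds) _ U)[h1 _] /(_ (map (@rshift n n) ds) _ U)[h2 _]] := Hsmooth.
have E : sder (j :: ds) xi eta = sder0 (j :: ds) (row_mx xi eta).
  by rewrite /sder (negbTE x0) (negbTE e0).
split; rewrite E /=.
  have d1 := DeriveDef (h1 (rshift n j)) (erefl _).
  apply: near_eq_is_derive (is_derive_row d1).
  by near=> y; have -> // : sder ds xi y = sder0 ds (row_mx xi y); near: y; apply: filterS (near_sder ds x0 e0).
have d2 := DeriveDef (h2 (rshift n j)) (erefl _).
apply: near_eq_is_derive (is_derive_row d2).
by near=> y; have -> // : sder ds xi y = sder0 ds (row_mx xi y); near: y; apply: filterS (near_sder ds x0 e0).
Unshelve. all: by end_near. Qed.

(** No derivative falls on the first variable, so [xi] leaves the estimate. The sup norm is at most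
    [enorm], so its negative powers are the larger ones. *)
Lemma sder_bound ds : osorted ds ->
  exists2 K, 0 <= K & forall xi eta, cabs (sder ds xi eta) <= K * `|eta| ^- size ds.
Proof.
move=> /osortedE E; have [Ca hCa] := Hbound (fun=> 0%N) (fun i => count_mem i ds).
exists `|Ca| => // xi eta.
have [x0|x0] := eqVneq xi 0; first by rewrite /sder x0 eqxx cabs0 mulr_ge0 // invr_ge0 exprn_ge0.
have [e0|e0] := eqVneq eta 0; first by rewrite /sder e0 eqxx orbT cabs0 mulr_ge0 // invr_ge0 exprn_ge0.
rewrite E sder_pd12 // -E; apply: le_trans (hCa _ _ x0 e0) _.
rewrite (_ : mlen _ = 0)%N ?expr0 ?invr1 ?mulr1; last by rewrite /mlen big1.
rewrite mlen_count; apply: le_trans (ler_wpM2r _ (ler_norm Ca)) _.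
  by rewrite invr_ge0 exprn_ge0 // /enorm sqrtr_ge0.
rewrite ler_wpM2l //.
have e1 : 0 < `|eta| by rewrite normr_gt0.
have e2 := lt_le_trans e1 (normr_le_enorm eta).
rewrite lef_pV2 ?posrE ?exprn_gt0 //.
by apply: lerXn2r; rewrite ?nnegrE ?normr_le_enorm // (ltW e2).
Qed.

Lemma sder_ccontat ds xi eta : xi != 0 -> eta != 0 -> ccontat (sder ds xi) eta.
Proof.
move=> x0 e0.
have U : [set z : 'rV[R]_(n + n) | lsubmx z != 0 /\ rsubmx z != 0] (row_mx xi eta).
  by rewrite /= row_mxKl row_mxKr.
have [/(_ (map (@rshift n n) ds) _ U)[_ h1] /(_ (map (@rshift n n) ds) _ U)[_ h2]] := Hsmooth.
apply: near_ccontat (near_sder ds x0 e0) _ _.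
  by rewrite /sder (negbTE x0) (negbTE e0).
split.
  exact: (cvg_comp _ _ (@row_mx_continuous R n n xi eta) h1).
exact: (cvg_comp _ _ (@row_mx_continuous R n n xi eta) h2).
Qed.

Lemma offaxes_open : open [set z : 'rV[R]_(n + n) | lsubmx z != 0 /\ rsubmx z != 0].
Proof.
have o0 : open [set x : 'rV[R]_n | x != 0] by rewrite openE => x /near_neq0.
have oI := openI (open_comp (fun x _ => @lsubmx_continuous R n n x) o0)
  (open_comp (fun x _ => @rsubmx_continuous R n n x) o0).
exact: oI.
Qed.

Lemma patch_measurable (U : set 'rV[R]_(n + n)) (f g : 'rV[R]_(n + n) -> R) : open U ->
  (forall x, U x -> {for x, continuous f}) -> (forall x, U x -> g x = f x) ->
  (forall x, ~ U x -> g x = 0) -> measurable_fun setT (g : borelRn R (n + n) -> R).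
Proof.
move=> oU cf gf g0.
rewrite (_ : g = (f : borelRn R (n + n) -> R) \_ (U : set (borelRn R (n + n)))).
  apply/(measurable_restrictT _ _).1; first exact: open_borel.
  exact: continuous_on_measurable.
apply/funext => x; rewrite /patch; case: ifPn => [/set_mem|/negP h].
  exact: gf.
by apply: g0 => Ux; apply: h; exact: mem_set.
Qed.

Lemma sder_measurable ds :
  cmeas (fun z : borelRn R (n + n) => sder ds (lsubmx (z : 'rV[R]_(n + n))) (rsubmx (z : 'rV[R]_(n + n)))).
Proof.
have h (g : C R -> R) (P : 'rV[R]_(n + n) -> R) : g 0 = 0 -> (forall z, g (sder0 ds z) = P z) ->
    (forall z, [set z : 'rV[R]_(n + n) | lsubmx z != 0 /\ rsubmx z != 0] z -> {for z, continuous P}) ->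
    measurable_fun setT (fun z : borelRn R (n + n) => g (sder ds (lsubmx (z : 'rV[R]_(n + n))) (rsubmx (z : 'rV[R]_(n + n))))).
  move=> g0 gP cP; apply: patch_measurable offaxes_open cP _ _ => z.
    by move=> [/negbTE z1 /negbTE z2]; rewrite -gP /sder z1 z2 hsubmxK.
  move=> hz; rewrite /sder; case: ifPn => // /norP[z1 z2].
  by case: hz.
split; [apply: (h (fun c => cRe c)) => //|apply: (h (fun c => cIm c)) => //] => z Uz.
  exact: (Hsmooth.1 _ _ Uz).2.
exact: (Hsmooth.2 _ _ Uz).2.
Qed.

End Symbol.

(** * The Leibniz expansion of the symbol times a transform *)

Section LeibnizFamily.
Variables (R : realType) (n N : nat) (sigma : 'rV[R]_n -> 'rV[R]_n -> C R).
Hypothesis n0 : (0 < n)%N.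
Hypothesis Hsmooth : csmooth_on
  [set z : 'rV[R]_(n + n) | lsubmx z != 0 /\ rsubmx z != 0] (uncurry2 sigma).
Hypothesis Hbound : forall a1 a2 : 'I_n -> nat, exists Ca : R,
  forall xi eta : 'rV[R]_n, xi != 0 -> eta != 0 ->
    cabs (pd12 a1 a2 sigma xi eta) <= Ca * (enorm xi ^- mlen a1) * (enorm eta ^- mlen a2).
Variable a : 'rV[R]_n -> C R.
Hypothesis ha : ON N a.
Implicit Types (ds : seq 'I_n) (xi eta v : 'rV[R]_n) (j : 'I_n).

Definition leib ds xi eta : C R :=
  \sum_(p <- splits ds) sder sigma p.1 xi eta * ft (Xds p.2 a) eta.

Let cca : cc a := SC_cc (ON_SC ha).

Lemma leib_xi0 ds eta : leib ds 0 eta = 0.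
Proof. by rewrite /leib big1 // => p _; rewrite /sder eqxx mul0r. Qed.

Lemma leib_eta0 ds xi : leib ds xi 0 = 0.
Proof. by rewrite /leib big1 // => p _; rewrite /sder eqxx orbT mul0r. Qed.

(* Each derivative of [sder] costs one power of [|eta|]; the [N + 1] powers come from
   the vanishing moments of [a]. *)
Lemma leib_bound ds : osorted ds -> (size ds <= N)%N -> exists2 K, 0 <= K &
  forall xi eta, cabs (leib ds xi eta) <= K * Num.min 1 (`|eta| ^+ (N.+1 - size ds)).
Proof.
move=> od sd.
have [] := @sum_bound R ('rV[R]_n * 'rV[R]_n)%type _ (splits ds)
  (fun p z => sder sigma p.1 z.1 z.2 * ft (Xds p.2 a) z.2)
  (fun z => Num.min 1 (`|z.2| ^+ (N.+1 - size ds))).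
- by move=> z; rewrite le_min ler01 exprn_ge0.
- move=> p hp.
  have [K1 K10 h1] := sder_bound Hbound (splits_pairwise hp od).
  have sp := splits_size hp.
  have [|K2 K20 h2] := @ON_vanish R n N a (N.+1 - size p.2) p.2 n0 ha.
    by rewrite subnKC // ltnW // ltnS (leq_trans _ sd) // -sp leq_addl.
  have [K3 K30 h3] := ft_bounded (cc_cible (Xds_cc p.2 cca)).
  (* [K2] serves for |eta| <= 1, through the vanishing at the origin; [K3], a plain bound on the
     transform, serves for |eta| > 1, where the negative powers are at most 1. *)
  exists (K1 * (K2 + K3)) => [|[xi eta] /=]; first by rewrite mulr_ge0 ?addr_ge0.
  have [e0|] := eqVneq eta 0.
    by rewrite /sder e0 eqxx orbT mul0r cabs0 !mulr_ge0 ?addr_ge0 // le_min ler01 exprn_ge0.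
  rewrite -normr_gt0 cabsM => r0.
  have {}h1 := h1 xi eta; have {}h2 := h2 eta; have {}h3 := h3 eta.
  move: `|eta| r0 h1 h2 (cabs_ge0 (sder sigma p.1 xi eta)) (cabs_ge0 (ft (Xds p.2 a) eta)) h3.
  move: (cabs (sder _ _ _ _)) (cabs (ft _ _)) => A B r r0 h1 h2 A0 B0 h3.
  have hk : A * B <= K1 * K2 * r ^+ (N.+1 - size ds).
    apply: le_trans (ler_pM A0 B0 h1 h2) _.
    rewrite (_ : N.+1 - size p.2 = size p.1 + (N.+1 - size ds))%N; last first.
      by rewrite -sp addnBA ?subnDl // sp ltnW.
    rewrite exprD le_eqVlt; apply/orP; left; apply/eqP.
    have : r ^+ size p.1 != 0 by rewrite expf_neq0 // gt_eqF.
    by move: (r ^+ size p.1) (r ^+ _) => x y hx; field.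
  rewrite minr_pMr ?mulr_ge0 ?addr_ge0 // le_min mulr1; apply/andP; split; last first.
    by apply: le_trans hk _; rewrite ler_wpM2r ?exprn_ge0 ?(ltW r0) // ler_wpM2l // lerDl.
  have [r1|r1] := leP r 1.
    apply: le_trans hk _; apply: (@le_trans _ _ (K1 * K2)).
      by rewrite ler_piMr ?mulr_ge0 // exprn_ile1 // (ltW r0).
    by rewrite ler_wpM2l // lerDl.
  apply: ler_pM => //; last by apply: le_trans h3 _; rewrite lerDr.
  apply: le_trans h1 _; rewrite ler_piMr // invf_le1 ?exprn_gt0 //.
  by rewrite exprn_ege1 // ltW.
by move=> K K0 h; exists K => // xi eta; exact: (h (xi, eta)).
Qed.

(** Off the axes this is the product rule, each term of [splits ds] giving two terms of
    [splits (j :: ds)]. For [xi = 0] the family is 0, and at [eta = 0] the order of vanishing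
    decides. *)
Lemma leib_cder ds xi eta j : osorted (j :: ds) -> (size (j :: ds) <= N)%N ->
  cder (leib ds xi) eta (ev R j) (leib (j :: ds) xi eta).
Proof.
move=> /andP[_ od] /= sd.
have [->|x0] := eqVneq xi 0.
  rewrite leib_xi0 (_ : leib ds 0 = fun=> 0); first exact: cder_cst.
  by apply/funext => y; exact: leib_xi0.
(* As [size ds < N], the exponent N + 1 - size ds in [leib_bound] is at least 2: the increment is
   quadratic in [h] and the derivative is 0, the value prescribed on the axis. *)
have [->|e0] := eqVneq eta 0.
  rewrite leib_eta0; have [K K0 hK] := leib_bound od (ltnW sd).
  have hq (h : R) : cabs (leib ds xi (h *: ev R j + 0)) <= K * `|ev R j| ^+ 2 * h ^+ 2.
    rewrite addr0; apply: le_trans (hK xi _) _; rewrite -mulrA ler_wpM2l //.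
    have -> : `|ev R j| ^+ 2 * h ^+ 2 = `|h *: ev R j| ^+ 2.
      by rewrite normrZ exprMn real_normK ?num_real // mulrC.
    move: `|h *: _| (normr_ge0 (h *: ev R j)) => r r0; rewrite ge_min; have [r1|r1] := leP r 1; apply/orP; [right|left].
      by apply: ler_wiXn2l => //; rewrite ltn_subRL addn1 ltnS.
    by rewrite exprn_ege1 // ltW.
  have K2 : 0 <= K * `|ev R j| ^+ 2 by rewrite mulr_ge0 // exprn_ge0.
  split; apply: (isder_sqr_bound K2) => h; rewrite leib_eta0 subr0; apply: le_trans (hq h).
    exact: Re_le_cabs.
  exact: Im_le_cabs.
have -> : leib (j :: ds) xi eta = \sum_(p <- splits ds)
    (sder sigma (j :: p.1) xi eta * ft (Xds p.2 a) eta + sder sigma p.1 xi eta * ft (Xds (j :: p.2) a) eta).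
  by rewrite /leib /= big_cat /= !big_map big_split.
apply: cder_sum => p; apply: cderM; first exact: sder_cder.
exact: ft_Xds_cder.
Qed.

(** At [eta = 0] the exponent in [leib_bound] is at least 1, which gives a Lipschitz bound; off the
    axes all factors are continuous. *)
Lemma leib_ccont ds xi : osorted ds -> (size ds <= N)%N -> ccont (leib ds xi).
Proof.
move=> od sd; suff h eta : ccontat (leib ds xi) eta by split=> eta; [exact: (h eta).1|exact: (h eta).2].
have [->|x0] := eqVneq xi 0.
  rewrite (_ : leib ds 0 = fun=> 0); first by split; exact: cst_continuous.
  by apply/funext => y; exact: leib_xi0.
have [->|e0] := eqVneq eta 0.
  have [K K0 hK] := leib_bound od sd.
  have hq v : cabs (leib ds xi (v + 0)) <= K * `|v|.
    rewrite addr0; apply: le_trans (hK xi v) _; rewrite ler_wpM2l // ge_min.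
    have [r1|r1] := leP `|v| 1; apply/orP; [right|by left; exact: ltW].
    by rewrite -[leRHS]expr1; apply: ler_wiXn2l => //; rewrite subn_gt0 ltnS.
  split; apply: (lipschitz_at K0) => v; rewrite leib_eta0 subr0; apply: le_trans (hq v).
    exact: Re_le_cabs.
  exact: Im_le_cabs.
apply: ccontat_sum => p; apply: ccontatM; first exact: sder_ccontat.
by have [h1 h2] := ft_ccont (Xds_cc p.2 cca); split; [exact: h1|exact: h2].
Qed.

Lemma lsubmx_measurable p q : measurable_fun setT (lsubmx : borelRn R (p + q) -> borelRn R p).
Proof.
by apply: measurable_fun_rV => i; under eq_fun do rewrite mxE; exact: coord_measurable.
Qed.

Lemma rsubmx_measurable p q : measurable_fun setT (rsubmx : borelRn R (p + q) -> borelRn R q).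
Proof.
by apply: measurable_fun_rV => i; under eq_fun do rewrite mxE; exact: coord_measurable.
Qed.

Lemma leib_measurable ds :
  cmeas (fun z : borelRn R (n + n) => leib ds (lsubmx (z : 'rV[R]_(n + n))) (rsubmx (z : 'rV[R]_(n + n)))).
Proof.
apply: cmeas_sum => p; apply: cmeasM; first exact: sder_measurable.
exact: (cmeas_comp (ccont_meas (ft_ccont (Xds_cc p.2 cca))) (@rsubmx_measurable n n)).
Qed.

(** The symbol contributes only its bound; the decay in [eta] is that of [ft a], and makes the
    double integral absolutely convergent. *)
Lemma leib_nil_dom : exists2 K, 0 <= K & forall xi eta, cabs (leib [::] xi eta) <= K * wgtn eta.
Proof.
have [K1 K10 h1] := @sder_bound R n sigma Hbound [::] isT.
have [K2 K20 h2] := ft_decay (ON_SC ha).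
exists (K1 * K2); first by rewrite mulr_ge0.
move=> xi eta; rewrite /leib /= big_seq1 cabsM Xds_nil -mulrA.
by apply: ler_pM; rewrite ?cabs_ge0 //; have := h1 xi eta; rewrite expr0 invr1 mulr1.
Qed.

End LeibnizFamily.

(** * Moments of the bilinear operator *)

Section KeyIdentity.
Variables (R : realType) (n N : nat) (A T : 'rV[R]_n -> C R)
  (D : seq 'I_n -> 'rV[R]_n -> 'rV[R]_n -> C R).
Hypothesis mA : cmeas (A : borelRn R n -> C R).
Hypothesis hA : exists2 K, 0 <= K & forall xi, cabs (A xi) <= K * wgtn xi.
Hypothesis mD : forall ds, cmeas (fun z : borelRn R (n + n) =>
  D ds (lsubmx (z : 'rV[R]_(n + n))) (rsubmx (z : 'rV[R]_(n + n)))).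
Hypothesis hD : exists2 K, 0 <= K & forall xi eta, cabs (D [::] xi eta) <= K * wgtn eta.
Hypothesis bD : forall ds, osorted ds -> (size ds <= N)%N ->
  exists2 K, 0 <= K & forall xi eta, cabs (D ds xi eta) <= K.
Hypothesis cD : forall ds xi, osorted ds -> (size ds <= N)%N -> ccont (D ds xi).
Hypothesis dD : forall ds xi eta j, osorted (j :: ds) -> (size (j :: ds) <= N)%N ->
  cder (D ds xi) eta (ev R j) (D (j :: ds) xi eta).
Implicit Types (ds : seq 'I_n) (x xi eta z : 'rV[R]_n) (j : 'I_n).

(** For [ds = [::]] this is the Fourier transform of [T]; a longer [ds] gives its derivatives. [A]
    stands for [ft a1] and [D] for [leib sigma a2]. *)
Definition conv ds z : C R :=
  cI (@lebm R n) (fun xi : borelRn R n => A xi * D ds xi (z - (xi : 'rV[R]_n))).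

Let iA : cible (@lebm R n) (A : borelRn R n -> C R).
Proof. by have [K _ h] := hA; exact: cible_dom mA (ribleZ K (wgtn_rible R n)) h. Qed.

Lemma shear_measurable : measurable_fun setT (fun p : borelRn R n * borelRn R n =>
  row_mx (p.1 : 'rV[R]_n) ((p.2 : 'rV[R]_n) - p.1) : borelRn R (n + n)).
Proof.
have h1 j : measurable_fun setT (fun p : borelRn R n * borelRn R n => (p.1 : 'rV[R]_n) 0 j).
  exact: (measurableT_comp (coord_measurable j) (@measurable_fst _ _ _ _)).
have h2 j : measurable_fun setT (fun p : borelRn R n * borelRn R n => (p.2 : 'rV[R]_n) 0 j).
  exact: (measurableT_comp (coord_measurable j) (@measurable_snd _ _ _ _)).
apply: measurable_fun_rV => i; case: (fintype.split_ordP i) => j ->.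
  by under eq_fun do rewrite row_mxEl; exact: h1.
by under eq_fun do rewrite row_mxEr !mxE; exact: measurable_funB.
Qed.

Lemma conv_integrand_measurable ds :
  cmeas (fun p : borelRn R n * borelRn R n => A p.1 * D ds p.1 ((p.2 : 'rV[R]_n) - p.1)).
Proof.
apply: cmeasM; first exact: (cmeas_comp mA (@measurable_fst _ _ _ _)).
rewrite (_ : (fun p => _) = (fun p : borelRn R n * borelRn R n =>
  D ds (lsubmx (row_mx (p.1 : 'rV[R]_n) ((p.2 : 'rV[R]_n) - p.1)))
   (rsubmx (row_mx (p.1 : 'rV[R]_n) ((p.2 : 'rV[R]_n) - p.1))))).
  exact: (cmeas_comp (mD ds) shear_measurable).
by apply/funext => p; rewrite row_mxKl row_mxKr.
Qed.

Lemma conv_slice_measurable ds z :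
  cmeas (fun xi : borelRn R n => A xi * D ds xi (z - (xi : 'rV[R]_n))).
Proof.
exact: (cmeas_comp (conv_integrand_measurable ds)
  (@pair2_measurable _ _ (borelRn R n) (borelRn R n) z)).
Qed.

Lemma conv_cible ds z : osorted ds -> (size ds <= N)%N ->
  cible (@lebm R n) (fun xi : borelRn R n => A xi * D ds xi (z - (xi : 'rV[R]_n))).
Proof.
move=> od sd; have [K K0 hK] := bD od sd.
apply: (cible_dom (conv_slice_measurable ds z) (ribleZ K (cible_cabs iA))) => xi.
by rewrite cabsM mulrC ler_wpM2r ?cabs_ge0.
Qed.

Lemma conv_cder ds z j : osorted (j :: ds) -> (size (j :: ds) <= N)%N ->
  cder (conv ds) z (ev R j) (conv (j :: ds) z).
Proof.
move=> oj sj; have [K K0 hK] := bD oj sj.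
have od : osorted ds by case/andP: oj.
have sd : (size ds <= N)%N := ltnW sj.
have := @cI_cder _ _ R (@lebm R n) (fun (t : R) (xi : borelRn R n) => A xi * D ds xi (t *: ev R j + z - (xi : 'rV[R]_n)))
  (fun (t : R) (xi : borelRn R n) => A xi * D (j :: ds) xi (t *: ev R j + z - (xi : 'rV[R]_n)))
  (fun xi => K * cabs (A xi)).
move=> h; have {h} : cder (fun t : R => conv ds (t *: ev R j + z)) 0 (1 : R) (conv (j :: ds) (0 *: ev R j + z)).
  apply: h.
  - by move=> t _; exact: conv_cible.
  - move=> t xi _; apply: cderZ; under eq_fun do rewrite -addrA; rewrite -addrA.
    by apply/cder_line; exact: dD.
  - exact: ribleZ (cible_cabs iA).
  - by move=> t xi _; rewrite cabsM mulrC ler_wpM2r ?cabs_ge0.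
by move=> /cder_line; rewrite scale0r add0r.
Qed.

Hypothesis TE : forall x, T x = cI (@lebm R (n + n)) (fun z : borelRn R (n + n) =>
  cexpi (2 * pi * dotp x (lsubmx (z : 'rV[R]_(n + n)) + rsubmx (z : 'rV[R]_(n + n)))) *
  (A (lsubmx (z : 'rV[R]_(n + n))) *
   D [::] (lsubmx (z : 'rV[R]_(n + n))) (rsubmx (z : 'rV[R]_(n + n))))).

(** The substitution eta = z - xi in the inner integral turns the integrand [F] into [F'];
    exchanging the order of integration then exhibits [T] as the inverse Fourier transform of [conv
    [::]]. *)
Lemma oscillatory_conv x : cible (@lebm R n) (fun z : borelRn R n => conv [::] z * cexpi (2 * pi * dotp x z)) /\
  T x = cI (@lebm R n) (fun z : borelRn R n => conv [::] z * cexpi (2 * pi * dotp x z)).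
Proof.
have [K K0 hK] := hD; have [KA KA0 hKA] := hA.
pose F (p : borelRn R n * borelRn R n) : C R :=
  cexpi (2 * pi * dotp x ((p.1 : 'rV[R]_n) + p.2)) * (A p.1 * D [::] p.1 p.2).
pose F' (p : borelRn R n * borelRn R n) : C R :=
  cexpi (2 * pi * dotp x p.2) * (A p.1 * D [::] p.1 ((p.2 : 'rV[R]_n) - p.1)).
have mF0 : cmeas (fun z : borelRn R (n + n) =>
  cexpi (2 * pi * dotp x (lsubmx (z : 'rV[R]_(n + n)) + rsubmx (z : 'rV[R]_(n + n)))) *
  (A (lsubmx (z : 'rV[R]_(n + n))) *
   D [::] (lsubmx (z : 'rV[R]_(n + n))) (rsubmx (z : 'rV[R]_(n + n))))).
  apply: cmeasM; last by apply: cmeasM => //; exact: (cmeas_comp mA (@lsubmx_measurable R n n)).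
  apply: cmeas_cexpi; apply: measurable_funM; first exact: measurable_cst.
  apply: dotp_measurable; first exact: measurable_cst.
  apply: measurable_fun_rV => i; under eq_fun do rewrite !mxE.
  by apply: measurable_funD; exact: coord_measurable.
have FE p : F p = (fun z : 'rV[R]_(n + n) => cexpi (2 * pi * dotp x (lsubmx z + rsubmx z)) *
   (A (lsubmx z) * D [::] (lsubmx z) (rsubmx z))) (row_mx p.1 p.2).
  by rewrite /F row_mxKl row_mxKr.
have mF : cmeas F.
  by rewrite (funext FE); exact: cmeas_cat mF0.
have mF' : cmeas F'.
  apply: cmeasM (conv_integrand_measurable [::]).
  exact: (cmeas_comp (cmeas_char x) (@measurable_snd _ _ _ _)).
(* Translated weights have the same mass, hence a bound uniform in [xi] for [cible_prod]. *)
have wr xi : rible (@lebm R n) (fun z : borelRn R n => K * wgtn ((z : 'rV[R]_n) - xi)) /\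
    rI (@lebm R n) (fun z : borelRn R n => K * wgtn ((z : 'rV[R]_n) - xi)) = rI (@lebm R n) (fun z => K * wgtn z).
  rewrite (_ : (fun z : borelRn R n => _) = (fun z : borelRn R n => K * wgtn (1 *: (z : 'rV[R]_n) - xi))).
    have [h1 ->] := rI_affine (- xi) (@ltr01 R) (ribleZ K (wgtn_rible R n)).
    by rewrite expr1n mul1r.
  by apply/funext => y; rewrite scale1r.
have [|hF1 hF2] := cible_prod (f := F) (K := rI (@lebm R n) (fun z => K * wgtn z)) mF (cible_cabs iA)
  (fun _ => ribleZ K (wgtn_rible R n)) (fun _ => cabs_ge0 _) (fun _ => lexx _).
  by move=> xi y; rewrite /F /= !cabsM cabs_cexpi mul1r ler_wpM2l ?cabs_ge0.
have [||hF1' hF2'] := cible_prod (f := F') (K := rI (@lebm R n) (fun z => K * wgtn z)) mF' (cible_cabs iA)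
  (fun xi => (wr xi).1) (fun _ => cabs_ge0 _).
- by move=> xi; rewrite (wr xi).2.
- by move=> xi z; rewrite /F' /= !cabsM cabs_cexpi mul1r ler_wpM2l ?cabs_ge0.
have hF3 z : cible (@lebm R n) (fun xi => F' (xi, z)).
  exact: (cibleZ (cexpi (2 * pi * dotp x z)) (@conv_cible [::] z isT isT)).
have [c1 c2] := cfubini2 hF1' hF3.
have E : (fun z : borelRn R n => conv [::] z * cexpi (2 * pi * dotp x z)) =
    (fun z => cI (@lebm R n) (fun xi => F' (xi, z))).
  by apply/funext => z; rewrite mulrC -(cIZ _ (@conv_cible [::] z isT isT)).
rewrite E; split=> //; rewrite -c2 TE (cI_cat mF0); last by rewrite -(funext FE).
rewrite -(funext FE) (cfubini1 hF1 hF2).2 (cfubini1 hF1' hF2').2.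
congr cI; apply/funext => xi.
have [_ ->] := cI_affine (- xi) (@ltr01 R) (hF2 xi).
rewrite expr1n mul1r; congr cI; apply/funext => z.
by rewrite /F /F' /= scale1r addrCA subrr addr0.
Qed.

Hypothesis hT : forall ds, (size ds <= N)%N -> cible (@lebm R n) (Xds ds T : borelRn R n -> C R).

(** Fourier inversion with [v = conv [::]] and [V = T]; the integrability of [T] is the case [ds =
    [::]] of [hT]. *)
Lemma ft_conv z : ft T z = conv [::] z.
Proof.
have [K K0 hK] := hD; have [B B0 hB] := @bD [::] isT isT.
have hc : cible (@lebm R n) (conv [::] : borelRn R n -> C R).
  have [] := oscillatory_conv 0; rewrite (_ : (fun z => _) = (conv [::] : borelRn R n -> C R)) //.
  apply/funext => y; rewrite (_ : dotp 0 y = 0) ?mulr0 ?cexpi0 ?mulr1 //.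
  by rewrite /dotp big1 // => i _; rewrite mxE mul0r.
apply/esym; apply: (fourier_inversion (M := 2 * rI (@lebm R n) (fun xi => B * cabs (A xi))) hc).
- move=> y; apply: cI_le_dom; [exact: conv_slice_measurable|exact: ribleZ (cible_cabs iA)|].
  by move=> xi; rewrite cabsM mulrC ler_wpM2r ?cabs_ge0.
- by move=> x; exact: (oscillatory_conv x).2.
- by have := @hT [::] isT; rewrite Xds_nil.
(* Continuity of [conv [::]] along the sequences: the continuity of each [D [::] xi] passes through
   the integral. *)
move=> u; apply: (cI_dct (g := (fun xi : borelRn R n => B * cabs (A xi)))).
- by move=> k; exact: conv_slice_measurable.
- exact: conv_slice_measurable.
- exact: ribleZ (cible_cabs iA).
- by move=> k xi; rewrite cabsM mulrC ler_wpM2r ?cabs_ge0.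
move=> xi; apply: ccvgM; first exact: ccvg_cst.
have [c1 c2] := @cD [::] xi isT isT.
have h : (tk R k *: u + z - xi) @[k --> \oo] --> z - xi.
  rewrite [X in _ --> X](_ : _ = 0 *: u + z - xi); last by rewrite scale0r add0r.
  apply: cvgB; last exact: cvg_cst.
  by apply: cvgD; [apply: cvgZ; [exact: tk_cvg|exact: cvg_cst]|exact: cvg_cst].
by split; [exact: (cvg_comp _ _ h (c1 _))|exact: (cvg_comp _ _ h (c2 _))].
Qed.

Theorem ft_Xds_conv ds z : osorted ds -> (size ds <= N)%N -> ft (Xds ds T) z = conv ds z.
Proof.
elim: ds z => [|j ds IH] z oj sj; first by rewrite Xds_nil ft_conv.
have od : osorted ds by case/andP: oj.
have E : ft (Xds ds T) = conv ds by apply/funext => y; apply: IH => //; exact: ltnW.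
apply: cder_unique (conv_cder z oj sj); rewrite -E Xds_cons; apply: ft_cder_cible.
  by apply: hT; exact: ltnW.
by rewrite -Xds_cons; exact: hT.
Qed.

End KeyIdentity.

(** * The axes, and null sets in dimension 0 *)

Section NullSets.
Variable R : realType.

(** In dimension 0 every box has volume 1, an empty product, so the first box of any cover already
    contributes 1. *)
Lemma leb0_neq0 (m : nat) (Z : set (borelRn R m)) : m = 0%N -> leb Z <> 0%E.
Proof.
move=> m0 h; have : (1%:E <= leb Z)%E.
  apply: le_ereal_inf_tmp => _ [ab _ <-].
  apply: le_trans (nneseries_lim_ge 1%N _); last first.
    by move=> k _ _; rewrite lee_fin /boxvol prodr_ge0 // => i _; rewrite le_max lexx.
  rewrite big_nat1 lee_fin /boxvol big1 // => i; have := ltn_ord i.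
  by rewrite {2}m0.
by rewrite h lee_fin ler10.
Qed.

Lemma point0_measurable m : measurable ([set (0 : 'rV[R]_m) : borelRn R m] : set (borelRn R m)).
Proof.
rewrite -[X in measurable X]setCK; apply: measurableC; apply: open_borel.
rewrite openE => x /eqP/near_neq0; apply: (@filterS _ _ (nbhs_filter x)) => y /eqP h.
by move=> h'; apply: h.
Qed.

Lemma lebm_point0 m : (0 < m)%N -> lebm [set (0 : 'rV[R]_m) : borelRn R m] = 0%E.
Proof.
move=> m0; apply/eqP; rewrite eq_le measure_ge0 andbT.
apply/lee_addgt0Pr => e e0; rewrite add0e.
(* With [t <= 1] the remaining sides only shrink the volume t^m, so it is at most t <= e. *)
pose t := Num.min 1 e.
have t0 : 0 < t by rewrite lt_min ltr01.
apply: (@le_trans _ _ (lebm (box 0 (const_mx t : 'rV[R]_m)))).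
  apply: le_measure; rewrite ?inE; [exact: point0_measurable|exact: box_measurable|].
  by move=> _ -> i /=; rewrite !mxE lexx.
rewrite lebm_box lee_fin /boxvol (bigD1 (Ordinal m0)) //= !mxE subr0 max_r ?(ltW t0) //.
apply: (@le_trans _ _ (t * 1)); last by rewrite mulr1 /t ge_min lexx orbT.
rewrite ler_wpM2l ?(ltW t0) //; apply: prodr_ile1 => i _.
by rewrite !mxE subr0 le_max lexx /= ge_max ler01 /= /t ge_min lexx.
Qed.

Definition axes n : set (borelRn R (n + n)) :=
  [set z : 'rV[R]_(n + n) | lsubmx z = 0 \/ rsubmx z = 0].

Lemma axes_measurable n : measurable (@axes n).
Proof.
rewrite (_ : @axes n = (@lsubmx R 1 n n : borelRn R (n + n) -> borelRn R n) @^-1` [set 0] `|`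
   (@rsubmx R 1 n n : borelRn R (n + n) -> borelRn R n) @^-1` [set 0]) //.
apply: measurableU; rewrite -[X in measurable X]setTI.
  by apply: lsubmx_measurable => //; exact: point0_measurable.
by apply: rsubmx_measurable => //; exact: point0_measurable.
Qed.

Lemma lebm_axes n : (0 < n)%N -> lebm (@axes n) = 0%E.
Proof.
move=> n0; rewrite lebm_cat; last exact: axes_measurable.
apply/eqP; rewrite eq_le measure_ge0 andbT.
pose P : set (borelRn R n) := [set (0 : 'rV[R]_n)].
have mP : measurable P := @point0_measurable n.
have P0 : lebm P = 0%E := lebm_point0 n0.
have E : @catmx R n n @^-1` @axes n = P `*` setT `|` setT `*` P.
  apply/seteqP; split=> -[x y] /=; rewrite /axes /catmx /= row_mxKl row_mxKr.
    by move=> [->|->]; [left|right].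
  by move=> [[-> _]|[_ ->]]; [left|right].
rewrite E; apply: le_trans (measureU2 _ _ _) _; try exact: measurableX.
have h1 : ((@lebm R n \x @lebm R n) (P `*` setT) = 0)%E.
  by rewrite product_measure1E // [X in (X * _)%E](P0 : _ = _) mul0e.
have h2 : ((@lebm R n \x @lebm R n) (setT `*` P) = 0)%E.
  by rewrite product_measure1E // [X in (_ * X)%E](P0 : _ = _) mule0.
rewrite -[leRHS]adde0; apply: leeD; rewrite le_eqVlt; apply/orP; left; apply/eqP; [exact: h1|exact: h2].
Qed.

End NullSets.

Lemma cI_null d (T : measurableType d) (R : realType) (mu : {measure set T -> \bar R})
    (N : set T) (f g : T -> C R) : measurable N -> mu N = 0%E ->
  (forall x, ~ N x -> f x = g x) -> cI mu f = cI mu g.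
Proof.
move=> mN N0 h; apply: complex_ext; rewrite /= /rI /Rintegral; congr fine.
  by apply: (integral_null mN N0) => x /h ->.
by apply: (integral_null mN N0) => x /h ->.
Qed.

(** * Integrability of polynomial multiples of a decaying function *)

Section Decay.
Variables (R : realType) (n : nat).
Implicit Types (T v : 'rV[R]_n -> C R).

Lemma wgtn_measurable : measurable_fun setT (@wgtn R n : borelRn R n -> R).
Proof. exact: rible_meas (wgtn_rible R n). Qed.

(* The weight [wgtn] makes the integrand integrable in both variables, so that
   Fubini's theorem provides the measurability. *)
Lemma oscillatory_measurable v : cible (@lebm R n) (v : borelRn R n -> C R) ->
  cmeas (fun x : borelRn R n => cI (@lebm R n) (fun z : borelRn R n => v z * cexpi (2 * pi * dotp x z))).
Proof.
move=> hv; pose F (p : borelRn R n * borelRn R n) : C R :=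
  Complex (wgtn p.1) 0 * (v p.2 * cexpi (2 * pi * dotp p.1 p.2)).
have mF : cmeas F.
  apply: cmeasM.
    by apply: cmeasR; exact: (measurableT_comp wgtn_measurable (@measurable_fst _ _ _ _)).
  apply: cmeasM; first exact: (cmeas_comp (cible_meas hv) (@measurable_snd _ _ _ _)).
  apply: cmeas_cexpi; apply: measurable_funM; first exact: measurable_cst.
  by apply: dotp_measurable; [exact: measurable_fst|exact: measurable_snd].
have [|h1 h2] := cible_prod (f := F) (K := rI (@lebm R n) (fun z => cabs (v z))) mF (wgtn_rible R n)
  (fun _ => cible_cabs hv) (fun x => ltW (wgtn_gt0 x)) (fun _ => lexx _).
  by move=> x z; rewrite /F /= !cabsM cabs_cexpi mulr1 cabsR ger0_norm // ltW // wgtn_gt0.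
have [/cible_meas h3 _] := cfubini1 h1 h2.
have hc x : cible (@lebm R n) (fun z : borelRn R n => v z * cexpi (2 * pi * dotp x z)).
  apply: cible_char => //; apply: measurable_funM; first exact: measurable_cst.
  by apply: dotp_measurable; [exact: measurable_cst|exact: measurable_id].
rewrite (_ : (fun x => _) = (fun x : borelRn R n => Complex (\prod_(i < n) (1 + (x : 'rV[R]_n) 0 i ^+ 2)) 0 *
    cI (@lebm R n) (fun z => F (x, z)))).
  apply: cmeasM => //; apply: cmeasR; apply: measurable_prod => i _.
  apply: measurable_funD; first exact: measurable_cst.
  by apply: measurable_funX; exact: coord_measurable.
apply/funext => x; rewrite /F /= cIZ // mulrA -complexRM /wgtn -big_split /= big1 ?mul1r //.
by move=> i _; rewrite mulfV // oneD_neq0.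
Qed.

Lemma Xds_decay_cible T (N : nat) (M Cb r0 : R) ds : (size ds <= N)%N ->
  cmeas (T : borelRn R n -> C R) -> (forall x, cabs (T x) <= M) ->
  (forall x, r0 < enorm x -> cabs (T x) <= Cb * enorm x ^- (2 * n + N + 1)) ->
  cible (@lebm R n) (Xds ds T : borelRn R n -> C R).
Proof.
move=> sd mT hM hC; pose p : R := 2 * pi; pose q := Num.max 1 r0.
have p0 : 0 <= p by rewrite mulr_ge0 // pi_ge0.
have M0 : 0 <= M := le_trans (cabs_ge0 _) (hM 0).
have q1 : 1 <= q by rewrite le_max lexx.
have q0 : 0 <= q := le_trans ler01 q1.
(* The first summand covers |x| <= q, by the bound [M]. The second covers |x| > q >= 1: there 1 +
   |x|^2 <= 2 |x|^2, and |x|^(size ds + 2n) is absorbed by the decay since size ds <= N. The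
   comparison with [wgtn] uses (1 + |x|^2)^(-n) <= wgtn x. *)
pose K := (p * q) ^+ size ds * M * (1 + q ^+ 2) ^+ n + p ^+ size ds * `|Cb| * 2 ^+ n.
have hx x : cabs (Xds ds T x) <= (p * enorm x) ^+ size ds * cabs (T x).
  rewrite /Xds cabsM ler_wpM2r ?cabs_ge0 // cabs_prod.
  elim: (ds) => [|j s IH]; first by rewrite big_nil expr0.
  rewrite big_cons exprS; apply: ler_pM; rewrite ?cabs_ge0 //.
    by apply: prodr_ge0 => k _; exact: cabs_ge0.
  rewrite /xmul cabsE /= expr0n /= add0r sqrrN sqrtr_sqr dotp_ev normrM ger0_norm //.
  by rewrite ler_wpM2l //; apply: le_trans (rV_coord_le _ _) (normr_le_enorm _).
have hw (x : 'rV[R]_n) : (1 + enorm x ^+ 2) ^- n <= wgtn x.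
  rewrite -exprVn (_ : _ ^+ n = \prod_(i < n) (1 + enorm x ^+ 2)^-1); last first.
    by rewrite prodr_const card_ord.
  apply: ler_prod => i _.
  rewrite invr_ge0 addr_ge0 ?sqr_ge0 //= lef_pV2 ?posrE ?ltr_pwDl ?sqr_ge0 // lerD2l.
  rewrite -[X in X <= _]real_normK ?num_real // lerXn2r ?nnegrE ?sqrtr_ge0 //.
  exact: le_trans (rV_coord_le _ _) (normr_le_enorm _).
have hK (x : 'rV[R]_n) : (p * enorm x) ^+ size ds * cabs (T x) * (1 + enorm x ^+ 2) ^+ n <= K.
  have r_ge0 : 0 <= enorm x by rewrite sqrtr_ge0.
  have T0 := cabs_ge0 (T x); have TM := hM x; have TC := hC x.
  move: (enorm x) (cabs (T x)) r_ge0 T0 TM TC => r t r_ge0 t0 tM tC.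
  have pr0 : 0 <= (p * r) ^+ size ds by rewrite exprn_ge0 // mulr_ge0.
  have pq0 : 0 <= (p * q) ^+ size ds by rewrite exprn_ge0 // mulr_ge0.
  have ps0 : 0 <= p ^+ size ds by rewrite exprn_ge0.
  have s0 (y : R) : 0 <= (1 + y ^+ 2) ^+ n by rewrite exprn_ge0 // addr_ge0 // sqr_ge0.
  have prt0 : 0 <= (p * r) ^+ size ds * t by rewrite mulr_ge0.
  have pC0 : 0 <= p ^+ size ds * `|Cb| by rewrite mulr_ge0.
  have pqM0 : 0 <= (p * q) ^+ size ds * M by rewrite mulr_ge0.
  have t2 : 0 <= 2 ^+ n :> R by rewrite exprn_ge0.
  have [rq|qr] := leP r q.
    apply: le_trans (_ : _ <= (p * q) ^+ size ds * M * (1 + q ^+ 2) ^+ n) _; last first.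
      by rewrite lerDl mulr_ge0.
    have h1 : (p * r) ^+ size ds <= (p * q) ^+ size ds.
      apply: lerXn2r; rewrite ?nnegrE; [exact: mulr_ge0|exact: mulr_ge0|by rewrite ler_wpM2l].
    have h2 : (1 + r ^+ 2) ^+ n <= (1 + q ^+ 2) ^+ n.
      apply: lerXn2r; rewrite ?nnegrE ?addr_ge0 ?sqr_ge0 // lerD2l.
      by apply: lerXn2r; rewrite ?nnegrE.
    by apply: ler_pM => //; apply: ler_pM.
  have r1 : 1 <= r by apply: ltW; exact: le_lt_trans q1 qr.
  have rp : 0 < r by exact: lt_le_trans ltr01 r1.
  have {}tC : t <= `|Cb| * r ^- (2 * n + N + 1).
    apply: le_trans (tC _) _; first by apply: le_lt_trans qr; rewrite le_max lexx orbT.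
    by rewrite ler_wpM2r ?ler_norm // invr_ge0 exprn_ge0.
  apply: le_trans (_ : _ <= p ^+ size ds * `|Cb| * 2 ^+ n) _; last first.
    by rewrite lerDr mulr_ge0.
  apply: (@le_trans _ _ ((p * r) ^+ size ds * (`|Cb| * r ^- (2 * n + N + 1)) * (2 * r ^+ 2) ^+ n)).
    apply: ler_pM => //; first by rewrite ler_wpM2l.
    apply: lerXn2r; rewrite ?nnegrE ?mulr_ge0 ?addr_ge0 ?sqr_ge0 //.
    by rewrite mulr2n mulrDl mul1r lerD2r exprn_ege1.
  have h : r ^+ size ds * r ^+ (2 * n) <= r ^+ (2 * n + N + 1).
    by rewrite -exprD ler_weXn2l // addnC -addnA leq_add2l (leq_trans sd) // leq_addr.
  rewrite (exprMn _ p r) (exprMn _ 2 (r ^+ 2)) -exprM.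
  rewrite (_ : _ * _ = p ^+ size ds * `|Cb| * 2 ^+ n *
     (r ^+ size ds * r ^+ (2 * n) / r ^+ (2 * n + N + 1))); last by ring.
  rewrite ler_piMr ?mulr_ge0 // ler_pdivrMr ?exprn_gt0 // mul1r.
  exact: h.
apply: (cible_dom _ (ribleZ K (wgtn_rible R n))) => [|x].
  by apply: cmeasM => //; apply: cmeas_prod => j; exact: (ccont_meas (ccont_xmul _)).
apply: le_trans (hx x) _; have w0 : 0 < (1 + enorm x ^+ 2) ^+ n.
  by rewrite exprn_gt0 // ltr_pwDl // sqr_ge0.
apply: le_trans (_ : _ <= K * (1 + enorm x ^+ 2) ^- n) _.
  by rewrite ler_pdivlMr.
rewrite ler_wpM2l //; apply: addr_ge0;
  by do !(apply: mulr_ge0 || apply: exprn_ge0 || apply: addr_ge0) => //.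
Qed.

End Decay.

(** * Moments of the operator and recovery of the symbol on the antidiagonal *)

Section OperatorMoments.
Variables (R : realType) (n N : nat) (sigma : 'rV[R]_n -> 'rV[R]_n -> C R).
Hypothesis n0 : (0 < n)%N.
Implicit Types (a T : 'rV[R]_n -> C R) (x xi z : 'rV[R]_n).

(** The two integrands differ only on the axes, where [sder] is set to 0; in positive dimension the
    axes are null. *)
Lemma TsigE a1 a2 x : Tsig sigma a1 a2 x =
  cI (@lebm R (n + n)) (fun z : borelRn R (n + n) =>
  cexpi (2 * pi * dotp x (lsubmx (z : 'rV[R]_(n + n)) + rsubmx (z : 'rV[R]_(n + n)))) *
  (ft a1 (lsubmx (z : 'rV[R]_(n + n))) *
   leib sigma a2 [::] (lsubmx (z : 'rV[R]_(n + n))) (rsubmx (z : 'rV[R]_(n + n))))).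
Proof.
rewrite /Tsig cintE ?addn_gt0 ?n0 //.
apply: (cI_null (@axes_measurable R n) (lebm_axes R n0)) => z hz.
have l0 : lsubmx (z : 'rV[R]_(n + n)) != 0 by apply/eqP => h; apply: hz; left.
have r0 : rsubmx (z : 'rV[R]_(n + n)) != 0 by apply/eqP => h; apply: hz; right.
rewrite /leib /= big_seq1 Xds_nil sder_nil // /fourier !cintE // -!mulrA; congr (_ * _).
exact: mulrCA.
Qed.

(** [Xds (canon al)] multiplies by the monomial x^al up to the nonzero constant (- 2 pi i)^|al|. *)
Lemma moment_eq0 al T : cible (@lebm R n) (Xds (canon al) T : borelRn R n -> C R) ->
  (cint (fun x => Complex (mono al x) 0 * T x) = 0) <-> (ft (Xds (canon al) T) 0 = 0).
Proof.
move=> hX; pose c : C R := Complex 0 (- (2 * pi)) ^+ size (canon al).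
have c0 : c != 0.
  have hp : 2 * pi != 0 :> R by rewrite mulf_neq0 // gt_eqF // pi_gt0.
  by rewrite expf_neq0 // eq_complex /= negb_and oppr_eq0 hp orbT.
have XE x : Xds (canon al) T x = c * (cmono al x * T x).
  by rewrite /Xds prod_xmul canon_count mulrA.
have hM : cible (@lebm R n) (fun x : borelRn R n => cmono al x * T x).
  rewrite (_ : (fun x => _) = (fun x => c^-1 * Xds (canon al) T x)); first exact: cibleZ.
  by apply/funext => x; rewrite XE mulKf.
have E : ft (Xds (canon al) T) 0 = c * cI (@lebm R n) (fun x : borelRn R n => cmono al x * T x).
  by rewrite ft0E (_ : Xds _ _ = fun x => c * (cmono al x * T x)) ?cIZ //; exact/funext.
rewrite cintE // E; split=> [->|/eqP]; first by rewrite mulr0.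
by rewrite mulf_eq0 (negbTE c0) /= => /eqP.
Qed.

Hypothesis Hsmooth : csmooth_on
  [set z : 'rV[R]_(n + n) | lsubmx z != 0 /\ rsubmx z != 0] (uncurry2 sigma).
Hypothesis Hbound : forall a1 a2 : 'I_n -> nat, exists Ca : R,
  forall xi eta : 'rV[R]_n, xi != 0 -> eta != 0 ->
    cabs (pd12 a1 a2 sigma xi eta) <= Ca * (enorm xi ^- mlen a1) * (enorm eta ^- mlen a2).
Hypothesis HT : forall f1 f2 : 'rV[R]_n -> C R, ON N f1 -> ON N f2 ->
  exists b : 'rV[R]_n -> R,
    [/\ loc_integrable b,
        (exists Cb r0 : R, forall x, r0 < enorm x -> b x <= Cb * enorm x ^- (2 * n + N + 1)) &
        forall x, cabs (Tsig sigma f1 f2 x) <= b x].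

Lemma leib_bounded a ds : ON N a -> osorted ds -> (size ds <= N)%N ->
  exists2 K, 0 <= K & forall xi eta, cabs (leib sigma a ds xi eta) <= K.
Proof.
move=> ha od sd; have [K K0 hK] := leib_bound n0 Hbound ha od sd.
exists K => // xi eta; apply: le_trans (hK xi eta) _.
by rewrite ler_piMr // ge_min lexx.
Qed.

Section Inputs.
Variables a1 a2 : 'rV[R]_n -> C R.
Hypotheses (h1 : ON N a1) (h2 : ON N a2).

Let mA : cmeas (ft a1 : borelRn R n -> C R) := ccont_meas (ft_ccont (SC_cc (ON_SC h1))).
Let hA := ft_decay (ON_SC h1).
Let mD := leib_measurable Hsmooth h2.
Let hD := leib_nil_dom Hbound h2.

Let bD ds := @leib_bounded a2 ds h2.

(** Measurability and a global bound come from the oscillatory integral, the decay at infinity from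
    [HT]. *)
Lemma Tsig_Xds_cible ds : (size ds <= N)%N ->
  cible (@lebm R n) (Xds ds (Tsig sigma a1 a2) : borelRn R n -> C R).
Proof.
move=> sd.
have hO := @oscillatory_conv R n N (ft a1) (Tsig sigma a1 a2) (leib sigma a2) mA hA mD hD bD (TsigE a1 a2).
have hc : cible (@lebm R n) (conv (ft a1) (leib sigma a2) [::] : borelRn R n -> C R).
  have [] := hO 0; rewrite (_ : (fun z => _) = (conv (ft a1) (leib sigma a2) [::] : borelRn R n -> C R)) //.
  apply/funext => y; rewrite (_ : dotp 0 y = 0) ?mulr0 ?cexpi0 ?mulr1 //.
  by rewrite /dotp big1 // => i _; rewrite mxE mul0r.
have [b [_ [Cb [r0 hb]] Tb]] := HT h1 h2.
apply: (@Xds_decay_cible R n _ N (2 * rI (@lebm R n) (fun z : borelRn R n => cabs (conv (ft a1) (leib sigma a2) [::] z))) Cb r0) => //.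
- rewrite (funext (fun x => (hO x).2)); exact: oscillatory_measurable.
- move=> x; rewrite (hO x).2; apply: cI_le_dom; [exact: cible_meas (hO x).1|exact: cible_cabs|].
  by move=> z; rewrite cabsM cabs_cexpi mulr1.
by move=> x hx; apply: le_trans (Tb x) (hb x hx).
Qed.

(** Moments are derivatives at frequency z = 0, where the argument z - xi becomes - xi: hence the
    antidiagonal. *)
Lemma moment_leib ds : osorted ds -> (size ds <= N)%N ->
  ft (Xds ds (Tsig sigma a1 a2)) 0 =
  cI (@lebm R n) (fun xi : borelRn R n => ft a1 xi * leib sigma a2 ds xi (- (xi : 'rV[R]_n))).
Proof.
move=> od sd.
have cD es xi : osorted es -> (size es <= N)%N -> ccont (leib sigma a2 es xi).
  exact: (leib_ccont n0 Hsmooth Hbound h2).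
have dD es xi eta j : osorted (j :: es) -> (size (j :: es) <= N)%N ->
    cder (leib sigma a2 es xi) eta (ev R j) (leib sigma a2 (j :: es) xi eta).
  exact: (leib_cder n0 Hsmooth Hbound h2).
have E := @ft_Xds_conv R n N (ft a1) (Tsig sigma a1 a2) (leib sigma a2) mA hA mD hD bD cD dD
  (TsigE a1 a2) Tsig_Xds_cible ds 0 od sd.
apply: etrans E _; rewrite /conv; congr cI; apply/funext => xi.
by rewrite sub0r.
Qed.

End Inputs.

(** Both arguments move, so this uses the joint continuity of the derivatives in the 2n
    variables. *)
Lemma sder_antidiagonal_ccontat ds z : z != 0 -> ccontat (fun xi => sder sigma ds xi (- xi)) z.
Proof.
move=> z0; pose f xi := sder0 sigma ds (row_mx xi (- xi)).
have U : [set z : 'rV[R]_(n + n) | lsubmx z != 0 /\ rsubmx z != 0] (row_mx z (- z)).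
  by rewrite /= row_mxKl row_mxKr oppr_eq0.
have [/(_ (map (@rshift n n) ds) _ U)[_ c1] /(_ (map (@rshift n n) ds) _ U)[_ c2]] := Hsmooth.
have cr : continuous (fun xi : 'rV[R]_n => row_mx xi (- xi)).
  apply: nonexpansive_continuous => x y; apply: rV_norm_le => // i.
  rewrite -[- row_mx _ _]scaleN1r scale_row_mx add_row_mx !scaleN1r.
  case: (fintype.split_ordP i) => j ->; first by rewrite row_mxEl rV_coord_le.
  by rewrite row_mxEr -opprD [X in `|X|]mxE normrN rV_coord_le.
apply: (@near_ccontat _ _ f); last first.
- by split; [exact: (cvg_comp _ _ (cr z) c1)|exact: (cvg_comp _ _ (cr z) c2)].
- by rewrite /f /sder oppr_eq0 (negbTE z0).
apply: (@filterS _ _ (nbhs_filter z) _ _ _ (near_neq0 z0)) => y /negbTE y0.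
by rewrite /f /sder oppr_eq0 y0.
Qed.

Lemma sder_eq0 : (forall a1 a2, ON N a1 -> ON N a2 -> forall ds, osorted ds -> (size ds <= N)%N ->
    ft (Xds ds (Tsig sigma a1 a2)) 0 = 0) ->
  forall ds, osorted ds -> (size ds <= N)%N -> forall z, z != 0 -> sder sigma ds z (- z) = 0.
Proof.
move=> hm ds; have [k] := ubnP (size ds); elim: k ds => // k IH ds sk od sd z z0.
(* The direction of differentiation of both test functions: it makes the multiplier (2 pi i
   xi_i)^(N+1) nonzero at [z] and at [- z]. *)
have [i zi] : exists i, z 0 i != 0.
  apply/existsP; apply: contra_neqT z0; rewrite negb_exists => /forallP h.
  by apply/rowP => i; rewrite mxE; apply/eqP; move: (h i); rewrite negbK.
have hp : 2 * pi != 0 :> R by rewrite mulf_neq0 // gt_eqF // pi_gt0.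
have c0 (t : R) : t != 0 -> Complex 0 (2 * pi * t) ^+ N.+1 != 0 :> C R.
  by move=> t0; rewrite expf_neq0 // eq_complex /= negb_and mulf_neq0 ?orbT.
have [r hr] := ft_cbump_neq0 z n0.
have [s hs] := ft_cbump_neq0 (- z) n0.
pose F y := iter N.+1 (cpd i) (cbump r y).
have FON y : ON N (F y) by apply: ON_iter n0 (SC_cbump r y).
pose a2 := iter N.+1 (cpd i) (@cbump R n s 0).
have a2ON : ON N a2 by apply: ON_iter n0 (SC_cbump s 0).
(* The other terms carry a shorter sorted list of derivatives of the symbol and vanish on the
   antidiagonal by induction. *)
have lead xi : leib sigma a2 ds xi (- xi) = sder sigma ds xi (- xi) * ft a2 (- xi).
  have [->|x0] := eqVneq xi 0; first by rewrite leib_xi0 /sder eqxx mul0r.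
  have [ps E hps] := splitsE ds.
  rewrite /leib E big_cons Xds_nil /= big1_seq ?addr0 // => p /andP[_ pp].
  have p1 := hps p pp; have pds : p \in splits ds by rewrite E inE pp orbT.
  rewrite IH ?mul0r //; first exact: leq_trans p1 sk.
    exact: splits_pairwise pds od.
  exact: leq_trans (ltnW p1) sd.
pose v xi := ft (F 0) xi * leib sigma a2 ds xi (- xi).
have [K2 _ hK2] := leib_bounded a2ON od sd.
have [B _ hB] := ft_bounded (cc_cible (SC_cc (ON_SC (FON 0)))).
have iv : cible (@lebm R n) (v : borelRn R n -> C R).
  have hc := @conv_cible R n N (ft (F 0)) (leib sigma a2)
    (ccont_meas (ft_ccont (SC_cc (ON_SC (FON 0))))) (ft_decay (ON_SC (FON 0)))
    (leib_measurable Hsmooth a2ON)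
    (fun es => leib_bounded a2ON) ds 0 od sd.
  rewrite (_ : v = fun xi => ft (F 0) xi * leib sigma a2 ds xi (0 - xi)) //.
  by apply/funext => xi; rewrite sub0r.
(* For every [x] the inverse transform of [v] is the moment obtained with [F (- x)] as first input,
   which vanishes by [hm]; so inversion applies with [V = 0]. Continuity of [v] is available at [z]
   because [z] is nonzero. *)
have v0 : v z = 0.
  rewrite (@fourier_inversion R n v (fun=> 0) z (B * K2) iv).
  - by under [X in cI _ X]eq_fun do rewrite mul0r; rewrite cI0.
  - by move=> xi; rewrite /v cabsM ler_pM ?cabs_ge0.
  - move=> x; have := hm _ _ (FON (- x)) a2ON ds od sd.
    rewrite (moment_leib (FON (- x)) a2ON od sd) => <-; congr cI; apply/funext => xi.
    rewrite /v /F !ft_iter; [|exact: SC_cbump..].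
    rewrite (cbump_translate r (- x)) -!mulrA; congr (_ * (_ * _)).
    rewrite mulrC; congr (_ * cexpi _).
    by rewrite !mulrA (dotpC (- x)) dotpNr mulrN opprK dotpC.
  - exact: cible0.
  have cv : ccontat v z.
    rewrite /v; under eq_fun do rewrite lead; apply: ccontatM.
      by have [c1 c2] := ft_ccont (SC_cc (ON_SC (FON 0))); split; [exact: c1|exact: c2].
    apply: ccontatM; first exact: sder_antidiagonal_ccontat.
    have [c1 c2] := ft_ccont (SC_cc (ON_SC a2ON)).
    have co : (- xi : 'rV[R]_n) @[xi --> z] --> - z by exact: opp_continuous.
    by split; [exact: (cvg_comp _ _ co (c1 _))|exact: (cvg_comp _ _ co (c2 _))].
  move=> u; have h : (tk R k *: u + z) @[k --> \oo] --> z.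
    rewrite [X in _ --> X](_ : _ = 0 *: u + z); last by rewrite scale0r add0r.
    by apply: cvgD; [apply: cvgZ; [exact: tk_cvg|exact: cvg_cst]|exact: cvg_cst].
  by split; [exact: (cvg_comp _ _ h cv.1)|exact: (cvg_comp _ _ h cv.2)].
move/eqP: v0; rewrite /v lead mulf_eq0 mulf_eq0.
rewrite /F ft_iter; last exact: SC_cbump.
rewrite mulf_eq0 (negbTE (c0 _ zi)) (negbTE hr) /= => /orP[/eqP //|].
rewrite /a2 ft_iter; last exact: SC_cbump.
by rewrite mulf_eq0 (negbTE hs) orbF (negbTE (c0 _ _)) // mxE oppr_eq0.
Qed.

End OperatorMoments.

Theorem theorem3p1 (R : realType) (n N : nat)
  (sigma : 'rV[R]_n -> 'rV[R]_n -> C R)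
  (Hinf : Linfty (uncurry2 sigma))
  (Hsmooth : csmooth_on
     [set z : 'rV[R]_(n + n) | lsubmx z != 0 /\ rsubmx z != 0] (uncurry2 sigma))
  (Hbound : forall a1 a2 : 'I_n -> nat, exists Ca : R,
     forall xi eta : 'rV[R]_n, xi != 0 -> eta != 0 ->
       cabs (pd12 a1 a2 sigma xi eta)
         <= Ca * (enorm xi ^- mlen a1) * (enorm eta ^- mlen a2))
  (HT : forall f1 f2 : 'rV[R]_n -> C R, ON N f1 -> ON N f2 ->
     exists b : 'rV[R]_n -> R,
       [/\ loc_integrable b,
           (exists Cb r0 : R, forall x, r0 < enorm x ->
               b x <= Cb * enorm x ^- (2 * n + N + 1)) &
           forall x, cabs (Tsig sigma f1 f2 x) <= b x]) :
  (forall al : 'I_n -> nat, (mlen al <= N)%N ->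
     forall xi : 'rV[R]_n, xi != 0 ->
       pd12 (fun _ => 0%N) al sigma xi (- xi) = 0)
  <->
  (forall f1 f2 : 'rV[R]_n -> C R, ON N f1 -> ON N f2 ->
     forall al : 'I_n -> nat, (mlen al <= N)%N ->
       cint (fun x => Complex (mono al x) 0 * Tsig sigma f1 f2 x) = 0).
Proof.
have n0 : (0 < n)%N.
  rewrite lt0n; apply/eqP => n0; have [_ [_ [_ [Z [_ Z0 _]]]]] := Hinf.
  by apply: (leb0_neq0 _ Z0); rewrite n0.
split=> [ha f1 f2 h1 h2 al hal|hb al hal xi xi0].
  have sal : (size (canon al) <= N)%N by rewrite -mlen_canon.
  apply/(moment_eq0 n0 (Tsig_Xds_cible n0 Hsmooth Hbound HT h1 h2 sal)).
  rewrite (moment_leib n0 Hsmooth Hbound HT h1 h2 (canon_osorted al) sal).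
  rewrite (_ : (fun xi => _) = fun=> 0) ?cI0 //; apply/funext => xi.
  rewrite /leib big1_seq ?mulr0 // => p /andP[_ hp].
  have [->|xi0] := eqVneq (xi : 'rV[R]_n) 0; first by rewrite /sder eqxx mul0r.
  (* The sublist of derivatives falling on the symbol is sorted, hence canonical for its own
     multiindex, to which (a) applies. *)
  rewrite (osortedE (splits_pairwise hp (canon_osorted al))) sder_pd12 ?oppr_eq0 //.
  rewrite ha ?mul0r // mlen_count; apply: leq_trans sal.
  by rewrite -(splits_size hp) leq_addr.
have sal : (size (canon al) <= N)%N by rewrite -mlen_canon.
rewrite -sder_pd12 ?oppr_eq0 //.
apply: (sder_eq0 n0 Hsmooth Hbound HT) => //; last exact: canon_osorted.
(* A sorted list is the canonical list of its multiplicities, so (b) covers all lists required by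
   [sder_eq0]. *)
move=> a1 a2 h1 h2 ds od sd; rewrite (osortedE od).
apply/(moment_eq0 n0); first by rewrite -(osortedE od); exact: (Tsig_Xds_cible n0 Hsmooth Hbound HT h1 h2 sd).
by apply: hb; rewrite ?mlen_count.
Qed.
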